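(* (a) For every $d \geq 2$ there exist constants $\bar a_d, \bar b_d, \rho_d, \bar\varepsilon_d \in (0,1)$, depending only on $d$, such that for all Borel sets $E, F \subseteq [0,1]^d$ with $\min\{\mathcal H^s_\infty(E), \mathcal H^s_\infty(F)\} \geq 1-\rho_d$ one has $$\Delta(E,F) \supseteq [\bar a_d, \bar b_d], \quad \text{provided } s \geq d - \bar\varepsilon_d .$$ (b) For every $d \geq 2$ there exists a constant $\rho_d \in (0,1)$ with the following property. For every $\rho \in (0,\rho_d]$ one can find $a_\rho, b_\rho, \varepsilon_\rho$, depending on $\rho$, such that for all Borel sets $E, F \subseteq [0,1]^d$, $$\Delta(E,F) \supseteq [a_\rho, b_\rho], \quad \text{provided } \min\{\mathcal H^s_\infty(E), \mathcal H^s_\infty(F)\} \geq 1-\rho \ \text{ and } \ s \geq d - \varepsilon_\rho .$$ The parameters $a_\rho, b_\rho, \varepsilon_\rho$ tend to $0$ as $\rho \to 0$. More precisely, there exists a constant $c_0 > 0$ depending only on $d$ such that for any $\kappa \in (0,1)$, the parameters $a_\rho, b_\rho, \varepsilon_\rho$ can be chosen to obey $$a_\rho = \rho^{c_0}, \qquad b_\rho = a_\rho^{\kappa} = \rho^{c_0\kappa}, \qquad \varepsilon_\rho = \frac{c_0\rho}{\log(1/\rho)},$$ provided $\rho$ is sufficiently small depending on $\kappa$.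
   Context: For $E, F \subseteq \mathbb R^d$, the distance set is $\Delta(E,F) = \{|x-y| : x \in E,\ y \in F\}$, with $|\cdot|$ the Euclidean norm. $\mathcal Q_d$ is the collection of all closed dyadic cubes in $\mathbb R^d$, and $\ell(Q)$ is the side-length of a cube $Q$. For $s \in (0,d]$, the $s$-dimensional dyadic Hausdorff content of $E$ is $$\mathcal H^s_\infty(E) = \inf\Big\{\sum_{i=1}^\infty \ell(Q_i)^s : E \subseteq \bigcup_{i=1}^\infty Q_i,\ Q_i \in \mathcal Q_d\Big\}.$$ *)

(* Defs.v *)
From HB Require Import structures.
From mathcomp Require Import all_boot all_order all_algebra.
From mathcomp Require Import all_classical all_reals all_analysis.

Set Implicit Arguments.
Unset Strict Implicit.
Unset Printing Implicit Defensive.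

Import Order.TTheory GRing.Theory Num.Theory.
Import numFieldNormedType.Exports.

Local Open Scope classical_set_scope.
Local Open Scope ring_scope.

(* R^d is 'rV[R]_d.  The library norm `|x| on matrices is the sup norm, hence
   the separate Euclidean norm; the library topology is the usual one. *)
Definition eucl_norm (R : realType) (d : nat) (x : 'rV[R]_d) : R :=
  Num.sqrt (\sum_(i < d) x 0 i ^+ 2).

Definition distance_set (R : realType) (d : nat) (E F : set 'rV[R]_d) : set R :=
  [set t | exists x y, [/\ E x, F y & t = eucl_norm (x - y)]].

Definition unit_cube (R : realType) (d : nat) : set 'rV[R]_d :=
  [set x : 'rV[R]_d | forall i : 'I_d, 0 <= x 0 i <= 1].

Definition borel_set (R : realType) (d : nat) (E : set 'rV[R]_d) : Prop :=
  <<s (@open 'rV[R]_d) >> E.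

(* The pair (j, k) encodes the closed dyadic cube
   \prod_i [2^-j k_i, 2^-j (k_i + 1)]; all scales j in Z are allowed. *)
Definition dyadic (d : nat) : Type := (int * 'rV[int]_d)%type.

Definition side (R : realType) (d : nat) (Q : dyadic d) : R := 2 ^ (- Q.1).

Definition cube (R : realType) (d : nat) (Q : dyadic d) : set 'rV[R]_d :=
  [set x : 'rV[R]_d | forall i : 'I_d,
     side R Q * (Q.2 0 i)%:~R <= x 0 i <= side R Q * (Q.2 0 i + 1)%:~R].

Definition dyadic_content (R : realType) (d : nat) (s : R) (E : set 'rV[R]_d)
    : \bar R :=
  ereal_inf [set (\sum_(0 <= i <oo) (side R (Q i) `^ s)%:E)%E
            | Q in [set Q : nat -> dyadic d | E `<=` \bigcup_i cube (Q i)]].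

Definition distances_contain_itv (R : realType) (d : nat) (rho a b eps : R)
    : Prop :=
  forall E F : set 'rV[R]_d,
    borel_set E -> borel_set F ->
    E `<=` @unit_cube R d -> F `<=` @unit_cube R d ->
  forall s : R, 0 < s <= d%:R -> d%:R - eps <= s ->
    ((1 - rho)%:E <= Order.min (dyadic_content s E) (dyadic_content s F))%E ->
    [set` `[a, b]] `<=` distance_set E F.

(* The requirement a rho < b rho keeps `[a rho, b rho] from being empty, in
   which case the containment would be void. *)
Definition admissible (R : realType) (d : nat) (rho_d : R) (a b eps : R -> R)
    : Prop :=
  forall rho : R, 0 < rho <= rho_d ->
    [/\ 0 < a rho, a rho < b rho, 0 < eps rho &
        distances_contain_itv d rho (a rho) (b rho) (eps rho)].

(* Main.v *)
Require Import Defs.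
From HB Require Import structures.
From mathcomp Require Import all_boot all_order all_algebra.
From mathcomp Require Import all_classical all_reals all_analysis.
From mathcomp Require Import zify ring lra.
Import Order.TTheory GRing.Theory Num.Theory.
Import numFieldNormedType.Exports.
Local Open Scope classical_set_scope.
Local Open Scope ring_scope.

(** Fix a distance [t].  A set of content close to [1] in a dimension [s] close to [d]
    carries, by Frostman's lemma, a measure that gives mass at most [l ^ s] to dyadic cubes
    of side [l] and has total mass close to [1].  Down to scales a little smaller than [t]
    such a measure looks like Lebesgue measure on the unit cube, because there [l ^ s] and
    [l ^ d] almost agree.  Hence, if [f] and [g] are the densities of two such measures
    averaged over cubes of such a side, the form that integrates [g x * f (x + v)] over [x]
    and over a piece of the sphere of vectors [v] of length [t], with a suitable measure, is
    bounded below ([sphere_form_main]).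

    The averaging scale is then refined, one binary digit of one coordinate at a time.
    Each refinement changes a density by an increment which has mean zero on small boxes,
    and averaging over a curved surface makes the norm of such an increment smaller by a
    power of the scale ([smoothing]), whereas the densities grow only like the scale to
    the power [s - d].  So the changes at all scales add up to less than the lower bound
    ([finite_level_positive]), and at every scale there are boxes meeting the two sets at
    distance nearly [t].  Compactness then yields the exact distance ([limit_distance]).

    Decay of spherical averages is obtained without Fourier analysis.  The squared norm
    of the average of [h] is a sum over pairs of points of the sphere of the
    autocorrelation of [h] at their difference.  Sphere points are parametrised by the
    squares of their coordinates; moving two points of a pair simultaneously, at suitable
    different speeds, moves the difference in any prescribed coordinate direction, in which
    the autocorrelation cancels.  This works unless the two points are nearly
    parallel ([two_parameter_sum]).  Everything takes place on a finite torus of grid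
    points, so all integrals are finite sums.

    Compactness requires closed subsets of nearly full content in Borel sets.  They come
    from Choquet's capacitability argument ([capacitability]), on the space of interleaved
    binary expansions; there cubes become cylinders, and content is strongly
    subadditive and continuous along increasing sequences ([content_bigcup]).

    The constants of the theorem only have to make [(Z / t) ^ (d - s)] close to [1] for all
    distances [t] in the interval, where [Z] depends on [d] alone.  In part (b) the
    exponent [c0 = 1] does it. *)

Set Implicit Arguments.
Unset Strict Implicit.
Unset Printing Implicit Defensive.

(** * Content on the binary tree *)

Notation word := (seq bool).

Definition covers (U : set word) (X : set (nat -> bool)) :=
  forall x, X x -> exists n, U (mkseq x n).

(** This says that the possibly infinite sum of [l] over [U] is at most [c]; only
    finite subsums occur, so no summability question arises. *)
Definition weight_le (R : realType) (l : word -> R) (U : set word) (c : R) :=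
  forall S : seq word, uniq S -> (forall w, w \in S -> U w) -> \sum_(w <- S) l w <= c.

(** The tree version of dyadic Hausdorff content: cylinders of infinite binary
    sequences play the role of the cubes, and [l w] is the cost of the cylinder of
    [w].  Cylinders are nested or disjoint, which closed cubes are not. *)
Definition content (R : realType) (l : word -> R) (X : set (nat -> bool)) : R :=
  inf [set c | exists2 U, covers U X & weight_le l U c].

Section Content.
Variables (R : realType) (l : word -> R).
Hypothesis l_ge0 : forall w, 0 <= l w.

Lemma content_set_lb X : lbound [set c | exists2 U, covers U X & weight_le l U c] 0.
Proof. by move=> c [U _ /(_ [::])]; rewrite big_nil; apply. Qed.

Lemma content_le U X c : covers U X -> weight_le l U c -> content l X <= c.
Proof.
move=> cov wU; apply: ge_inf; last by exists U.
by exists 0; exact: content_set_lb.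
Qed.

Lemma content_has_inf X :
  has_inf [set c | exists2 U, covers U X & weight_le l U c].
Proof.
split; last by exists 0; exact: content_set_lb.
exists (l [::]); exists [set [::]]; first by move=> x _; exists 0%N.
case=> [|w [|w' S]] /= uS HS; first by rewrite big_nil.
- by rewrite big_seq1 (HS w) ?inE.
- move: uS; rewrite (HS w) ?inE ?eqxx// (HS w') ?inE ?eqxx ?orbT//.
Qed.

Lemma content_lt X c : content l X < c -> exists2 U, covers U X & weight_le l U c.
Proof.
move=> /(inf_lt (content_has_inf X).1) [c' [U cU wU] c'c].
by exists U => // S uS HS; apply: (le_trans (wU S uS HS)); exact: ltW.
Qed.

Lemma le_content X Y : X `<=` Y -> content l X <= content l Y.
Proof.
move=> XY; apply: lb_le_inf; first exact: (content_has_inf Y).1.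
move=> c [U cU wU]; apply: (@content_le U) => // x /XY; exact: cU.
Qed.

(** The words generating the largest cylinders of two families: they cover everything
    that either family covers, without repetition. *)
Definition maximal_words (U V : set word) : set word :=
  [set w | (U w \/ V w) /\ forall n, (n < size w)%N -> ~ (U (take n w) \/ V (take n w))].

Lemma take_mkseq (T : Type) (x : nat -> T) m n :
  (m <= n)%N -> take m (mkseq x n) = mkseq x m.
Proof. by move=> mn; rewrite /mkseq -map_take take_iota (minn_idPl mn). Qed.

Lemma maximal_words_prefix (U V : set word) x n : U (mkseq x n) \/ V (mkseq x n) ->
  exists2 m, (m <= n)%N & maximal_words U V (mkseq x m).
Proof.
move=> h; pose P k := `[< U (mkseq x k) \/ V (mkseq x k) >].
have exP : exists k, P k by exists n; apply/asboolP.
case: (ex_minnP exP) => m /asboolP Pm mmin.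
exists m; first by apply: mmin; apply/asboolP.
split=> // k; rewrite size_mkseq => km; rewrite take_mkseq ?(ltnW km)// => hk.
by have /asboolP/mmin := hk; rewrite leqNgt km.
Qed.

(** Strong subadditivity.  Each point of [X] lies in a cylinder of [U] and in one of
    [V]; the smaller of the two is not maximal, so the words that are left over after
    removing the maximal ones from the multiset union of [U] and [V] still cover [X]
    and have total weight at least [content l X]. *)
Lemma maximal_words_weight (U V : set word) X a b :
  weight_le l U a -> weight_le l V b -> covers U X -> covers V X ->
  weight_le l (maximal_words U V) (a + b - content l X).
Proof.
move=> wU wV cU cV S1 uS1 S1W; set W := maximal_words U V in S1W.
rewrite lerBrDr -lerBrDl.
(* [Q] is the leftover: a word in both families is counted once as maximal and once
   here. *)
pose Q : set word := [set w | (U w /\ V w) \/ ((U w \/ V w) /\ ~ W w)].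
apply: (@content_le Q) => [x Xx|S2 uS2 S2Q].
  have [n Un] := cU _ Xx; have [m Vm] := cV _ Xx.
  have [mn|nm|e] := ltngtP m n.
  - exists n; right; split; first by left.
    move=> [_ /(_ m)]; rewrite size_mkseq => /(_ mn).
    by rewrite take_mkseq ?(ltnW mn)//; apply; right.
  - exists m; right; split; first by right.
    move=> [_ /(_ n)]; rewrite size_mkseq => /(_ nm).
    by rewrite take_mkseq ?(ltnW nm)//; apply; left.
  - by exists n; left; rewrite -{2}e.
pose u w := `[< U w >]; pose v w := `[< V w >].
have hU := wU ([seq w <- S1 | u w] ++ [seq w <- S2 | ~~ v w]).
have hV := wV ([seq w <- S1 | ~~ u w] ++ [seq w <- S2 | v w]).
have {}hU : \sum_(w <- S1 | u w) l w + \sum_(w <- S2 | ~~ v w) l w <= a.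
  rewrite -[X in X + _]big_filter -[X in _ + X]big_filter -big_cat; apply: hU.
    rewrite cat_uniq !filter_uniq// andbT; apply/hasPn => w.
    rewrite !mem_filter => /andP[/asboolP nV /S2Q q]; apply/negP => /andP[/asboolP Uw /S1W Ww].
    by case: q => [[]//|[_ []]].
  move=> w; rewrite mem_cat !mem_filter => /orP[/andP[/asboolP//]|/andP[/asboolP nV /S2Q]].
  by case=> [[]//|[[]//]].
have {}hV : \sum_(w <- S1 | ~~ u w) l w + \sum_(w <- S2 | v w) l w <= b.
  rewrite -[X in X + _]big_filter -[X in _ + X]big_filter -big_cat; apply: hV.
    rewrite cat_uniq !filter_uniq// andbT; apply/hasPn => w.
    rewrite !mem_filter => /andP[/asboolP Vw /S2Q q]; apply/negP => /andP[/asboolP nU /S1W Ww].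
    by case: q => [[]//|[_ []]].
  move=> w; rewrite mem_cat !mem_filter => /orP[/andP[/asboolP nU /S1W]|/andP[/asboolP//]].
  by case=> -[].
have e1 : \sum_(w <- S1) l w = \sum_(w <- S1 | u w) l w + \sum_(w <- S1 | ~~ u w) l w.
  exact: bigID.
have e2 : \sum_(w <- S2) l w = \sum_(w <- S2 | v w) l w + \sum_(w <- S2 | ~~ v w) l w.
  exact: bigID.
by rewrite e1 e2; lra.
Qed.

(** Content is continuous along increasing sequences.  Starting from nearly optimal
    covers of each [X n], replace the current cover by the maximal words of it and of the
    next one; by strong subadditivity only the small excess weights accumulate.  The
    cylinder over a given point can only grow along this process, hence stabilises, so
    the words that belong to all but finitely many of the covers cover the union. *)
Lemma content_bigcup (X : nat -> set (nat -> bool)) c :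
  (forall n, X n `<=` X n.+1) -> (forall n, content l (X n) <= c) ->
  content l (\bigcup_n X n) <= c.
Proof.
move=> Xinc Xc; apply/ler_addgt0Pr => e e0.
have /choice[U HU] : forall n, exists U, covers U (X n) /\
    weight_le l U (content l (X n) + e * (1 / 2) ^+ n.+1).
  move=> n; have : content l (X n) < content l (X n) + e * (1 / 2) ^+ n.+1.
    by rewrite ltrDl mulr_gt0// exprn_gt0// divr_gt0.
  by move=> /content_lt[U ? ?]; exists U.
pose fix V n := if n is n'.+1 then maximal_words (V n') (U n) else U 0%N.
have cVX n : covers (V n) (X n).
  case: n => [|n] x Xx; first exact: (HU 0%N).1.
  have [k Uk] := (HU n.+1).1 _ Xx.
  have [|m _ h] := @maximal_words_prefix (V n) (U n.+1) x k; first by right.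
  by exists m.
have wV n : weight_le l (V n) (content l (X n) + e * (1 - (1 / 2) ^+ n.+1)).
  elim: n => [|n IH].
    by have := (HU 0%N).2; rewrite expr1; have -> : 1 - 1 / 2 = 1 / 2 :> R by lra.
  move=> S uS HS.
  have cU : covers (U n.+1) (X n) by move=> x /Xinc; exact: (HU n.+1).1.
  apply: (le_trans (maximal_words_weight IH (HU n.+1).2 (cVX n) cU uS HS)).
  by rewrite ![(1/2) ^+ n.+2]exprS; lra.
have mono n x j : V n (mkseq x j) -> exists2 i, (i <= j)%N & V n.+1 (mkseq x i).
  by move=> h; apply: maximal_words_prefix; left.
apply: (@content_le [set w | exists n0, forall n, (n0 <= n)%N -> V n w]).
  move=> x [k _ Xk].
  pose P j := `[< exists2 n, (k <= n)%N & V n (mkseq x j) >].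
  have exP : exists j, P j.
    have [j Vj] := cVX _ _ Xk; exists j; apply/asboolP; by exists k.
  case: (ex_minnP exP) => j /asboolP[n kn Vn] jmin.
  exists j, n => n' nn'.
  rewrite -(subnKC nn'); elim: (n' - n)%N => [|r IH]; first by rewrite addn0.
  have [i ij Vi] := mono _ _ _ IH.
  have : P i by apply/asboolP; exists (n + r).+1 => //; lia.
  move=> /jmin ji; rewrite addnS; have -> : j = i by lia.
  exact: Vi.
move=> S uS HS.
have [n Hn] : exists n, forall w, w \in S -> V n w.
  have : exists n0, forall n, (n0 <= n)%N -> forall w, w \in S -> V n w.
    elim: S {uS} HS => [|w S IH] HS; first by exists 0%N.
    have [|n1 H1] := IH; first by move=> v vS; apply: HS; rewrite inE vS orbT.
    have [|n2 H2] := HS w; first by rewrite inE eqxx.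
    exists (maxn n1 n2) => n; rewrite geq_max => /andP[h1 h2] v.
    by rewrite inE => /orP[/eqP->|vS]; [exact: H2|exact: H1].
  by move=> [n0 H]; exists n0; exact: H.
apply: (le_trans (wV n S uS Hn)); apply: lerD => //.
by rewrite ler_piMr ?(ltW e0)// lerBlDr lerDl.
Qed.

End Content.

(** * Capacitability of analytic sets *)

(** Koenig's lemma, as sequential compactness: a sequence of sequences with entries in
    prescribed finite sets has an accumulation point. *)
Lemma konig (T : eqType) (z : nat -> nat -> T) (B : nat -> seq T) :
  (forall i k, (i < k)%N -> z k i \in B i) ->
  exists y : nat -> T, forall m k0, exists2 k, (k0 <= k)%N &
    forall i, (i < m)%N -> z k i = y i.
Proof.
move=> zB.
pose often (s : seq T) := forall k0, exists2 k, (k0 <= k)%N & mkseq (z k) (size s) = s.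
have often0 : often [::] by move=> k0; exists k0.
have step s : often s -> exists a, often (rcons s a).
  move=> os; apply/not_existsP => no.
  have /choice[f Hf] : forall a, exists k0, forall k, (k0 <= k)%N ->
      mkseq (z k) (size s).+1 <> rcons s a.
    move=> a; have := no a; move=> /existsNP[k0 H]; exists k0 => k kk e.
    by apply: H; exists k => //; rewrite size_rcons.
  pose K := (\max_(a <- B (size s)) f a + (size s).+1)%N.
  have [k Kk e] := os K.
  have zk : z k (size s) \in B (size s) by apply: zB; rewrite /K in Kk; lia.
  apply: (Hf (z k (size s)) k).
    have : (f (z k (size s)) <= \max_(a <- B (size s)) f a)%N.
      by apply: (leq_bigmax_seq (F := f)).
    by rewrite /K in Kk; lia.
  by rewrite /mkseq -addn1 iotaD map_cat -/(mkseq _ _) e cats1.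
have t := z 0%N 0%N.
have stepb s : exists a, often s -> often (rcons s a).
  have [/step[a H]|no] := pselect (often s); first by exists a.
  by exists t.
have /choice[nxt Hn] := stepb.
pose st := fix st n := if n is n'.+1 then rcons (st n') (nxt (st n')) else [::].
have szst n : size (st n) = n by elim: n => //= n IH; rewrite size_rcons IH.
have ost n : often (st n) by elim: n => //= n IH; exact: Hn.
exists (fun n => nxt (st n)) => m k0.
have stE n : st n = mkseq (fun n => nxt (st n)) n.
  by elim: n => //= n IH; rewrite {1}IH /mkseq -[in RHS]addn1 iotaD map_cat /= cats1.
have [k kk e] := ost m k0; exists k => // i im.
have := congr1 (fun s => nth t s i) e; rewrite szst stE !nth_mkseq//.
Qed.

Definition closed_seq (K : set (nat -> bool)) :=
  forall x, (forall m, exists2 x', K x' & forall i, (i < m)%N -> x' i = x i) -> K x.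

(** Closedness in the product of the Cantor space with the Baire space. *)
Definition closed_seq2 (Z : (nat -> bool) -> (nat -> nat) -> Prop) :=
  forall x y, (forall m, exists x' y', [/\ Z x' y',
    forall i, (i < m)%N -> x' i = x i & forall i, (i < m)%N -> y' i = y i]) -> Z x y.

(** Analytic sets are the projections of closed subsets of the product with the Baire
    space. *)
Definition analytic (X : set (nat -> bool)) :=
  exists2 Z, closed_seq2 Z & forall x, X x <-> exists y, Z x y.

(** Write [X] as the projection of a closed set and bound the coordinates of the
    witness one after the other: letting a bound grow exhausts the set, so by
    [content_bigcup] finite bounds [N 0], [N 1] and so on can be chosen without the content
    dropping to [c].  The witnesses below these bounds form a compact set, so the projection
    [K] is closed, and a cover of [K] already covers one of the approximating sets. *)
Lemma capacitability (R : realType) (l : word -> R) (X : set (nat -> bool)) (c : R) :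
  (forall w, 0 <= l w) -> analytic X -> c < content l X ->
  exists K, [/\ closed_seq K, K `<=` X & c <= content l K].
Proof.
move=> l0 [Z Zcl XZ] cX.
pose bounded (s : seq nat) (y : nat -> nat) := forall i, (i < size s)%N -> (y i <= nth 0%N s i)%N.
pose XX s : set (nat -> bool) := [set x | exists2 y, Z x y & bounded s y].
have step s : exists n, c < content l (XX s) -> c < content l (XX (rcons s n)).
  have [h|h] := pselect (c < content l (XX s)); last by exists 0%N.
  apply/not_existsP => no.
  have : content l (\bigcup_n XX (rcons s n)) <= c.
    apply: content_bigcup => // [n x [y Zy by_]|n].
      exists y => // i; rewrite size_rcons => iS; have := by_ i; rewrite size_rcons => /(_ iS).
      by rewrite !nth_rcons; case: ifP => // _; case: ifP => // _; lia.
    by rewrite leNgt; apply/negP => h'; apply: (no n).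
  rewrite leNgt => /negP; apply; apply: (lt_le_trans h); apply: le_content => //.
  move=> x [y Zy by_]; exists (y (size s)) => //; exists y => // i.
  rewrite size_rcons ltnS nth_rcons => iS; case: ltnP => [/by_//|si].
  have -> : i = size s by apply/eqP; rewrite eqn_leq iS.
  by rewrite eqxx.
have /choice[nxt Hn] := step.
pose st := fix st n := if n is n'.+1 then rcons (st n') (nxt (st n')) else [::].
have szst n : size (st n) = n by elim: n => //= n IH; rewrite size_rcons IH.
have cst n : c < content l (XX (st n)).
  elim: n => [|n IH] /=; last by apply: Hn.
  apply: (lt_le_trans cX); apply: le_content => // x /XZ[y Zy]; by exists y.
pose N n := nxt (st n).
have stE n : st n = mkseq N n.
  by elim: n => //= n IH; rewrite {1}IH /mkseq -[in RHS]addn1 iotaD map_cat /= cats1.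
pose K : set (nat -> bool) := [set x | exists2 y, Z x y & forall i, (y i <= N i)%N].
have compact_ (xs : nat -> nat -> bool) (ys : nat -> nat -> nat) :
    (forall k, Z (xs k) (ys k)) -> (forall k i, (i < k)%N -> (ys k i <= N i)%N) ->
    exists2 x, K x & forall m k0, exists2 k, (k0 <= k)%N & forall i, (i < m)%N -> xs k i = x i.
  move=> HZ HN.
  pose B i := [seq (b, j) | b <- [:: true; false], j <- iota 0 (N i).+1].
  have [|xy Hxy] := @konig _ (fun k i => (xs k i, ys k i)) B.
    move=> i k ik; apply/allpairsP; exists (xs k i, ys k i); split => //.
      by case: (xs k i).
    by rewrite mem_iota add0n ltnS HN.
  exists (fun i => (xy i).1); last first.
    move=> m k0; have [k kk H] := Hxy m k0; exists k => // i im.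
    by rewrite -(H i im).
  exists (fun i => (xy i).2); last first.
    move=> i; have [k kk H] := Hxy i.+1 i.+1.
    by rewrite -(H i (ltnSn i)) /=; apply: HN.
  apply: Zcl => m; have [k kk H] := Hxy m 0%N.
  by exists (xs k), (ys k); split => // i im; rewrite -(H i im).
exists K; split.
- move=> x Hx.
  have /choice[xs Hxs] : forall m, exists x', K x' /\ forall i, (i < m)%N -> x' i = x i.
    by move=> m; have [x' ? ?] := Hx m; exists x'.
  have /choice[ys Hys] : forall m, exists y, Z (xs m) y /\ forall i, (y i <= N i)%N.
    by move=> m; have [[y ? ?] _] := Hxs m; exists y.
  have [|k i _|x' Kx' Hx'] := @compact_ xs ys; first by move=> k; exact: (Hys k).1.
    exact: (Hys k).2.
  suff -> : x = x' by [].
  apply/funext => i; have [k ik H] := Hx' i.+1 i.+1.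
  by rewrite -(H i (ltnSn i)) (Hxs k).2.
- by move=> x [y Zy _]; apply/XZ; exists y.
- rewrite leNgt; apply/negP => /(content_lt l0)[U cU wU].
  have [[k Hk]|no] := pselect (exists k, covers U (XX (st k))).
    have := content_le Hk wU; rewrite leNgt => /negP; apply; exact: cst.
  have /choice[xs Hxs] : forall k, exists x, XX (st k) x /\ forall n, ~ U (mkseq x n).
    move=> k; have : ~ covers U (XX (st k)) by move=> H; apply: no; exists k.
    move=> /existsNP[x /not_implyP[Xx nU]]; exists x; split => // n Un.
    by apply: nU; exists n.
  have /choice[ys Hys] : forall k, exists y, Z (xs k) y /\ bounded (st k) y.
    by move=> k; have [[y ? ?] _] := Hxs k; exists y.
  have [|k i ik|x Kx Hx] := @compact_ xs ys; first by move=> k; exact: (Hys k).1.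
    have := (Hys k).2 i; rewrite szst => /(_ ik).
    by rewrite stE nth_mkseq.
  have [n Un] := cU _ Kx.
  have [k _ H] := Hx n 0%N.
  apply: ((Hxs k).2 n); have -> // : mkseq (xs k) n = mkseq x n.
  by apply/eq_in_map => i; rewrite mem_iota => /andP[_ /H].
Qed.

(** * Frostman flows on finite trees *)

Definition meets (K : set (nat -> bool)) (w : word) :=
  exists2 x, K x & mkseq x (size w) = w.

(** Max-flow and min-cut on the tree of words of length at most [N], where an edge into
    [w] has capacity [l w].  The minimal cut is computed from the leaves upwards, and it
    is realised by a cover of [K]; the maximal flow is distributed from the root
    downwards in proportion to the cuts.  The first argument of both functions is the
    height above the leaves. *)
Section Frostman.
Variables (R : realType) (l : word -> R) (K : set (nat -> bool)).
Hypothesis l_ge0 : forall w, 0 <= l w.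

Fixpoint min_cut (h : nat) (w : word) : R :=
  if h is h'.+1 then
    Num.min (l w) (min_cut h' (rcons w false) + min_cut h' (rcons w true))
  else if `[< meets K w >] then l w else 0.

Fixpoint max_flow (h : nat) (w u : word) : R :=
  match u, h with
  | [::], _ => min_cut h w
  | a :: u', h'.+1 =>
      min_cut h w / (min_cut h' (rcons w false) + min_cut h' (rcons w true))
        * max_flow h' (rcons w a) u'
  | _, 0%N => 0
  end.

Lemma sum_subseq_le (S S' : seq word) : uniq S' -> {subset S' <= S} ->
  \sum_(w <- S') l w <= \sum_(w <- S) l w.
Proof.
elim: S' S => [|w S' IH] S; first by rewrite big_nil => _ _; apply: sumr_ge0.
move=> /= /andP[wS' uS'] sub.
have wS : w \in S by apply: sub; rewrite inE eqxx.
rewrite big_cons (perm_big _ (perm_to_rem wS)) big_cons lerD2l.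
apply: IH => // v vS'.
have vS : v \in S by apply: sub; rewrite inE vS' orbT.
have := perm_mem (perm_to_rem wS) v; rewrite vS inE => /esym/orP[/eqP vw|//].
by move: wS'; rewrite -vw vS'.
Qed.

Lemma min_cut_cover h w : exists2 S : seq word,
  \sum_(v <- S) l v = min_cut h w &
  forall x, K x -> mkseq x (size w) = w -> exists n, mkseq x n \in S.
Proof.
elim: h w => [|h IH] w /=.
  case: asboolP => Kw; last first.
    exists [::]; first by rewrite big_nil.
    by move=> x Kx xw; exfalso; apply: Kw; exists x.
  exists [:: w]; first by rewrite big_seq1.
  by move=> x _ xw; exists (size w); rewrite xw inE.
have [lw|lw] := leP (l w) (min_cut h (rcons w false) + min_cut h (rcons w true)).
  exists [:: w]; first by rewrite big_seq1.
  by move=> x _ xw; exists (size w); rewrite xw inE.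
have [S0 S0l H0] := IH (rcons w false); have [S1 S1l H1] := IH (rcons w true).
exists (S0 ++ S1); first by rewrite big_cat /= S0l S1l.
move=> x Kx xw.
have : mkseq x (size w).+1 = rcons w (x (size w)).
  by rewrite /mkseq -addn1 iotaD map_cat -/(mkseq _ _) xw cats1.
rewrite -(size_rcons w (x (size w))); case: (x (size w)) => e.
  by have [n nS] := H1 _ Kx e; exists n; rewrite mem_cat nS orbT.
by have [n nS] := H0 _ Kx e; exists n; rewrite mem_cat nS.
Qed.

Lemma content_le_min_cut h : content l K <= min_cut h [::].
Proof.
have [S <- HS] := min_cut_cover h [::].
apply: (@content_le _ _ [set w | w \in S]).
  by move=> x Kx; have [n] := HS x Kx erefl; exists n.
by move=> S' uS' HS'; apply: sum_subseq_le.
Qed.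

Lemma min_cut_ge0 h w : 0 <= min_cut h w.
Proof.
elim: h w => [|h IH] w /=; first by case: ifP.
by rewrite le_min l_ge0 addr_ge0.
Qed.

Lemma min_cut_le h w : min_cut h w <= l w.
Proof.
case: h => [|h] /=; first by case: ifP.
by rewrite ge_min lexx.
Qed.

Lemma max_flow_ge0 h w u : 0 <= max_flow h w u.
Proof.
elim: u h w => [|a u IH] [|h] w /=; rewrite ?min_cut_ge0//.
- exact: (min_cut_ge0 0).
- exact: (min_cut_ge0 h.+1).
- rewrite mulr_ge0// divr_ge0 ?addr_ge0 ?min_cut_ge0//.
  exact: (min_cut_ge0 h.+1).
Qed.

Lemma max_flow_ratio h w :
  min_cut h.+1 w / (min_cut h (rcons w false) + min_cut h (rcons w true)) <= 1.
Proof.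
set s := _ + _; have [s0|s0] := eqVneq s 0; first by rewrite s0 invr0 mulr0.
have sgt0 : 0 < s by rewrite lt_def s0 addr_ge0 ?min_cut_ge0.
by rewrite ler_pdivrMr// mul1r /= ge_min lexx orbT.
Qed.

Lemma max_flow_le h w u : max_flow h w u <= l (w ++ u).
Proof.
elim: u h w => [|a u IH] h w; first by rewrite cats0; case: h => *; exact: min_cut_le.
case: h => [|h]; first exact: l_ge0.
rewrite -cat_rcons; apply: le_trans (IH h (rcons w a)).
by rewrite [X in X <= _]/= ler_piMl ?max_flow_ge0// max_flow_ratio.
Qed.

Lemma max_flow_nil h w : max_flow h w [::] = min_cut h w.
Proof. by case: h. Qed.

(** If both children have a zero cut then the cut of the parent is zero too, so the
    convention [x / 0 = 0] loses no mass. *)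
Lemma max_flow_additive h w u : (size u < h)%N ->
  max_flow h w u = max_flow h w (rcons u false) + max_flow h w (rcons u true).
Proof.
elim: u h w => [|a u IH] [|h] w //= uh; last by rewrite -mulrDr -IH.
rewrite !max_flow_nil -mulrDr.
set s := _ + _; have [s0|s0] := eqVneq s 0; last by rewrite divfK.
by rewrite s0 mulr0; apply/eqP; rewrite eq_le ge_min lexx orbT le_min l_ge0 lexx.
Qed.

Lemma max_flow_meets h w u : size u = h -> 0 < max_flow h w u -> meets K (w ++ u).
Proof.
elim: u h w => [|a u IH] [|h] w //=.
  by rewrite cats0; case: asboolP => // _; rewrite ltxx.
move=> [uh] H; rewrite -cat_rcons; apply: (IH h) => //.
rewrite lt_def max_flow_ge0 andbT; apply/eqP => e.
by move: H; rewrite e mulr0 ltxx.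
Qed.

Lemma finite_frostman N : exists mu : word -> R,
  [/\ forall w, 0 <= mu w, forall w, mu w <= l w,
   forall w, (size w < N)%N -> mu w = mu (rcons w false) + mu (rcons w true),
   content l K <= mu [::] &
   forall w, size w = N -> 0 < mu w -> meets K w].
Proof.
exists (max_flow N [::]); split.
- exact: max_flow_ge0.
- by move=> w; have := max_flow_le N [::] w.
- by move=> w; exact: max_flow_additive.
- by rewrite max_flow_nil content_le_min_cut.
- by move=> w; exact: max_flow_meets.
Qed.

End Frostman.

(** * Analytic sets and Borel sets *)

Lemma analytic_bigcup (X : nat -> set (nat -> bool)) :
  (forall n, analytic (X n)) -> analytic (\bigcup_n X n).
Proof.
move=> H; have /choice[Z HZ] : forall n, exists Z, closed_seq2 Z /\
    forall x, X n x <-> exists y, Z x y by move=> n; have [Z ? ?] := H n; exists Z.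
exists (fun x y => Z (y 0%N) x (fun n => y n.+1)).
  move=> x y Hxy; apply: (HZ _).1 => m.
  have [x' [y' [Zx' ex ey]]] := Hxy m.+1.
  exists x', (fun n => y' n.+1); split.
  - by rewrite -(ey 0%N).
  - by move=> i im; apply: ex; apply: ltnW.
  - by move=> i im; apply: ey.
move=> x; split => [[n _ /(HZ n).2[y Zy]]|[y Zy]].
  by exists (fun k => if k is k'.+1 then y k' else n).
by exists (y 0%N) => //; apply/(HZ _).2; exists (fun n => y n.+1).
Qed.

(** The countably many witnesses are interleaved into one by the pairing of natural
    numbers; finitely many coordinates of one of them involve finitely many
    coordinates of the interleaved sequence, which keeps the condition closed. *)
Lemma analytic_bigcap (X : nat -> set (nat -> bool)) :
  (forall n, analytic (X n)) -> analytic (\bigcap_n X n).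
Proof.
move=> H; have /choice[Z HZ] : forall n, exists Z, closed_seq2 Z /\
    forall x, X n x <-> exists y, Z x y by move=> n; have [Z ? ?] := H n; exists Z.
exists (fun x y => forall i, Z i x (fun n => y (pickle (i, n)))).
  move=> x y Hxy i; apply: (HZ i).1 => m.
  pose M := (\max_(n < m) (pickle (i, val n)).+1 + m)%N.
  have [x' [y' [Zx' ex ey]]] := Hxy M.
  exists x', (fun n => y' (pickle (i, n))); split => //.
  - by move=> j jm; apply: ex; rewrite /M; lia.
  - move=> j jm; apply: ey; rewrite /M.
    have := leq_bigmax (F := fun n : 'I_m => (pickle (i, val n)).+1) (Ordinal jm).
    by rewrite /=; lia.
move=> x; split => [Hx|[y Zy] i _]; last by apply/(HZ i).2; eexists; exact: Zy.
have /choice[ys Hys] : forall i, exists y, Z i x y by move=> i; apply/(HZ i).2/Hx.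
exists (fun k => if (unpickle k : option (nat * nat)) is Some (i, n) then ys i n else 0%N).
move=> i; have -> // : (fun n => if (unpickle (pickle (i, n)) : option (nat * nat))
    is Some (i, n) then ys i n else 0%N) = ys i.
by apply/funext => n; rewrite pickleK.
Qed.

Definition open_seq (X : set (nat -> bool)) :=
  forall x, X x -> exists m, forall x', (forall i, (i < m)%N -> x' i = x i) -> X x'.

Lemma analytic_open (X : set (nat -> bool)) : open_seq X -> analytic X.
Proof.
move=> oX.
(* The first entry of the witness is a length such that the corresponding cylinder
   around the point lies in [X]. *)
exists (fun x y => forall x', (forall i, (i < y 0%N)%N -> x' i = x i) -> X x').
  move=> x y Hxy x'' ex.
  have [x' [y' [Xx' ex' ey']]] := Hxy (y 0%N).+1.
  apply: Xx' => i; rewrite ey'// => iy; rewrite ex// ex'//.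
  exact: ltnW.
move=> x; split => [/oX[m Hm]|[y H]]; first by exists (fun=> m).
exact: H.
Qed.

Lemma analytic_setC_open (X : set (nat -> bool)) : open_seq X -> analytic (~` X).
Proof.
move=> oX; exists (fun x _ => ~ X x).
  move=> x y Hxy /oX[m Hm]; have [x' [_ [nX ex _]]] := Hxy m.
  exact/nX/Hm.
by move=> x; split => [nX|[]//]; exists (fun=> 0%N).
Qed.

(** * Binary expansions *)

(** The digits of the [d] coordinates are interleaved: the letter of index [n * d + i]
    is the digit of index [n] of the coordinate [i].  Splitting one coordinate at a time
    makes the tree binary. *)
Fixpoint approx (d : nat) (x : nat -> bool) (n i : nat) : nat :=
  if n is n'.+1 then (2 * approx d x n' i + x (n' * d + i))%N else 0%N.

Lemma eq_approx d x x' n i : (i < d)%N ->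
  (forall k, (k < n * d)%N -> x k = x' k) -> approx d x n i = approx d x' n i.
Proof.
move=> id; elim: n => //= n IH e; rewrite IH => [|k kn]; last by apply: e; nia.
by rewrite e//; nia.
Qed.

Section Expansion.
Variables (R : realType) (d : nat).

Local Notation approxR x n i := ((approx d x n i)%:R / 2 ^+ n : R).

Definition point x : 'rV[R]_d := \row_i sup [set approxR x n i | n in setT].

Let e2_gt0 n : 0 < 2 ^+ n :> R. Proof. by rewrite exprn_gt0. Qed.

Lemma approxS x n (i : 'I_d) : approxR x n i <= approxR x n.+1 i /\
  approxR x n.+1 i + (2 ^+ n.+1)^-1 <= approxR x n i + (2 ^+ n)^-1.
Proof.
have -> : approxR x n i = (2 * (approx d x n i)%:R) / 2 ^+ n.+1.
  by rewrite exprS invfM mulrACA divff ?mul1r.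
have -> : (2 ^+ n)^-1 = 2 / 2 ^+ n.+1 :> R by rewrite exprS invfM mulrA divff ?mul1r.
rewrite -[X in _ + X <= _]mul1r -!mulrDl !ler_pM2r ?invr_gt0// natrD natrM.
by case: (x _); rewrite /=; split; lra.
Qed.

Lemma approx_mono x n m (i : 'I_d) : (n <= m)%N -> approxR x n i <= approxR x m i /\
  approxR x m i + (2 ^+ m)^-1 <= approxR x n i + (2 ^+ n)^-1.
Proof.
move=> /subnKC <-; elim: (m - n)%N => [|r [IH1 IH2]]; first by rewrite addn0.
have [h1 h2] := approxS x (n + r) i; rewrite addnS; split.
  exact: le_trans h1.
exact: le_trans IH2.
Qed.

Lemma point_ge x n (i : 'I_d) : approxR x n i <= point x 0 i.
Proof.
rewrite mxE; apply: ub_le_sup; last by exists n.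
exists (approxR x 0 i + (2 ^+ 0)^-1) => _ [m _ <-].
have [_] := approx_mono x i (leq0n m); apply: le_trans.
by rewrite lerDl invr_ge0 ltW.
Qed.

Lemma point_le x n (i : 'I_d) : point x 0 i <= approxR x n i + (2 ^+ n)^-1.
Proof.
rewrite mxE; apply: ge_sup; first by exists (approxR x 0 i), 0%N.
move=> _ [m _ <-]; have [nm|/ltnW mn] := leqP n m.
  have [_] := approx_mono x i nm; apply: le_trans.
  by rewrite lerDl invr_ge0 ltW.
have [h _] := approx_mono x i mn; apply: (le_trans h).
by rewrite lerDl invr_ge0 ltW.
Qed.

Lemma point_approx_dist x n (i : 'I_d) : `|point x 0 i - approxR x n i| <= (2 ^+ n)^-1.
Proof.
have := point_ge x n i; have := point_le x n i => h1 h2.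
have := e2_gt0 n; rewrite -invr_gt0 => h3.
by rewrite ler_norml; apply/andP; split; lra.
Qed.

Lemma approx_itv01 x n (i : 'I_d) : 0 <= approxR x n i <= 1.
Proof.
have [h1 h2] := approx_mono x i (leq0n n).
rewrite /= mul0r in h1 h2; rewrite h1 /=; move: h2; rewrite expr0 invr1 add0r.
by apply: le_trans; rewrite lerDl invr_ge0 ltW.
Qed.

Lemma point_itv01 x (i : 'I_d) : 0 <= point x 0 i <= 1.
Proof.
have := point_ge x 0 i; have := point_le x 0 i.
by rewrite /= mul0r expr0 invr1 add0r => -> ->.
Qed.

Lemma norm_sub_itv01 (a b : R) : 0 <= a <= 1 -> 0 <= b <= 1 -> `|a - b| <= 1.
Proof.
move=> /andP[a0 a1] /andP[b0 b1].
by rewrite ler_norml; apply/andP; split; lra.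
Qed.

Lemma point_dist x x' n (i : 'I_d) : (forall k, (k < n * d)%N -> x k = x' k) ->
  `|point x 0 i - point x' 0 i| <= (2 ^+ n)^-1.
Proof.
move=> e; have e' := eq_approx (ltn_ord i) e.
have := point_ge x n i; have := point_le x n i.
have := point_ge x' n i; have := point_le x' n i.
rewrite e' => h1 h2 h3 h4; rewrite ler_norml; apply/andP; split; lra.
Qed.

Lemma exp2V_le (e : R) : 0 < e -> exists n, (2 ^+ n)^-1 <= e.
Proof.
move=> e0; have [n Hn] : exists n : nat, e^-1 < n%:R.
  by exists (Num.bound e^-1); apply: archi_boundP; rewrite invr_ge0 ltW.
exists n; rewrite -[leRHS]invrK lef_pV2 ?posrE ?invr_gt0// -natrX.
apply: (le_trans (ltW Hn)); rewrite ler_nat; apply: ltnW; exact: ltn_expl.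
Qed.

Lemma le_exp2V_eq (a b : R) (C : R) : (forall n, `|a - b| <= C / 2 ^+ n) -> a = b.
Proof.
move=> H; apply/eqP; rewrite -subr_eq0 -normr_le0.
apply/ler_addgt0Pr => e e0; rewrite add0r.
have C0 : 0 <= C by have := H 0%N; rewrite expr0 divr1; apply: le_trans.
have [|n Hn] := @exp2V_le (e / (C + 1)); first by rewrite divr_gt0// ltr_wpDl.
apply: (le_trans (H n)); apply: (le_trans (ler_wpM2l C0 Hn)).
by rewrite mulrA ler_pdivrMr ?ltr_wpDl// mulrC ler_pM2l// lerDl.
Qed.

(** Greedy expansions, in which [1] gets all its digits equal to one. *)
Lemma point_surj (v : 'rV[R]_d) : unit_cube v -> exists x, point x = v.
Proof.
move=> Hv; pose fix a (r : R) n := if n is n'.+1 then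
  (2 * a r n' + ((2 * a r n' + 1)%:R / 2 ^+ n'.+1 <= r)%R)%N else 0%N.
pose x k := let r := oapp (v 0) 0 (insub (k %% d)%N : option 'I_d) in let n := (k %/ d)%N in
  ((2 * a r n + 1)%:R / 2 ^+ n.+1 <= r).
have ax (i : 'I_d) n : approx d x n i = a (v 0 i) n.
  elim: n => //= n ->; have d0 : (0 < d)%N by exact: leq_ltn_trans (ltn_ord i).
  by rewrite /x divnMDl// divn_small// addn0 modnMDl modn_small// valK.
have aP (i : 'I_d) n : (a (v 0 i) n)%:R / 2 ^+ n <= v 0 i <= (a (v 0 i) n)%:R / 2 ^+ n + (2 ^+ n)^-1.
  elim: n => [|n /andP[IH1 IH2]] /=.
    by rewrite mul0r expr0 invr1 add0r; exact: Hv.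
  move: IH1 IH2; set r := v 0 i; set A := a r n.
  have -> : A%:R / 2 ^+ n = (2 * A)%:R / 2 ^+ n.+1 :> R.
    by rewrite exprS invfM natrM mulrACA divff ?mul1r.
  have -> : (2 ^+ n)^-1 = 2 / 2 ^+ n.+1 :> R by rewrite exprS invfM mulrA divff ?mul1r.
  have eB (k : nat) : (2 * A + k)%:R = (2 * A)%:R + k%:R :> R by rewrite natrD.
  rewrite !eB; set B := (2 * A)%:R; set q := (2 ^+ n.+1)^-1.
  have [h|h] := leP ((B + 1%:R) * q) r; rewrite /= => h1 h2; apply/andP; split; lra.
exists x; apply/rowP => i; apply: (@le_exp2V_eq _ _ 1) => n.
have := point_ge x n i; have := point_le x n i; have /andP[] := aP i n.
rewrite ax mul1r => h1 h2 h3 h4; rewrite ler_norml; apply/andP; split; lra.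
Qed.

Lemma open_seq_point (E : set 'rV[R]_d) : open E -> open_seq (point @^-1` E).
Proof.
move=> oE x Ex; have /nbhs_ballP[e /= e0 He] := open_nbhs_nbhs (conj oE Ex).
have [|n Hn] := @exp2V_le (e / 2); first by rewrite divr_gt0.
exists (n * d)%N => x' ex; apply: He; split => // i j.
rewrite /ball /= ord1; apply: (@le_lt_trans _ _ (2 ^+ n)^-1); last by lra.
by apply: point_dist => k kn; rewrite ex.
Qed.

(** Sets whose preimage and its complement are both analytic form a sigma-algebra,
    and it contains the open sets. *)
Lemma analytic_borel (E : set 'rV[R]_d) : borel_set E -> analytic (point @^-1` E).
Proof.
move=> bE.
suff : [set A : set 'rV[R]_d | analytic (point @^-1` A) /\ analytic (~` (point @^-1` A))] E.
  by case.
apply: bE; split; last first.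
  by move=> A /open_seq_point oA; split; [exact: analytic_open|exact: analytic_setC_open].
split => /=.
- have o0 : open_seq (point @^-1` set0) by [].
  by split; [exact: analytic_open|exact: analytic_setC_open].
- by move=> A [h1 h2]; rewrite setTD preimage_setC setCK.
- move=> A HA; rewrite preimage_bigcup setC_bigcup; split.
    by apply: analytic_bigcup => n; have [] := HA n.
  by apply: analytic_bigcap => n; have [] := HA n.
Qed.

(** Between two multiples of [d] a word describes a box that is not a cube; its cost is
    that of the smallest dyadic cube of the expansion that contains it. *)
Definition cube_weight (s : R) (w : word) : R := ((2 ^+ (size w %/ d))^-1) `^ s.

(** A family of words covering the preimage yields dyadic cubes covering [E] at the same
    cost.  The sequences of cubes in the definition of content have no empty terms, so
    the remaining indices are filled with cubes of summably small cost. *)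
Lemma le_content_expansion (s : R) (E : set 'rV[R]_d) (c : R) :
  (0 < d)%N -> 0 < s -> E `<=` @unit_cube R d ->
  (c%:E <= dyadic_content s E)%E -> c <= content (cube_weight s) (point @^-1` E).
Proof.
move=> d0 s0 E1 cE; apply: lb_le_inf.
  by apply: (content_has_inf _ _).1 => w; exact: powR_ge0.
move=> c' [U cU wU]; apply/ler_addgt0Pr => e e0.
have /choice[J HJ] : forall i : nat, exists J : nat, ((2 ^+ J)^-1 : R) `^ s <= e * (1 / 2) ^+ i.+1.
  move=> i; have p : 0 < e * (1 / 2) ^+ i.+1 by rewrite mulr_gt0// exprn_gt0// divr_gt0.
  have [|J HJ] := @exp2V_le ((e * (1 / 2) ^+ i.+1) `^ s^-1); first by rewrite powR_gt0.
  exists J; apply: (@le_trans _ _ (((e * (1 / 2) ^+ i.+1) `^ s^-1) `^ s)).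
    by apply: ge0_ler_powR; rewrite ?nnegrE ?invr_ge0 ?powR_ge0 ?exprn_ge0// ltW.
  by rewrite -powRrM mulVf ?gt_eqF// powRr1 ?lexx// ltW.
pose cub (w : word) : dyadic d := ((size w %/ d)%N%:Z,
  \row_i (approx d (nth false w) (size w %/ d) i)%:Z).
pose sel (i : nat) : option word := if (pickle_inv i : option word) is Some w then
  if `[< U w >] then Some w else None else None.
pose Q (i : nat) : dyadic d := if sel i is Some w then cub w else ((J i)%:Z, 0).
have sideE (n : nat) : 2 ^ (- n%:Z) = (2 ^+ n)^-1 :> R by rewrite -exprnN.
have cub_side w : side R (cub w) `^ s = cube_weight s w by rewrite /side /= sideE.
rewrite -lee_fin; apply: (le_trans cE).
apply: (@le_trans _ _ (\sum_(0 <= i <oo) (side R (Q i) `^ s)%:E)%E).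
  apply: ereal_inf_lbound; exists Q => //= v Ev.
  have [x xv] := point_surj (E1 _ Ev).
  have [n Un] : exists n, U (mkseq x n) by apply: cU; rewrite /= xv.
  exists (pickle (mkseq x n)) => // i.
  rewrite /Q /sel pickleK_inv asboolT// /cub /side /= sideE size_mkseq !mxE.
  have -> : approx d (nth false (mkseq x n)) (n %/ d) i = approx d x (n %/ d) i.
    apply: eq_approx => // k kn; rewrite nth_mkseq//.
    exact: (leq_trans kn (leq_divM _ _)).
  have := point_ge x (n %/ d) i; have := point_le x (n %/ d) i.
  rewrite xv intrD -!pmulrn => h1 h2; apply/andP; split.
    by rewrite mulrC.
  by apply: (le_trans h1); rewrite mulrDr mulr1 mulrC.
apply: lime_le; first by apply: is_cvg_nneseries => n _ _; rewrite lee_fin powR_ge0.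
apply: nearW => n; rewrite sumEFin lee_fin big_mkord.
have B k : \sum_(i < k) e * (1 / 2) ^+ i.+1 <= e.
  suff -> : \sum_(i < k) e * (1 / 2) ^+ i.+1 = e * (1 - (1 / 2) ^+ k).
    by rewrite ler_piMr ?ltW// gerBl.
  elim: k => [|k IH]; first by rewrite big_ord0 expr0 subrr mulr0.
  by rewrite big_ord_recr /= IH exprS; lra.
have A : \sum_(i < n) (if sel i is Some w then cube_weight s w else 0) <= c'.
  have -> : \sum_(i < n) (if sel i is Some w then cube_weight s w else 0) =
      \sum_(w <- pmap sel (iota 0 n)) cube_weight s w.
    rewrite -(big_mkord xpredT (fun i => if sel i is Some w then cube_weight s w else 0)).
    rewrite /index_iota subn0; elim: (iota 0 n) => [|i r IH] /=; first by rewrite !big_nil.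
    by rewrite big_cons IH; case: (sel i) => [w|] /=; rewrite ?big_cons ?add0r.
  have selP (i : nat) w : sel i = Some w -> U w /\ pickle w = i.
    rewrite /sel; case Ei: (pickle_inv i) => [w'|//]; case: asboolP => // Uw [<-].
    by split => //; have := @pickle_invK word i; rewrite /oapp Ei.
  apply: wU.
    have : uniq (map pickle (pmap sel (iota 0 n))).
      have -> : map pickle (pmap sel (iota 0 n)) = [seq i <- iota 0 n | sel i].
        elim: (iota 0 n) => //= i r IH; case Ei: (sel i) => [w|//] /=.
        by rewrite IH (selP _ _ Ei).2.
      by rewrite filter_uniq// iota_uniq.
    exact: map_uniq.
  move=> w; rewrite mem_pmap => /mapP[i _ /esym/selP[]//].
apply: (le_trans _ (lerD A (B n))); rewrite -big_split /=.
apply: ler_sum => i _; rewrite /Q; case: (sel i) => [w|].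
  rewrite cub_side lerDl mulr_ge0 ?exprn_ge0 ?divr_ge0//; exact: ltW.
by rewrite add0r /side /= sideE HJ.
Qed.

End Expansion.

(** * Sums over a square of parameters *)

Section TwoParameter.
Variable R : realType.

Lemma sum_shift (u : int -> R) (S : R) (m : nat) (c : int) :
  (forall k, `|u k| <= S) ->
  `|\sum_(k < m) u (k%:Z + c) - \sum_(k < m) u k%:Z| <= 2 * S * `|c|%:~R.
Proof.
have S0 (v : int -> R) : (forall k, `|v k| <= S) -> 0 <= S.
  by move=> /(_ 0); apply: le_trans.
have shift_nat (v : int -> R) (n : nat) : (forall k, `|v k| <= S) ->
    `|\sum_(k < m) v (k%:Z + n%:Z) - \sum_(k < m) v k%:Z| <= 2 * S * n%:R.
  move=> vS; have S_ge0 := S0 v vS.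
  elim: n => [|n IH].
    rewrite mulr0 (eq_bigr (fun k : 'I_m => v k%:Z)) ?subrr ?normr0// => k _.
    by rewrite addr0.
  have e : `|\sum_(k < m) v (k%:Z + n.+1%:Z) - \sum_(k < m) v (k%:Z + n%:Z)| <= 2 * S.
    case: m {IH} => [|m']; first by rewrite !big_ord0 subrr normr0 mulr_ge0.
    rewrite big_ord_recr [X in _ - X]big_ord_recl /=.
    rewrite (eq_bigr (fun i : 'I_m' => v ((bump 0 i)%:Z + n%:Z))); last first.
      by move=> i _; congr v; rewrite /bump /=; lia.
    have h1 := vS (m'%:Z + n.+1%:Z); have h2 := vS (0%:Z + n%:Z).
    have -> : forall s x y : R, s + x - (y + s) = x - y by move=> s x y; lra.
    by apply: (le_trans (ler_normB _ _)); lra.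
  have -> : 2 * S * n.+1%:R = 2 * S + 2 * S * n%:R by rewrite -natr1; ring.
  apply: (le_trans _ (lerD e IH)); apply: (le_trans _ (ler_normD _ _)).
  by rewrite subrKA.
move=> uS; case: c => n; first exact: shift_nat.
rewrite distrC NegzE.
have := @shift_nat (fun k => u (k - n.+1%:Z)) n.+1.
rewrite (eq_bigr (fun k : 'I_m => u k%:Z)); last by move=> k _; rewrite addrK.
by rewrite normrN; apply.
Qed.

Lemma sum2_shift (F : int -> int -> R) (A A' : nat) (c c' : int) :
  (forall k k', `|F k k'| <= 1) ->
  `|\sum_(a < A) \sum_(a' < A') F (a%:Z + c) (a'%:Z + c')
    - \sum_(a < A) \sum_(a' < A') F a%:Z a'%:Z| <=
  2 * (A'%:R * `|c|%:~R + A%:R * `|c'|%:~R).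
Proof.
move=> F1.
have h1 : `|\sum_(a < A) \sum_(a' < A') F (a%:Z + c) (a'%:Z + c')
    - \sum_(a < A) \sum_(a' < A') F (a%:Z + c) a'%:Z| <= 2 * (A%:R * `|c'|%:~R).
  rewrite -sumrB; apply: (le_trans (ler_norm_sum _ _ _)).
  have -> : 2 * (A%:R * `|c'|%:~R) = \sum_(a < A) (2 * 1 * `|c'|%:~R) :> R.
    by rewrite sumr_const card_ord -mulr_natl; ring.
  apply: ler_sum => a _; exact: (sum_shift (u := F (a%:Z + c))).
have h2 : `|\sum_(a < A) \sum_(a' < A') F (a%:Z + c) a'%:Z
    - \sum_(a < A) \sum_(a' < A') F a%:Z a'%:Z| <= 2 * (A'%:R * `|c|%:~R).
  have := @sum_shift (fun k => \sum_(a' < A') F k a'%:Z) A'%:R A c.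
  rewrite mulrA; apply => k; apply: (le_trans (ler_norm_sum _ _ _)).
  have -> : A'%:R = \sum_(a' < A') 1 :> R by rewrite sumr_const card_ord.
  by apply: ler_sum.
have h : forall x y z : R, `|x - z| <= `|x - y| + `|y - z|.
  by move=> x y z; apply: (le_trans _ (ler_normD _ _)); rewrite subrKA.
by apply: (le_trans (h _ _ _)); apply: (le_trans (lerD h1 h2)); lra.
Qed.

(** If shifting by multiples of a vector [(D, D')] makes the partial sums of [F] along
    the shifts bounded, then [F] has a small average over any square cell that is much
    longer than the shifts: averaging the sum over the cell with its [2 * K] translates
    costs only a boundary term. *)
Lemma cell_sum (F : int -> int -> R) (A K B : nat) (D D' : int) (C1 : R) :
  (forall k k', `|F k k'| <= 1) -> (`|D| <= B)%N -> (`|D'| <= B)%N -> (0 < K)%N ->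
  (forall a a' : nat, (a < A)%N -> (a' < A)%N ->
     `|\sum_(s < 2 * K) F (a%:Z + s%:Z * D) (a'%:Z + s%:Z * D')| <= C1) ->
  `|\sum_(a < A) \sum_(a' < A) F a%:Z a'%:Z| <=
    A%:R ^+ 2 * C1 / (2 * K%:R) + 8 * K%:R * B%:R * A%:R.
Proof.
move=> F1 DB DB' K0 HC.
set S := \sum_(a < A) _; have K0' : 0 < 2 * K%:R :> R by rewrite mulr_gt0// ltr0n.
rewrite -(ler_pM2l K0').
have -> : 2 * K%:R * (A%:R ^+ 2 * C1 / (2 * K%:R) + 8 * K%:R * B%:R * A%:R) =
  A%:R ^+ 2 * C1 + 2 * K%:R * (8 * K%:R * B%:R * A%:R) :> R by field; lra.
pose G (s : nat) := \sum_(a < A) \sum_(a' < A) F (a%:Z + s%:Z * D) (a'%:Z + s%:Z * D').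
have hG s : (s < 2 * K)%N -> `|S - G s| <= 8 * K%:R * B%:R * A%:R.
  move=> sK; rewrite distrC.
  apply: (le_trans (sum2_shift _ _ _ _ F1)).
  have b1 (E : int) : (`|E| <= B)%N -> `|s%:Z * E|%:~R <= 2 * K%:R * B%:R :> R.
    move=> EB; rewrite normrM.
    have -> : `|s%:Z| * `|E| = (s * `|E|)%N%:Z by lia.
    rewrite -pmulrn -!natrM ler_nat; apply: leq_mul => //; exact: ltnW.
  have A0 : 0 <= A%:R :> R by [].
  have := ler_wpM2l A0 (b1 D DB); have := ler_wpM2l A0 (b1 D' DB'); lra.
have h1 : `|\sum_(s < 2 * K) (S - G s)| <= 2 * K%:R * (8 * K%:R * B%:R * A%:R).
  apply: (le_trans (ler_norm_sum _ _ _)).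
  apply: (@le_trans _ _ (\sum_(s < 2 * K) (8 * K%:R * B%:R * A%:R))).
    by apply: ler_sum => s _; exact: hG.
  by rewrite sumr_const card_ord -[X in X <= _]mulr_natl natrM.
have h2 : `|\sum_(s < 2 * K) G s| <= A%:R ^+ 2 * C1.
  rewrite /G exchange_big /=; apply: (le_trans (ler_norm_sum _ _ _)).
  have -> : A%:R ^+ 2 * C1 = \sum_(a < A) \sum_(a' < A) C1.
    by rewrite !sumr_const !card_ord -[in RHS]mulrnA -[in RHS]mulr_natl natrM -expr2.
  apply: ler_sum => a _; rewrite exchange_big /=; apply: (le_trans (ler_norm_sum _ _ _)).
  by apply: ler_sum => a' _; exact: HC.
have -> : 2 * K%:R * `|S| = `|\sum_(s < 2 * K) S|.
  by rewrite sumr_const card_ord -[in RHS]mulr_natl normrM normr_nat natrM.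
have -> : \sum_(s < 2 * K) S = \sum_(s < 2 * K) G s + \sum_(s < 2 * K) (S - G s).
  by rewrite -big_split /=; apply: eq_bigr => s _; lra.
by apply: (le_trans (ler_normD _ _)); exact: lerD.
Qed.

Lemma count_linear (al be g : R) (m : nat) : al != 0 -> 0 <= g ->
  \sum_(k < m) (if `|al * k%:R + be| < g then 1 else 0) <= 2 * g / `|al| + 1.
Proof.
move=> al0 g0; pose P (k : nat) := `|al * k%:R + be| < g.
have ap : 0 < `|al| by rewrite normr_gt0.
have W0 : 0 <= 2 * g / `|al| by rewrite divr_ge0// mulr_ge0.
pose s := [seq k <- iota 0 m | P k].
have -> : \sum_(k < m) (if `|al * k%:R + be| < g then 1 else 0) = (size s)%:R :> R.
  have -> : size s = (\sum_(k < m) P k)%N.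
    rewrite /s size_filter -sum1_count big_mkcond /=.
    have -> : iota 0 m = index_iota 0 m by rewrite /index_iota subn0.
    by rewrite big_mkord; apply: eq_bigr => k _; case: (P k).
  by rewrite natr_sum; apply: eq_bigr => k _; rewrite /P; case: ifP.
have [->|s0] := eqVneq s [::]; first by rewrite /=; lra.
have exP : exists k, P k.
  case E : s s0 => [//|x s'] _; exists x.
  have : x \in s by rewrite E inE eqxx.
  by rewrite mem_filter => /andP[].
case: (ex_minnP exP) => a Pa amin.
have sub : {subset s <= iota a (Num.truncn (2 * g / `|al|)).+1}.
  move=> x; rewrite mem_filter => /andP[Px _].
  have ax := amin _ Px.
  rewrite mem_iota ax /= addnS ltnS -leq_subLR truncn_ge_nat// natrB//.
  rewrite ler_pdivlMr//.
  have : `|al * x%:R + be - (al * a%:R + be)| < 2 * g.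
    by apply: (le_lt_trans (ler_normB _ _)); move: Px Pa; rewrite /P; lra.
  have -> : al * x%:R + be - (al * a%:R + be) = al * (x%:R - a%:R) by ring.
  rewrite normrM (@ger0_norm _ (x%:R - a%:R)) ?subr_ge0 ?ler_nat// mulrC; exact: ltW.
have us : uniq s by rewrite filter_uniq// iota_uniq.
have := uniq_leq_size us sub; rewrite size_iota -(ler_nat R) => h.
apply: (le_trans h); by rewrite -natr1 lerD2r truncn_le.
Qed.

End TwoParameter.

Lemma in_extended_range (m A k a : nat) (y : int) :
  (2 * A <= m)%N -> (k < m)%N -> (a < A)%N -> (`|y| <= A)%N ->
  [/\ - m%:Z <= k%:Z <= 2 * m%:Z, - m%:Z <= k%:Z + a%:Z <= 2 * m%:Z &
      - m%:Z <= k%:Z + a%:Z + y <= 2 * m%:Z].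
Proof. by move=> ? ? ? ?; split; lia. Qed.

Lemma base_in_extended_range (m : nat) (k : int) :
  0 <= k < m%:Z -> - m%:Z <= k <= 2 * m%:Z.
Proof. by move=> ?; lia. Qed.

Lemma double_cell_le (K B : nat) : (0 < K)%N -> (2 * K * B <= 8 * K ^ 2 * B)%N.
Proof. by move=> K0; rewrite leq_mul2r; apply/orP; right; nia. Qed.

Lemma double_le (K A m : nat) : (0 < K)%N -> (32 * K * A <= m)%N -> (2 * A <= m)%N.
Proof. nia. Qed.

Section Shifts.
Variable R : realType.

Lemma norm_sub_via (x y z : R) : `|x - z| <= `|x - y| + `|y - z|.
Proof. by apply: (le_trans _ (ler_normD _ _)); rewrite subrKA. Qed.

(** Linearisation of a square root: with [x1] and [x2] the square roots of two values,
    [(x2 ^+ 2 - x1 ^+ 2) / (2 * p)] is the increment predicted by the slope at [p]. *)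
Lemma increment_linear (L p x1 x2 dl : R) : 0 < L -> L <= p -> L <= x1 -> L <= x2 ->
  `|x1 - p| <= dl -> `|x2 - p| <= dl ->
  `|x2 - x1 - (x2 ^+ 2 - x1 ^+ 2) / (2 * p)| <= `|x2 ^+ 2 - x1 ^+ 2| * dl / (2 * L ^+ 2).
Proof.
move=> L0 Lp L1 L2 d1 d2; have p0 : 0 < p by lra.
have s0 : 0 < x1 + x2 by lra.
have -> : x2 - x1 - (x2 ^+ 2 - x1 ^+ 2) / (2 * p) =
    (x2 ^+ 2 - x1 ^+ 2) * ((2 * p - x1 - x2) / ((x1 + x2) * (2 * p))).
  by field; lra.
rewrite normrM -mulrA; apply: ler_wpM2l => //.
rewrite normrM normfV (@ger0_norm _ ((x1 + x2) * (2 * p))); last by nra.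
rewrite ler_pdivrMr; last by nra.
have dl0 : 0 <= dl by apply: le_trans d1.
have h1 : `|2 * p - x1 - x2| <= 2 * dl.
  have -> : 2 * p - x1 - x2 = - ((x1 - p) + (x2 - p)) by ring.
  by rewrite normrN; apply: (le_trans (ler_normD _ _)); lra.
have h2 : 4 * L ^+ 2 <= (x1 + x2) * (2 * p).
  by have := ler_pM (ltW L0) (ltW L0) Lp L1; have := ler_pM (ltW L0) (ltW L0) Lp L2; lra.
apply: (le_trans h1); rewrite mulrAC ler_pdivlMr; last by nra.
have := ler_wpM2l dl0 h2; lra.
Qed.

Lemma round_int (x : R) : exists n : int, `|n%:~R - x| <= 1 /\ `|n%:~R| <= `|x| + 1 :> R.
Proof.
exists (Num.floor x).
have h : `|(Num.floor x)%:~R - x| <= 1.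
  have /andP[h1 h2] := floor_itv x; rewrite intrD in h2.
  by rewrite ler_norml; apply/andP; split; lra.
split=> //; have -> : (Num.floor x)%:~R = ((Num.floor x)%:~R - x) + x :> R by ring.
by apply: (le_trans (ler_normD _ _)); lra.
Qed.

(** The shift vector along which the first coordinate of a difference of two points on
    arcs stays put while the second one advances by [b].  It exists because the directions
    [(p, r)] and [(p', r')] are not parallel: this is where curvature enters. *)
Lemma shift_exists (L T b tau g p p' r r' : R) :
  0 < L -> 0 < b -> tau != 0 -> 0 < g ->
  L <= p <= T -> L <= p' <= T -> L <= r <= T -> L <= r' <= T ->
  g <= `|p * r' - p' * r| ->
  exists D D' : int, [/\ `|D%:~R| <= 2 * b * T ^+ 3 / (`|tau| * g) + 1 :> R,
    `|D'%:~R| <= 2 * b * T ^+ 3 / (`|tau| * g) + 1 :> R,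
    `|tau * (D%:~R / (2 * p) - D'%:~R / (2 * p'))| <= `|tau| / L &
    `|- tau * (D%:~R / (2 * r) - D'%:~R / (2 * r')) - b| <= `|tau| / L].
Proof.
move=> L0 b0 t0 g0 /andP[Lp pT] /andP[Lp' pT'] /andP[Lr rT] /andP[Lr' rT'] gd.
have d0 : p * r' - p' * r != 0 by rewrite -normr_gt0; exact: lt_le_trans gd.
have tp : 0 < `|tau| by rewrite normr_gt0.
have T0 : 0 < T by lra.
(* To first order a shift by [p * la] and [p' * la] leaves the difference of the
   functions with slopes [tau / (2 * p)] and [tau / (2 * p')] unchanged; this value of
   [la] makes the other difference move by [b]. *)
pose la := - 2 * b * r * r' / (tau * (p * r' - p' * r)).
have lab (y : R) : L <= y <= T -> `|y * la| <= 2 * b * T ^+ 3 / (`|tau| * g).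
  move=> /andP[Ly yT]; rewrite normrM (@ger0_norm _ y) /la; last by lra.
  rewrite normrM normfV !normrM normrN (@ger0_norm _ 2)// (ger0_norm (ltW b0)).
  rewrite (@ger0_norm _ r) ?(@ger0_norm _ r'); try lra.
  have q0 : 0 <= 2 * b * r * r' by rewrite !mulr_ge0//; lra.
  rewrite mulrA; apply: ler_pM.
  - by rewrite mulr_ge0//; lra.
  - by rewrite invr_ge0 mulr_ge0.
  - have -> : 2 * b * T ^+ 3 = T * (2 * b * T * T) by ring.
    have h1 : r * r' <= T * T by apply: ler_pM; lra.
    have h2 : 2 * b * r * r' <= 2 * b * T * T.
      by have := ler_wpM2l (ltW b0) h1; lra.
    by apply: ler_pM => //; lra.
  - by rewrite lef_pV2 ?posrE ?mulr_gt0 ?normr_gt0// ler_pM2l.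
have [D [D1 D2]] := round_int (p * la); have [D' [D1' D2']] := round_int (p' * la).
have hq (y y' : R) : L <= y -> L <= y' ->
    `|tau * ((D%:~R - p * la) / (2 * y) - (D'%:~R - p' * la) / (2 * y'))| <= `|tau| / L.
  move=> Ly Ly'; rewrite normrM ler_pM2l//.
  have hx (u z : R) : `|u| <= 1 -> L <= z -> `|u / (2 * z)| <= (2 * L)^-1.
    move=> u1 Lz; rewrite normrM normfV (@ger0_norm _ (2 * z)); last by lra.
    rewrite -[leRHS]mul1r ler_pM ?invr_ge0//; first lra.
    by rewrite lef_pV2 ?posrE; lra.
  apply: (le_trans (ler_normB _ _)).
  have := hx _ _ D1 Ly; have := hx _ _ D1' Ly'.
  have -> : (2 * L)^-1 = L^-1 / 2 by field; lra.
  by lra.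
exists D, D'; split.
- by apply: (le_trans D2); rewrite lerD2r; apply: lab; rewrite Lp.
- by apply: (le_trans D2'); rewrite lerD2r; apply: lab; rewrite Lp'.
- have -> : tau * (D%:~R / (2 * p) - D'%:~R / (2 * p')) =
      tau * ((D%:~R - p * la) / (2 * p) - (D'%:~R - p' * la) / (2 * p')).
    by field; apply/andP; split; apply: lt0r_neq0; lra.
  exact: hq.
- have -> : - tau * (D%:~R / (2 * r) - D'%:~R / (2 * r')) - b =
      - (tau * ((D%:~R - p * la) / (2 * r) - (D'%:~R - p' * la) / (2 * r'))).
    by rewrite /la; field; rewrite d0 t0 /=; apply/andP; split; apply: lt0r_neq0; lra.
  by rewrite normrN; exact: hq.
Qed.

End Shifts.

(** * Cancellation along curved shifts *)

(** Two points run along circular arcs, of coordinates [(X k, Y k)] and [(X' k', Y' k')].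
    The squares of the coordinates are affine functions of the parameters, so that the two
    coordinates play symmetric roles.  [Psi] is a function of the difference of the
    two points which cancels when the second coordinate of the difference runs through an
    arithmetic progression of step [b] while the first one is fixed: that is
    [Psi_path].  The conclusion is that the average of [Psi] over all pairs of parameters
    is of order [1 / K].  Pairs of nearly parallel points are few.  Around any other pair the
    parameters can be shifted so that the difference follows such a progression, up to
    errors that are quadratic in the shifts; cells of length [A] are long compared with
    these shifts, whose length is at most [2 * K * B], and short enough for the arcs to look
    straight. *)
Section CurvedSum.
Variable R : realType.
Variables (c T b : R) (K m : nat) (al al' be be' tau C1 : R) (X X' Y Y' : int -> R).
Variable Psi : int -> int -> R.
Let inr (k : int) := - m%:Z <= k <= 2 * m%:Z.
Hypotheses (c01 : 0 < c <= 1) (T0 : 0 < T) (b0 : 0 < b) (K0 : (0 < K)%N) (m0 : (0 < m)%N).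
Hypothesis hX : forall k, inr k -> X k ^+ 2 = al + tau * k%:~R /\ c * T <= X k <= T.
Hypothesis hX' : forall k, inr k -> X' k ^+ 2 = al' + tau * k%:~R /\ c * T <= X' k <= T.
Hypothesis hY : forall k, inr k -> Y k ^+ 2 = be - tau * k%:~R /\ c * T <= Y k <= T.
Hypothesis hY' : forall k, inr k -> Y' k ^+ 2 = be' - tau * k%:~R /\ c * T <= Y' k <= T.
Hypothesis htau : `|tau| = c * T ^+ 2 / m%:R.
Hypothesis hT : 2048 * b * K%:R ^+ 6 <= c ^+ 3 * T.
Hypothesis hm : 4 * K%:R ^+ 2 * T <= m%:R * b.
Hypothesis Psi1 : forall k k', `|Psi k k'| <= 1.
Hypothesis Psi_path : forall k k' : nat -> int,
  (forall s, (s < 2 * K)%N -> inr (k s) /\ inr (k' s)) ->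
  (forall s, (s < 2 * K)%N ->
     `|X (k s) - X' (k' s) - (X (k 0%N) - X' (k' 0%N))| <= b / K%:R) ->
  (forall s, (s < 2 * K)%N ->
     `|Y (k s) - Y' (k' s) - (Y (k 0%N) - Y' (k' 0%N)) - s%:R * b| <= b / K%:R) ->
  `|\sum_(s < 2 * K) Psi (k s) (k' s)| <= C1.

Let c0 : 0 < c. Proof. by case/andP: c01. Qed.
Let c1 : c <= 1. Proof. by case/andP: c01. Qed.
Let Kr : 1 <= K%:R :> R. Proof. by rewrite ler1n. Qed.
Let mr : 0 < m%:R :> R. Proof. by rewrite ltr0n. Qed.
Let tau0 : tau != 0.
Proof. by rewrite -normr_gt0 htau divr_gt0// mulr_gt0// exprn_gt0. Qed.

Let c_ge0 : 0 <= c. Proof. exact: ltW. Qed.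
Let T_ge0 : 0 <= T. Proof. exact: ltW. Qed.
Let b_ge0 : 0 <= b. Proof. exact: ltW. Qed.
Let cT0 : 0 < c * T. Proof. by rewrite mulr_gt0. Qed.
Let cT_ge0 : 0 <= c * T. Proof. by rewrite mulr_ge0. Qed.

Let B0 : R := 4 * b * K%:R * m%:R / (c * T).
Let B := (Num.truncn B0).+2.
Let A := (8 * K ^ 2 * B)%N.

Let mlarge : 8192 * K%:R ^+ 8 <= m%:R :> R.
Proof.
have h1 : 4 * K%:R ^+ 2 * (2048 * b * K%:R ^+ 6) <= 4 * K%:R ^+ 2 * (c ^+ 3 * T).
  by rewrite ler_wpM2l// mulr_ge0// exprn_ge0.
have h2 : 4 * K%:R ^+ 2 * (c ^+ 3 * T) <= 4 * K%:R ^+ 2 * T.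
  rewrite ler_wpM2l// ?mulr_ge0 ?exprn_ge0//.
  by rewrite ler_piMl// exprn_ile1//.
rewrite -(ler_pM2r b0); apply: (le_trans _ hm); apply: (le_trans _ h2).
by apply: (le_trans _ h1); rewrite le_eqVlt; apply/orP; left; apply/eqP; ring.
Qed.

Let B0_large : 2 <= B0.
Proof.
rewrite /B0 ler_pdivlMr ?mulr_gt0//.
have h : 4 * K%:R ^+ 2 * T * K%:R <= m%:R * b * K%:R by rewrite ler_wpM2r.
have h2 : c * T <= T by rewrite ler_piMl.
have h3 : T <= K%:R ^+ 3 * T by rewrite ler_peMl// exprn_ege1.
have -> : 4 * b * K%:R * m%:R = 4 * (m%:R * b * K%:R) by ring.
have e : 4 * K%:R ^+ 2 * T * K%:R = 4 * (K%:R ^+ 3 * T) by ring.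
move: h h2 h3; rewrite e; set u := K%:R ^+ 3 * T; set v := m%:R * b * K%:R; set w := c * T.
have := T0; lra.
Qed.

Let BE : B%:R = (Num.truncn B0)%:R + 2 :> R.
Proof. by rewrite /B -addn2 natrD. Qed.

Let B_ge : B0 + 1 <= B%:R.
Proof. by have := truncnS_gt B0; rewrite BE -natr1; lra. Qed.

Let B_le : B%:R <= 2 * B0.
Proof.
have : (Num.truncn B0)%:R <= B0 by rewrite truncn_le; have := B0_large; lra.
by rewrite BE; have := B0_large; lra.
Qed.

Let AE : A%:R = 8 * K%:R ^+ 2 * B%:R :> R.
Proof. by rewrite /A !natrM; ring. Qed.

Let A_le : 32 * K%:R * A%:R <= m%:R :> R.
Proof.
rewrite AE; have h : 32 * K%:R * (8 * K%:R ^+ 2 * B%:R) <= 512 * K%:R ^+ 3 * B0.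
  have -> : 32 * K%:R * (8 * K%:R ^+ 2 * B%:R) = (256 * K%:R ^+ 3) * B%:R :> R by ring.
  have -> : 512 * K%:R ^+ 3 * B0 = (256 * K%:R ^+ 3) * (2 * B0) by ring.
  by rewrite ler_wpM2l// mulr_ge0// exprn_ge0.
apply: (le_trans h); rewrite /B0 mulrA ler_pdivrMr ?mulr_gt0//.
have -> : 512 * K%:R ^+ 3 * (4 * b * K%:R * m%:R) = m%:R * (2048 * b * K%:R ^+ 4) by ring.
rewrite ler_wpM2l////.
apply: (@le_trans _ _ (2048 * b * K%:R ^+ 6)).
  have b2 : 0 <= 2048 * b by have := b0; lra.
  by apply: (ler_wpM2l b2); apply: ler_weXn2l.
apply: (le_trans hT); rewrite ler_wpM2r//.
by rewrite -[leRHS]expr1; apply: ler_wiXn2l.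
Qed.

Let A_m : (2 * A <= m)%N.
Proof. by apply: (double_le K0); rewrite -(ler_nat R) 2!natrM. Qed.

Lemma sqrt_increment (Z : int -> R) (ga th : R) (k0 a : nat) (y : int) :
  `|th| = `|tau| ->
  (forall k, inr k -> Z k ^+ 2 = ga + th * k%:~R /\ c * T <= Z k <= T) ->
  (k0 < m)%N -> (a < A)%N -> (`|y| <= A)%N -> `|y%:~R| <= 2 * K%:R * B%:R :> R ->
  `|Z (k0%:Z + a%:Z + y) - Z (k0%:Z + a%:Z) - th * (y%:~R / (2 * Z k0%:Z))|
    <= b / (4 * K%:R).
Proof.
move=> thE hZ k0m aA yA yB.
have cTp := cT0; have bp := b0; have Kp := Kr.
have [r0 r1 r2] := in_extended_range A_m k0m aA yA.
have [e0 /andP[l0 _]] := hZ _ r0; have [e1 /andP[l1 _]] := hZ _ r1.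
have [e2 /andP[l2 _]] := hZ _ r2.
have close (x : R) (z : int) : x ^+ 2 = ga + th * (k0%:Z + z)%:~R -> c * T <= x ->
    `|z%:~R| <= 2 * A%:R :> R -> `|x - Z k0%:Z| <= `|tau| * A%:R / (c * T).
  move=> ex lx zA.
  have -> : x - Z k0%:Z = (th * z%:~R) / (x + Z k0%:Z).
    apply/eqP; rewrite eq_sym; apply/eqP.
    apply: (canLR (mulfK _)); first by rewrite gt_eqF//; lra.
    by rewrite -subr_sqr ex e0 intrD; ring.
  rewrite normrM normfV normrM thE (@ger0_norm _ (x + _)); last by lra.
  rewrite ler_pdivrMr; last by lra.
  rewrite mulrAC ler_pdivlMr//.
  have h : `|tau| * `|z%:~R| <= `|tau| * (2 * A%:R) by rewrite ler_wpM2l.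
  have h0 : 0 <= `|tau| * A%:R by rewrite mulr_ge0.
  have := ler_wpM2r (ltW cT0) h.
  have : `|tau| * A%:R * (2 * (c * T)) <= `|tau| * A%:R * (x + Z k0%:Z).
    by rewrite ler_wpM2l//; lra.
  lra.
have A0 : 0 <= A%:R :> R by [].
have hz1 : `|(a%:Z)%:~R| <= 2 * A%:R :> R.
  by rewrite -pmulrn normr_nat -natrM ler_nat (leq_trans (ltnW aA))// leq_pmull.
have hz2 : `|(a%:Z + y)%:~R| <= 2 * A%:R :> R.
  rewrite intrD; apply: (le_trans (ler_normD _ _)).
  have h1 : `|(a%:Z)%:~R| <= A%:R :> R by rewrite -pmulrn normr_nat ler_nat ltnW.
  have h2 : `|y%:~R| <= A%:R :> R.
    by rewrite -intr_norm (_ : `|y| = `|y|%N%:Z)// -pmulrn ler_nat.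
  by lra.
rewrite -addrA in e2 l2 *.
have := increment_linear cT0 l0 l1 l2 (close _ _ e1 l1 hz1) (close _ _ e2 l2 hz2).
have -> : Z (k0%:Z + (a%:Z + y)) ^+ 2 - Z (k0%:Z + a%:Z) ^+ 2 = th * y%:~R.
  by rewrite e1 e2 !intrD; ring.
rewrite -mulrA => /le_trans; apply.
rewrite normrM thE.
have h1 : `|tau| * `|y%:~R| * (`|tau| * A%:R / (c * T)) / (2 * (c * T) ^+ 2) <=
   `|tau| * (2 * K%:R * B%:R) * (`|tau| * A%:R / (c * T)) / (2 * (c * T) ^+ 2).
  rewrite ler_pM2r ?invr_gt0 ?mulr_gt0 ?exprn_gt0//.
  by rewrite ler_wpM2r ?divr_ge0 ?mulr_ge0// ler_wpM2l// normr_gt0.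
apply: (le_trans h1).
have tB : `|tau| * B%:R <= 8 * b * K%:R * T.
  apply: (le_trans (ler_wpM2l (normr_ge0 tau) B_le)).
  rewrite htau /B0 le_eqVlt; apply/orP; left; apply/eqP; field.
  by rewrite !gt_eqF.
have -> : `|tau| * (2 * K%:R * B%:R) * (`|tau| * A%:R / (c * T)) / (2 * (c * T) ^+ 2)
   = (`|tau| * B%:R) ^+ 2 * (8 * K%:R ^+ 3 / (c * T) ^+ 3).
  by rewrite AE; field; rewrite !gt_eqF.
have h2 : (`|tau| * B%:R) ^+ 2 <= (8 * b * K%:R * T) ^+ 2.
  by rewrite ler_sqr ?nnegrE ?mulr_ge0//.
apply: (le_trans (ler_wpM2r _ h2)).
  by rewrite divr_ge0 ?exprn_ge0 ?mulr_ge0 ?exprn_ge0//.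
have -> : (8 * b * K%:R * T) ^+ 2 * (8 * K%:R ^+ 3 / (c * T) ^+ 3) =
  (2048 * b * K%:R ^+ 6) * b / (4 * K%:R * (c ^+ 3 * T)).
  by field; rewrite !gt_eqF//; lra.
rewrite ler_pdivrMr; last by rewrite !mulr_gt0// ?exprn_gt0//; lra.
have -> : b / (4 * K%:R) * (4 * K%:R * (c ^+ 3 * T)) = (c ^+ 3 * T) * b.
  by field; rewrite gt_eqF//; lra.
by rewrite ler_wpM2r//.
Qed.


Let A_gt0 : (0 < A)%N.
Proof. by rewrite /A !muln_gt0 K0. Qed.

Lemma good_cell (k0 k1 : nat) : (k0 < m)%N -> (k1 < m)%N ->
  T ^+ 4 / K%:R <= `|X k0%:Z ^+ 2 * Y' k1%:Z ^+ 2 - X' k1%:Z ^+ 2 * Y k0%:Z ^+ 2| ->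
  `|\sum_(a < A) \sum_(a' < A) Psi (k0%:Z + a%:Z) (k1%:Z + a'%:Z)| <=
    A%:R ^+ 2 * ((C1 / 2 + 1) / K%:R).
Proof.
move=> k0m k1m; have cTp := cT0; have bp := b0; have Kp := Kr; have Tp := T0.
have K2 : 0 < K%:R :> R by lra.
have [r0 _ _] := @in_extended_range m A k0 0 0 A_m k0m A_gt0 (leq0n _).
have [r1 _ _] := @in_extended_range m A k1 0 0 A_m k1m A_gt0 (leq0n _).
have [_ lX] := hX r0; have [_ lX'] := hX' r1.
have [_ lY] := hY r0; have [_ lY'] := hY' r1.
set p := X k0%:Z in lX *; set p' := X' k1%:Z in lX' *.
set r := Y k0%:Z in lY *; set r' := Y' k1%:Z in lY' *.
move=> hg; pose g := T ^+ 2 / (2 * K%:R).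
have g0 : 0 < g by rewrite divr_gt0 ?exprn_gt0// mulr_gt0.
have hd : g <= `|p * r' - p' * r|.
  case/andP: lX lX' lY lY' => a1 a2 /andP[a3 a4] /andP[a5 a6] /andP[a7 a8].
  have s1 : p * r' <= T * T by apply: ler_pM; lra.
  have s2 : p' * r <= T * T by apply: ler_pM; lra.
  have s0 : 0 < p * r' + p' * r by rewrite addr_gt0// mulr_gt0//; lra.
  have e : p ^+ 2 * r' ^+ 2 - p' ^+ 2 * r ^+ 2 = (p * r' - p' * r) * (p * r' + p' * r) by ring.
  move: hg; rewrite e normrM (ger0_norm (ltW s0)) => hg.
  rewrite /g ler_pdivrMr ?mulr_gt0//.
  have T2 : 0 < T ^+ 2 by rewrite exprn_gt0.
  rewrite -(ler_pM2r T2) -exprD.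
  rewrite ler_pdivrMr// in hg; apply: (le_trans hg).
  have : `|p * r' - p' * r| * (p * r' + p' * r) * K%:R <= `|p * r' - p' * r| * (2 * T ^+ 2) * K%:R.
    by rewrite ler_pM2r// ler_wpM2l//; lra.
  lra.
have [D [D' [D1 D2 D3 D4]]] := shift_exists cT0 b0 tau0 g0 lX lX' lY lY' hd.
have eB0 : 2 * b * T ^+ 3 / (`|tau| * g) = B0.
  by rewrite htau /g /B0; field; rewrite !gt_eqF.
rewrite eB0 in D1 D2.
have toB (E : int) : `|E%:~R| <= B0 + 1 -> (`|E| <= B)%N.
  move=> h; rewrite -(ler_nat R); apply: le_trans B_ge.
  by apply: le_trans h; rewrite -intr_norm (_ : `|E| = `|E|%N%:Z)// -pmulrn.
have DB := toB _ D1; have DB' := toB _ D2.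
have K2B : (2 * K * B <= A)%N by exact: double_cell_le.
have sD (E : int) (s : nat) : (s < 2 * K)%N -> (`|E| <= B)%N ->
    (`|(s%:Z * E)%R| <= A)%N /\ `|(s%:Z * E)%:~R| <= 2 * K%:R * B%:R :> R.
  move=> sK EB; have h : (`|(s%:Z * E)%R| <= 2 * K * B)%N.
    by rewrite abszM; apply: leq_mul => //; exact: ltnW.
  split; first exact: leq_trans K2B.
  rewrite -intr_norm (_ : `|s%:Z * E| = `|(s%:Z * E)%R|%N%:Z)//.
  by rewrite -pmulrn -!natrM ler_nat.
have hs (s : nat) : (s < 2 * K)%N -> s%:R * (`|tau| / (c * T)) <= b / (2 * K%:R).
  move=> sK; have h1 : s%:R <= 2 * K%:R :> R by rewrite -natrM ler_nat ltnW.
  have h2 : 0 <= `|tau| / (c * T) by rewrite divr_ge0.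
  apply: (le_trans (ler_wpM2r h2 h1)).
  have -> : 2 * K%:R * (`|tau| / (c * T)) = 4 * K%:R ^+ 2 * T / (m%:R * (2 * K%:R)).
    by rewrite htau; field; rewrite !gt_eqF.
  rewrite ler_pdivrMr ?mulr_gt0//.
  have -> : b / (2 * K%:R) * (m%:R * (2 * K%:R)) = m%:R * b.
    by field; rewrite gt_eqF.
  exact: hm.
have bK : b / (4 * K%:R) + b / (4 * K%:R) + b / (2 * K%:R) = b / K%:R.
  by field; rewrite gt_eqF.
have combine (u v x y z : R) (s : nat) : (s < 2 * K)%N ->
    `|u - s%:R * x| <= b / (4 * K%:R) -> `|v - s%:R * y| <= b / (4 * K%:R) ->
    `|x - y - z| <= `|tau| / (c * T) -> `|u - v - s%:R * z| <= b / K%:R.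
  move=> sK h1 h2 h3; rewrite -bK.
  have -> : u - v - s%:R * z = (u - s%:R * x) - (v - s%:R * y) + s%:R * (x - y - z) by ring.
  apply: (le_trans (ler_normD _ _)); apply: lerD.
    by apply: (le_trans (ler_normB _ _)); exact: lerD.
  rewrite normrM normr_nat; apply: le_trans (hs s sK).
  by rewrite ler_wpM2l.
have := @cell_sum _ (fun k k' => Psi (k0%:Z + k) (k1%:Z + k')) A K B D D' C1.
move=> /(_ _ DB DB' K0) H.
apply: (le_trans (H _ _)) => //; last first.
  rewrite le_eqVlt; apply/orP; left; apply/eqP.
  by rewrite AE; field; rewrite gt_eqF.
have eqZ (th q : R) (E : int) (s : nat) :
    th * ((s%:Z * E)%:~R / (2 * q)) = s%:R * (th * (E%:~R / (2 * q))).
  by rewrite intrM -pmulrn -!mulrA mulrCA.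
move=> a a' aA aA'.
under eq_bigr do rewrite !addrA.
apply: (Psi_path (k := fun s => k0%:Z + a%:Z + s%:Z * D)
                 (k' := fun s => k1%:Z + a'%:Z + s%:Z * D')) => s sK;
  have [sD1 sD1'] := sD D s sK DB; have [sD2 sD2'] := sD D' s sK DB'.
- have [_ _ ?] := in_extended_range A_m k0m aA sD1.
  by have [_ _ ?] := in_extended_range A_m k1m aA' sD2.
- have h1 := sqrt_increment erefl hX k0m aA sD1 sD1'.
  have h2 := sqrt_increment erefl hX' k1m aA' sD2 sD2'.
  rewrite eqZ in h1; rewrite eqZ in h2.
  have := @combine _ _ _ _ 0 s sK h1 h2.
  rewrite !mul0r !addr0 subr0 mulr0 subr0 -mulrBr => /(_ D3).
  by congr (`|_| <= _); ring.
- have hYn k : inr k -> Y k ^+ 2 = be + - tau * k%:~R /\ c * T <= Y k <= T.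
    by move=> /hY; rewrite mulNr.
  have hYn' k : inr k -> Y' k ^+ 2 = be' + - tau * k%:~R /\ c * T <= Y' k <= T.
    by move=> /hY'; rewrite mulNr.
  have h1 := sqrt_increment (normrN tau) hYn k0m aA sD1 sD1'.
  have h2 := sqrt_increment (normrN tau) hYn' k1m aA' sD2 sD2'.
  rewrite eqZ in h1; rewrite eqZ in h2.
  have := @combine _ _ _ _ b s sK h1 h2.
  rewrite !mul0r !addr0 -mulrBr => /(_ D4).
  by congr (`|_| <= _); ring.
Qed.

Hypothesis C1_ge0 : 0 <= C1.

(** The condition that the two points be nearly parallel is an affine inequality in the
    parameter of the second one, so it holds on an interval of parameters. *)
Lemma count_degenerate (k0 : nat) : (k0 < m)%N ->
  \sum_(k1 < m) (if `|X k0%:Z ^+ 2 * Y' k1%:Z ^+ 2 - X' k1%:Z ^+ 2 * Y k0%:Z ^+ 2|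
      < T ^+ 4 / K%:R then 1 else 0) <= (c ^- 3 + 1) / K%:R * m%:R.
Proof.
move=> k0m; have cTp := cT0; have Kp := Kr; have Tp := T0.
have K2 : 0 < K%:R :> R by lra.
have [r0 _ _] := @in_extended_range m A k0 0 0 A_m k0m A_gt0 (leq0n _).
have [eX /andP[lX _]] := hX r0; have [eY /andP[lY _]] := hY r0.
set q := X k0%:Z ^+ 2; set q2 := Y k0%:Z ^+ 2.
have hq : (c * T) ^+ 2 <= q by rewrite ler_sqr ?nnegrE; lra.
have hq2 : (c * T) ^+ 2 <= q2 by rewrite ler_sqr ?nnegrE; lra.
have cT2 : 0 < (c * T) ^+ 2 by rewrite exprn_gt0.
have s0 : 0 < q + q2 by lra.
have al0 : - tau * (q + q2) != 0 by rewrite mulf_neq0 ?oppr_eq0// gt_eqF.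
have g0 : 0 <= T ^+ 4 / K%:R by rewrite divr_ge0 ?exprn_ge0.
rewrite (eq_bigr (fun k1 : 'I_m => if `|- tau * (q + q2) * (k1 : nat)%:R
    + (q * be' - al' * q2)| < T ^+ 4 / K%:R then 1 else 0)); last first.
  move=> k1 _; have [r1 _ _] := @in_extended_range m A k1 0 0 A_m (ltn_ord k1) A_gt0 (leq0n _).
  have [-> _] := hX' r1; have [-> _] := hY' r1.
  have -> : q * (be' - tau * (k1%:Z)%:~R) - (al' + tau * (k1%:Z)%:~R) * q2 =
    - tau * (q + q2) * (k1 : nat)%:R + (q * be' - al' * q2) by rewrite -pmulrn; ring.
  by [].
apply: (le_trans (count_linear _ _ al0 g0)).
have -> : (c ^- 3 + 1) / K%:R * m%:R = c ^- 3 / K%:R * m%:R + m%:R / K%:R.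
  by rewrite [X in X * _]mulrDl mul1r [LHS]mulrDl (mulrC K%:R^-1).
apply: lerD.
  rewrite normrM normrN (ger0_norm (ltW s0)) ler_pdivrMr; last first.
    by rewrite mulr_gt0// normr_gt0.
  have h : `|tau| * (2 * (c * T) ^+ 2) <= `|tau| * (q + q2) by rewrite ler_wpM2l//; lra.
  have h3 : 0 <= c ^- 3 / K%:R * m%:R by rewrite !mulr_ge0// ?invr_ge0// exprn_ge0.
  apply: (le_trans _ (ler_wpM2l h3 h)).
  rewrite le_eqVlt; apply/orP; left; apply/eqP.
  by rewrite htau; field; rewrite !gt_eqF.
rewrite ler_pdivlMr// mul1r.
have := mlarge; have : K%:R <= K%:R ^+ 8 :> R.
  by rewrite -[leLHS]expr1; apply: ler_weXn2l.
lra.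
Qed.

Lemma two_parameter_sum :
  `|\sum_(k < m) \sum_(k' < m) Psi k%:Z k'%:Z| <= (C1 + 4 + c ^- 3) / K%:R * m%:R ^+ 2.
Proof.
have cTp := cT0; have Kp := Kr; have Tp := T0; have mp := mr.
have K2 : 0 < K%:R :> R by lra.
have Ap : 0 < A%:R :> R by rewrite ltr0n A_gt0.
have A2 : 0 < A%:R ^+ 2 :> R by rewrite exprn_gt0.
set S := \sum_(k < m) _.
(* The sum over the whole square is replaced by its average over all translates by
   vectors of a cell, that is by a sum of sums over cells with arbitrary corners. *)
pose G a a' := \sum_(k < m) \sum_(k' < m) Psi (k%:Z + a%:Z) (k'%:Z + a'%:Z).
have hG (a a' : nat) : (a < A)%N -> (a' < A)%N -> `|S - G a a'| <= 4 * m%:R * A%:R.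
  move=> aA aA'; rewrite distrC; apply: (le_trans (sum2_shift _ _ _ _ Psi1)).
  have ea (n : nat) : `|n%:Z|%:~R = n%:R :> R by rewrite ger0_norm.
  rewrite !ea.
  have h1 : m%:R * a%:R <= m%:R * A%:R :> R by rewrite ler_pM2l// ler_nat ltnW.
  have h2 : m%:R * a'%:R <= m%:R * A%:R :> R by rewrite ler_pM2l// ler_nat ltnW.
  lra.
have sumA (x : R) : \sum_(a < A) \sum_(a' < A) x = A%:R ^+ 2 * x.
  by rewrite !sumr_const !card_ord -mulrnA -[LHS]mulr_natl natrM -expr2.
have e1 : `|\sum_(a < A) \sum_(a' < A) (S - G a a')| <= A%:R ^+ 2 * (4 * m%:R * A%:R).
  rewrite -sumA; apply: (le_trans (ler_norm_sum _ _ _)); apply: ler_sum => a _.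
  by apply: (le_trans (ler_norm_sum _ _ _)); apply: ler_sum => a' _; exact: hG.
have e2 : `|\sum_(a < A) \sum_(a' < A) G a a'| <=
   A%:R ^+ 2 * ((C1 / 2 + 1) / K%:R * m%:R ^+ 2 + (c ^- 3 + 1) / K%:R * m%:R ^+ 2).
  have -> : \sum_(a < A) \sum_(a' < A) G a a' =
    \sum_(k < m) \sum_(k' < m) \sum_(a < A) \sum_(a' < A) Psi (k%:Z + a%:Z) (k'%:Z + a'%:Z).
    under eq_bigr do rewrite exchange_big /=.
    rewrite exchange_big /=; apply: eq_bigr => k _.
    under eq_bigr do rewrite exchange_big /=.
    by rewrite exchange_big.
  apply: (@le_trans _ _ (\sum_(k < m) \sum_(k' < m) A%:R ^+ 2 * ((C1 / 2 + 1) / K%:R +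
    (if `|X k%:Z ^+ 2 * Y' k'%:Z ^+ 2 - X' k'%:Z ^+ 2 * Y k%:Z ^+ 2|
      < T ^+ 4 / K%:R then 1 else 0)))).
    apply: (le_trans (ler_norm_sum _ _ _)); apply: ler_sum => k _.
    apply: (le_trans (ler_norm_sum _ _ _)); apply: ler_sum => k' _.
    case: ltP => h; last by rewrite addr0; exact: good_cell.
    apply: (@le_trans _ _ (A%:R ^+ 2 * 1)); last first.
      by rewrite ler_pM2l// lerDr divr_ge0// addr_ge0// divr_ge0.
    rewrite -sumA; apply: (le_trans (ler_norm_sum _ _ _)); apply: ler_sum => a _.
    by apply: (le_trans (ler_norm_sum _ _ _)); apply: ler_sum.
  under eq_bigr do rewrite -mulr_sumr big_split /=.
  rewrite -mulr_sumr big_split /= ler_pM2l//; apply: lerD.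
    rewrite !sumr_const !card_ord -mulrnA -[X in X <= _]mulr_natl natrM -expr2.
    by rewrite mulrC.
  apply: (@le_trans _ _ (\sum_(k < m) (c ^- 3 + 1) / K%:R * m%:R)).
    by apply: ler_sum => k _; exact: count_degenerate.
  by rewrite sumr_const card_ord -[X in X <= _]mulr_natr -mulrA -expr2.
have e3 : A%:R ^+ 2 * `|S| <= A%:R ^+ 2 * ((C1 / 2 + 1) / K%:R * m%:R ^+ 2
    + (c ^- 3 + 1) / K%:R * m%:R ^+ 2 + 4 * m%:R * A%:R).
  have -> : A%:R ^+ 2 * `|S| = `|\sum_(a < A) \sum_(a' < A) S|.
    by rewrite sumA normrM (ger0_norm (ltW A2)).
  have -> : \sum_(a < A) \sum_(a' < A) S =
    \sum_(a < A) \sum_(a' < A) G a a' + \sum_(a < A) \sum_(a' < A) (S - G a a').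
    rewrite -big_split /=; apply: eq_bigr => a _; rewrite -big_split /=.
    by apply: eq_bigr => a' _; rewrite addrC subrK.
  by rewrite mulrDr; apply: (le_trans (ler_normD _ _)); exact: lerD.
rewrite ler_pM2l// in e3; apply: (le_trans e3).
have e4 : 4 * m%:R * A%:R <= m%:R ^+ 2 / K%:R :> R.
  rewrite ler_pdivlMr// expr2 -!mulrA mulrCA ler_pM2l//.
  have h0 : 0 <= K%:R * A%:R :> R by rewrite mulr_ge0.
  have : 32 * (K%:R * A%:R) <= m%:R :> R by have := A_le; rewrite -mulrA.
  lra.
have e5 : 0 <= C1 / 2 / K%:R * m%:R ^+ 2 by rewrite !mulr_ge0 ?exprn_ge0// divr_ge0.
have e6 : 0 <= m%:R ^+ 2 / K%:R :> R by rewrite divr_ge0 ?exprn_ge0.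
have -> : (C1 + 4 + c ^- 3) / K%:R * m%:R ^+ 2 = (C1 / 2 + 1) / K%:R * m%:R ^+ 2
    + (c ^- 3 + 1) / K%:R * m%:R ^+ 2 + C1 / 2 / K%:R * m%:R ^+ 2 + 2 * (m%:R ^+ 2 / K%:R).
  by field; rewrite !gt_eqF.
lra.
Qed.

End CurvedSum.

(** * A measure on the sphere *)

Section Sphere.
Variables (R : realType) (d : nat) (z0 : 'I_d) (T : R) (m : nat).
Hypotheses (T0 : 0 < T) (m0 : (0 < m)%N).

Let c : R := (4 * d%:R)^-1.

Let dr : 1 <= d%:R :> R.
Proof. by rewrite ler1n; exact: leq_ltn_trans (ltn_ord z0). Qed.
Let c_gt0 : 0 < c. Proof. by rewrite invr_gt0; have := dr; lra. Qed.
Let c_le1 : 4 * c <= 1.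
Proof. by rewrite /c invfM mulrA divff ?mul1r ?invf_le1//; have := dr; lra. Qed.
Let cd : 4 * c * d%:R = 1.
Proof. by rewrite /c; field; rewrite gt_eqF//; have := dr; lra. Qed.
Let mr : 0 < m%:R :> R. Proof. by rewrite ltr0n. Qed.

(** The squares of the coordinates of points of the sphere of radius [T].  All squares
    except that of coordinate [z0] are equally spaced, and the last one is then affine in
    each parameter, so that any coordinate can be traded against any other one.  The
    parameters have a component for every coordinate, so that they share their index type
    with the points. *)
Definition sphere_sq (k : 'I_d -> int) (i : 'I_d) : R :=
  if i == z0 then T ^+ 2 - \sum_(j | j != z0) c * T ^+ 2 * (2 + (k j)%:~R / m%:R)
  else c * T ^+ 2 * (2 + (k i)%:~R / m%:R).

Definition sphere_point (k : 'I_d -> int) (i : 'I_d) : int :=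
  Num.floor (Num.sqrt (sphere_sq k i)).

Definition upd (T : Type) (k : 'I_d -> T) (i : 'I_d) (x : T) (j : 'I_d) : T :=
  if j == i then x else k j.

Lemma sum_sphere_sq k : \sum_i sphere_sq k i = T ^+ 2.
Proof.
rewrite (bigD1 z0)//= /sphere_sq eqxx.
rewrite [X in _ + X](eq_bigr (fun j => c * T ^+ 2 * (2 + (k j)%:~R / m%:R))); last first.
  by move=> i /negbTE ->.
by rewrite subrK.
Qed.

Lemma sphere_sq_range (k : 'I_d -> int) (i : 'I_d) :
  (forall j, - m%:Z <= k j <= 2 * m%:Z) -> c * T ^+ 2 <= sphere_sq k i <= T ^+ 2.
Proof.
move=> hk; have T2 : 0 < T ^+ 2 by rewrite exprn_gt0.
have cT2 : 0 < c * T ^+ 2 by rewrite mulr_gt0.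
have hj j : c * T ^+ 2 <= c * T ^+ 2 * (2 + (k j)%:~R / m%:R) <= 4 * c * T ^+ 2.
  have /andP[k1 k2] := hk j.
  have h1 : -1 <= (k j)%:~R / m%:R :> R.
    by rewrite ler_pdivlMr// mulN1r -[m%:R]/((m%:Z)%:~R) -mulrNz ler_int.
  have h2 : (k j)%:~R / m%:R <= 2 :> R.
    by rewrite ler_pdivrMr// -[m%:R]/((m%:Z)%:~R) -[2]/((2%:Z)%:~R) -intrM ler_int.
  have := ler_wpM2l (ltW cT2) h1; have := ler_wpM2l (ltW cT2) h2.
  by move=> ? ?; apply/andP; split; lra.
have h4 : 4 * c * T ^+ 2 <= T ^+ 2 by rewrite -[leRHS]mul1r ler_pM2r.
rewrite /sphere_sq; case: eqP => _; last first.
  by have /andP[? ?] := hj i; apply/andP; split; lra.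
have s1 : \sum_(j | j != z0) c * T ^+ 2 * (2 + (k j)%:~R / m%:R) <=
    \sum_(j | j != z0) 4 * c * T ^+ 2.
  by apply: ler_sum => j _; case/andP: (hj j).
have s2 : \sum_(j | j != z0) 4 * c * T ^+ 2 + 4 * c * T ^+ 2 = T ^+ 2.
  have : \sum_(j : 'I_d) 4 * c * T ^+ 2 = T ^+ 2.
    rewrite sumr_const card_ord -[LHS]mulr_natr.
    have -> : 4 * c * T ^+ 2 * d%:R = (4 * c * d%:R) * T ^+ 2 by ring.
    by rewrite cd mul1r.
  by rewrite (bigD1 z0)//= addrC.
have s3 : 0 <= \sum_(j | j != z0) c * T ^+ 2 * (2 + (k j)%:~R / m%:R).
  by apply: sumr_ge0 => j _; case/andP: (hj j) => h _; lra.
by apply/andP; split; lra.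
Qed.

Lemma sphere_sqrt_range (k : 'I_d -> int) (i : 'I_d) :
  (forall j, - m%:Z <= k j <= 2 * m%:Z) ->
  Num.sqrt (sphere_sq k i) ^+ 2 = sphere_sq k i /\
  c * T <= Num.sqrt (sphere_sq k i) <= T.
Proof.
move=> hk; have /andP[h1 h2] := sphere_sq_range i hk.
have T2 : 0 < T ^+ 2 by rewrite exprn_gt0.
have cT2 : 0 < c * T ^+ 2 by rewrite mulr_gt0.
split; first by rewrite sqr_sqrtr//; lra.
have cT : 0 <= c * T by rewrite mulr_ge0// ltW.
apply/andP; split.
  rewrite -[leLHS]ger0_norm// -sqrtr_sqr; apply: ler_wsqrtr; apply: le_trans h1.
  have -> : (c * T) ^+ 2 = c * (c * T ^+ 2) by ring.
  by apply: ler_piMl; [exact: ltW|have := c_le1; have := c_gt0; lra].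
have T_ge0 : 0 <= T by exact: ltW.
by rewrite -[leRHS]ger0_norm// -sqrtr_sqr; exact: ler_wsqrtr.
Qed.

Lemma sphere_point_bounds (k : 'I_d -> int) (i : 'I_d) :
  (forall j, - m%:Z <= k j <= 2 * m%:Z) -> 0 <= sphere_point k i /\ (sphere_point k i)%:~R <= T.
Proof.
move=> hk; have [_ /andP[h1 h2]] := sphere_sqrt_range i hk.
have cT : 0 <= c * T by rewrite mulr_ge0// ltW.
split; first by rewrite floor_ge0; lra.
by apply: le_trans h2; exact: floor_le.
Qed.

Variables (b K : nat).
Hypotheses (K0 : (0 < K)%N) (Kb : (K <= b)%N).
Hypothesis hT : 2048 * b%:R * K%:R ^+ 6 <= c ^+ 3 * T.
Hypothesis hm : 4 * K%:R ^+ 2 * T <= m%:R * b%:R.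
Variable Phi : ('I_d -> int) -> R.
Hypothesis Phi1 : forall z, `|Phi z| <= 1.
Hypothesis Phi_lip : forall z z',
  `|Phi z - Phi z'| <= 2 / b%:R * \sum_i `|(z i - z' i)%:~R|.
Variable j : 'I_d.
Hypothesis Phi_cancel : forall z,
  `|\sum_(s < 2 * K) Phi (fun i => z i + (if i == j then s%:Z * b%:Z else 0))| <= 2.

Let b0 : (0 < b)%N. Proof. exact: leq_trans Kb. Qed.
Let br : 0 < b%:R :> R. Proof. by rewrite ltr0n. Qed.
Let Kr : 0 < K%:R :> R. Proof. by rewrite ltr0n. Qed.

Lemma floor_diff (x x' y y' w : R) (n : int) : n%:~R = w ->
  `|(Num.floor x - Num.floor x' - (Num.floor y - Num.floor y') - n)%:~R| <=
  `|x - x' - (y - y') - w| + 2.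
Proof.
move=> <-.
have -> : (Num.floor x - Num.floor x' - (Num.floor y - Num.floor y') - n)%:~R =
  (Num.floor x)%:~R - (Num.floor x')%:~R - ((Num.floor y)%:~R - (Num.floor y')%:~R) - n%:~R :> R.
  by rewrite !(intrD, intrN).
have h (u : R) : (Num.floor u)%:~R <= u < (Num.floor u)%:~R + 1.
  by have := floor_itv u; rewrite intrD.
have /andP[? ?] := h x; have /andP[? ?] := h x'.
have /andP[? ?] := h y; have /andP[? ?] := h y'.
have := ler_norm (x - x' - (y - y') - n%:~R).
have := ler_norm (- (x - x' - (y - y') - n%:~R)); rewrite normrN.
set N := `|x - x' - _ - _| => ? ?.
by rewrite ler_norml; apply/andP; split; lra.
Qed.

(** Rounding to integer points costs at most [2] in each of the two moving coordinates,
    and [Phi] varies slowly on that scale. *)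
Lemma sphere_path (th th' : 'I_d -> int) (i0 : 'I_d) (k k' : nat -> int) :
  i0 != z0 -> j \in [:: i0; z0] ->
  (forall s i, (s < 2 * K)%N -> i \in [:: i0; z0] ->
    `|Num.sqrt (sphere_sq (upd th i0 (k s)) i) - Num.sqrt (sphere_sq (upd th' i0 (k' s)) i)
     - (Num.sqrt (sphere_sq (upd th i0 (k 0%N)) i) - Num.sqrt (sphere_sq (upd th' i0 (k' 0%N)) i))
     - (if i == j then s%:R * b%:R else 0)| <= b%:R / K%:R) ->
  `|\sum_(s < 2 * K) Phi (fun i => sphere_point (upd th i0 (k s)) i
       - sphere_point (upd th' i0 (k' s)) i)| <= 26.
Proof.
move=> i0z jin hpath.
pose z s i := sphere_point (upd th i0 (k s)) i - sphere_point (upd th' i0 (k' s)) i.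
pose w s i := z 0%N i + (if i == j then s%:Z * b%:Z else 0).
have hz s : (s < 2 * K)%N -> \sum_i `|(z s i - w s i)%:~R| <= 2 * (b%:R / K%:R + 2) :> R.
  move=> sK; rewrite (bigD1 i0)//= (bigD1 z0) 1?eq_sym//= big1; last first.
    move=> i /andP[ii0 iz0]; rewrite /w /z.
    have -> : (i == j) = false.
      by apply/negbTE; apply: contraTneq jin => <-; rewrite !inE negb_or ii0.
    rewrite addr0 /sphere_point /sphere_sq (negbTE iz0) /upd (negbTE ii0).
    by rewrite subrr normr0.
  have h i : i \in [:: i0; z0] -> `|(z s i - w s i)%:~R| <= b%:R / K%:R + 2 :> R.
    move=> iin; rewrite /w opprD addrA /z /sphere_point.
    apply: le_trans; first apply: (@floor_diff _ _ _ _ (if i == j then s%:R * b%:R else 0)).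
      by case: ifP => // _; rewrite intrM.
    by rewrite lerD2r; exact: hpath.
  have i0in : i0 \in [:: i0; z0] by rewrite !inE eqxx.
  have z0in : z0 \in [:: i0; z0] by rewrite !inE eqxx orbT.
  by have := h _ i0in; have := h _ z0in; lra.
have -> : \sum_(s < 2 * K) Phi (z s) = \sum_(s < 2 * K) Phi (w s)
     + \sum_(s < 2 * K) (Phi (z s) - Phi (w s)).
  by rewrite -big_split /=; apply: eq_bigr => s _; rewrite addrC subrK.
have h1 : `|\sum_(s < 2 * K) Phi (w s)| <= 2 by exact: Phi_cancel.
have h2 : `|\sum_(s < 2 * K) (Phi (z s) - Phi (w s))| <= 24.
  apply: (@le_trans _ _ (\sum_(s < 2 * K) 2 / b%:R * (2 * (b%:R / K%:R + 2)))).
    apply: (le_trans (ler_norm_sum _ _ _)); apply: ler_sum => s _.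
    apply: (le_trans (Phi_lip _ _)); rewrite ler_pM2l ?divr_gt0//; exact: hz.
  rewrite sumr_const card_ord -[X in X <= _]mulr_natl natrM.
  have -> : 2 * K%:R * (2 / b%:R * (2 * (b%:R / K%:R + 2))) = 8 + 16 * (K%:R / b%:R) :> R.
    by field; rewrite !gt_eqF.
  have : K%:R / b%:R <= 1 :> R by rewrite ler_pdivrMr// mul1r ler_nat.
  lra.
by apply: (le_trans (ler_normD _ _)); lra.
Qed.

(** With all parameters but the one of [i0] frozen, only the coordinates [i0] and [z0] move,
    and they run along circular arcs.  When the cancelling direction [j] is [i0] the two
    coordinates exchange their roles, which changes the sign of the slope. *)
Lemma frozen_sum (th th' : 'I_d -> int) (i0 : 'I_d) :
  i0 != z0 -> j \in [:: i0; z0] ->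
  (forall i, 0 <= th i < m%:Z) -> (forall i, 0 <= th' i < m%:Z) ->
  `|\sum_(k < m) \sum_(k' < m) Phi (fun i => sphere_point (upd th i0 k%:Z) i
       - sphere_point (upd th' i0 k'%:Z) i)| <= (30 + c ^- 3) / K%:R * m%:R ^+ 2.
Proof.
move=> i0z jin hth hth'.
have rng (t : 'I_d -> int) (k : int) : (forall i, 0 <= t i < m%:Z) ->
    - m%:Z <= k <= 2 * m%:Z -> forall i, - m%:Z <= upd t i0 k i <= 2 * m%:Z.
  by move=> ht hk i; rewrite /upd; case: eqP => // _; exact: base_in_extended_range.
pose tau := c * T ^+ 2 / m%:R.
pose be (t : 'I_d -> int) := T ^+ 2 - \sum_(i | (i != z0) && (i != i0))
   c * T ^+ 2 * (2 + (t i)%:~R / m%:R) - 2 * c * T ^+ 2.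
have tau0 : 0 < tau by rewrite divr_gt0// mulr_gt0// exprn_gt0.
have hX (t : 'I_d -> int) : (forall i, 0 <= t i < m%:Z) -> forall k,
    - m%:Z <= k <= 2 * m%:Z ->
    Num.sqrt (sphere_sq (upd t i0 k) i0) ^+ 2 = 2 * c * T ^+ 2 + tau * k%:~R /\
    c * T <= Num.sqrt (sphere_sq (upd t i0 k) i0) <= T.
  move=> ht k hk; have [-> h] := sphere_sqrt_range i0 (rng t k ht hk); split => //.
  by rewrite /sphere_sq (negbTE i0z) /upd eqxx /tau; field; rewrite gt_eqF.
have hY (t : 'I_d -> int) : (forall i, 0 <= t i < m%:Z) -> forall k,
    - m%:Z <= k <= 2 * m%:Z ->
    Num.sqrt (sphere_sq (upd t i0 k) z0) ^+ 2 = be t - tau * k%:~R /\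
    c * T <= Num.sqrt (sphere_sq (upd t i0 k) z0) <= T.
  move=> ht k hk; have [-> h] := sphere_sqrt_range z0 (rng t k ht hk); split => //.
  rewrite /sphere_sq eqxx (bigD1 i0)//= /be {1}/upd eqxx.
  rewrite (eq_bigr (fun i => c * T ^+ 2 * (2 + (t i)%:~R / m%:R))); last first.
    by move=> i /andP[_ /negbTE ii0]; rewrite /upd ii0.
  by rewrite /tau; field; rewrite gt_eqF.
have c01 : 0 < c <= 1 by have := c_gt0; have := c_le1; move=> ? ?; apply/andP; split; lra.
have Psi1 : forall k k', `|Phi (fun i => sphere_point (upd th i0 k) i
       - sphere_point (upd th' i0 k') i)| <= 1 by move=> k k'; exact: Phi1.
have C26 : 0 <= 26 :> R by [].
have -> : (30 + c ^- 3) / K%:R = (26 + 4 + c ^- 3) / K%:R.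
  by congr ((_ + _) / _); lra.
move: jin; rewrite !inE => /orP[/eqP ji|/eqP jz].
  apply: (@two_parameter_sum R c T b%:R K m (be th) (be th') (2 * c * T ^+ 2) (2 * c * T ^+ 2)
    (- tau) 26 (fun k => Num.sqrt (sphere_sq (upd th i0 k) z0))
    (fun k => Num.sqrt (sphere_sq (upd th' i0 k) z0))
    (fun k => Num.sqrt (sphere_sq (upd th i0 k) i0))
    (fun k => Num.sqrt (sphere_sq (upd th' i0 k) i0))
    (fun k k' => Phi (fun i => sphere_point (upd th i0 k) i - sphere_point (upd th' i0 k') i)))
    => //.
  - by move=> k hk; rewrite mulNr; exact: hY.
  - by move=> k hk; rewrite mulNr; exact: hY.
  - by move=> k hk; rewrite mulNr opprK; exact: hX.
  - by move=> k hk; rewrite mulNr opprK; exact: hX.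
  - by rewrite normrN gtr0_norm.
  - move=> k k' hr h1 h2; apply: sphere_path => //; first by rewrite !inE ji eqxx.
    move=> s i sK; rewrite !inE => /orP[/eqP->|/eqP->].
      by rewrite ji eqxx; exact: h2.
    by rewrite ji eq_sym (negbTE i0z) subr0; exact: h1.
apply: (@two_parameter_sum R c T b%:R K m (2 * c * T ^+ 2) (2 * c * T ^+ 2) (be th) (be th')
    tau 26 (fun k => Num.sqrt (sphere_sq (upd th i0 k) i0))
    (fun k => Num.sqrt (sphere_sq (upd th' i0 k) i0))
    (fun k => Num.sqrt (sphere_sq (upd th i0 k) z0))
    (fun k => Num.sqrt (sphere_sq (upd th' i0 k) z0))
    (fun k k' => Phi (fun i => sphere_point (upd th i0 k) i - sphere_point (upd th' i0 k') i)))
    => //.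
- exact: hX.
- exact: hX.
- exact: hY.
- exact: hY.
- by rewrite gtr0_norm.
- move=> k k' hr h1 h2; apply: sphere_path => //; first by rewrite !inE jz eqxx orbT.
  move=> s i sK; rewrite !inE => /orP[/eqP->|/eqP->].
    by rewrite jz (negbTE i0z) subr0; exact: h1.
  by rewrite jz eqxx; exact: h2.
Qed.

Definition sphere_vec (th : {ffun 'I_d -> 'I_m}) (i : 'I_d) : int :=
  sphere_point (fun i => (th i : nat)%:Z) i.

(** Resampling one component of a uniformly distributed parameter does not change its
    distribution; the involution swaps the new value with the old one. *)
Lemma sum_update (F : {ffun 'I_d -> 'I_m} -> R) (i : 'I_d) :
  \sum_(th : {ffun 'I_d -> 'I_m}) \sum_(k < m) F [ffun x => upd th i k x] = m%:R * \sum_th F th.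
Proof.
rewrite pair_big /=.
pose f (p : {ffun 'I_d -> 'I_m} * 'I_m) := ([ffun x => upd p.1 i p.2 x], p.1 i).
have fK : involutive f.
  move=> [th k]; rewrite /f /=; congr pair; last by rewrite ffunE /upd eqxx.
  apply/ffunP => x; rewrite !ffunE /upd; case: (eqVneq x i) => [->//|/negbTE xi].
  by rewrite ffunE xi.
rewrite (reindex_inj (inv_inj fK)) /=.
rewrite (eq_bigr (fun p : {ffun 'I_d -> 'I_m} * 'I_m => F p.1)); last first.
  move=> [th k] _; rewrite /f /=; congr F.
  apply/ffunP => x; rewrite !ffunE /upd; case: (eqVneq x i) => [->//|/negbTE xi].
  by rewrite ffunE xi.
rewrite -(pair_big xpredT xpredT (fun th _ => F th)) /=.
by rewrite mulr_sumr; apply: eq_bigr => th _; rewrite sumr_const card_ord -[LHS]mulr_natl.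
Qed.

Lemma sphere_pairs : (2 <= d)%N ->
  `|\sum_th \sum_th' Phi (fun i => sphere_vec th i - sphere_vec th' i)| <=
  (30 + c ^- 3) / K%:R * #|{ffun 'I_d -> 'I_m}|%:R ^+ 2.
Proof.
move=> d2.
have [i0 i0z jin] : exists2 i0, i0 != z0 & j \in [:: i0; z0].
  have [jz|jz] := eqVneq j z0; last by exists j => //; rewrite !inE eqxx.
  have : (0 < #|predC1 z0|)%N by rewrite cardC1 card_ord -ltnS prednK// ltnW.
  by move=> /card_gt0P[i0 i0z]; exists i0 => //; rewrite jz !inE eqxx orbT.
set S := \sum_th _.
have m2 : 0 < m%:R ^+ 2 :> R by rewrite exprn_gt0.
have e : m%:R ^+ 2 * S = \sum_(th : {ffun 'I_d -> 'I_m}) \sum_(th' : {ffun 'I_d -> 'I_m})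
    \sum_(k < m) \sum_(k' < m)
    Phi (fun i => sphere_point (upd (fun x => (th x : nat)%:Z) i0 k%:Z) i
       - sphere_point (upd (fun x => (th' x : nat)%:Z) i0 k'%:Z) i).
  rewrite expr2 -mulrA /S -(sum_update _ i0) mulr_sumr; apply: eq_bigr => th _.
  rewrite mulr_sumr exchange_big /=; apply: eq_bigr => k _.
  rewrite -(sum_update _ i0); apply: eq_bigr => th' _; apply: eq_bigr => k' _.
  congr Phi; apply/funext => i; congr (_ - _); rewrite /sphere_vec; congr sphere_point;
    by apply/funext => x; rewrite ffunE /upd; case: eqP.
rewrite -(ler_pM2l m2) -[X in X * `|S|]ger0_norm ?(ltW m2)// -normrM e.
apply: (@le_trans _ _ (\sum_(th : {ffun 'I_d -> 'I_m}) \sum_(th' : {ffun 'I_d -> 'I_m})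
    (30 + c ^- 3) / K%:R * m%:R ^+ 2)).
  apply: (le_trans (ler_norm_sum _ _ _)); apply: ler_sum => th _.
  apply: (le_trans (ler_norm_sum _ _ _)); apply: ler_sum => th' _.
  by apply: frozen_sum => // i; rewrite lez_nat ltz_nat ltn_ord.
rewrite !sumr_const -mulrnA -[X in X <= _]mulr_natl natrM -expr2.
by rewrite le_eqVlt; apply/orP; left; apply/eqP; ring.
Qed.

End Sphere.

(** * Smoothing by spherical averages *)

(** The square of the norm of the spherical average of [h] is a sum over pairs of points of
    the sphere of the autocorrelation [corr] of [h], evaluated at their difference.  The
    autocorrelation inherits slow variation and cancellation from [h], so the estimate for
    pairs of sphere points applies.  This replaces the decay of the Fourier transform of
    the surface measure. *)
Section Smoothing.
Variables (R : realType) (d : nat) (z0 : 'I_d) (T : R) (m : nat).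
Hypotheses (T0 : 0 < T) (m0 : (0 < m)%N) (d2 : (2 <= d)%N).
Let c : R := (4 * d%:R)^-1.
Variables (b K : nat).
Hypotheses (K0 : (0 < K)%N) (Kb : (K <= b)%N).
Hypothesis hT : 2048 * b%:R * K%:R ^+ 6 <= c ^+ 3 * T.
Hypothesis hm : 4 * K%:R ^+ 2 * T <= m%:R * b%:R.
Variables (G : finZmodType) (e_ : 'I_d -> G).

Definition act (z : 'I_d -> int) : G := \sum_i e_ i *~ z i.

Lemma actB z z' : act (fun i => z i - z' i) = act z - act z'.
Proof. by rewrite /act -sumrB; apply: eq_bigr => i _; rewrite mulrzBr. Qed.

Lemma sum_translate (F : G -> R) (g : G) : \sum_x F (x + g) = \sum_x F x.
Proof. by rewrite [RHS](reindex_inj (addIr g)). Qed.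

Let sphere_act (th : {ffun 'I_d -> 'I_m}) : G := act (sphere_vec z0 T th).

Variables (h : G -> R) (S : R) (j : 'I_d).
Hypothesis S0 : 0 < S.
Hypothesis hS : forall x, `|h x| <= S.
Hypothesis h_var : forall i, \sum_x `|h (x + e_ i) - h x| <= 2 * S / b%:R * #|G|%:R.
Hypothesis h_cancel : forall x, `|\sum_(s < 2 * K) h (x + e_ j *~ (s%:Z * b%:Z))| <= 2 * S.

Let variation (g : G) := \sum_x `|h (x + g) - h x|.

Let variation0 : variation 0 = 0.
Proof. by rewrite /variation big1// => x _; rewrite addr0 subrr normr0. Qed.

Let variationD g g' : variation (g + g') <= variation g + variation g'.
Proof.
have <- : \sum_x `|h (x + g' + g) - h (x + g')| = variation g.
  exact: (sum_translate (fun x => `|h (x + g) - h x|) g').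
rewrite -big_split /=; apply: ler_sum => x _.
have -> : x + (g + g') = x + g' + g by rewrite (addrC g) addrA.
by apply: (le_trans _ (ler_normD _ _)); rewrite subrKA.
Qed.

Let variationN g : variation (- g) = variation g.
Proof.
rewrite /variation -[RHS](sum_translate (fun x => `|h (x + g) - h x|) (- g)); apply: eq_bigr => x _.
by rewrite subrK distrC.
Qed.

Let variationz g (n : int) : variation (g *~ n) <= `|n|%:~R * variation g.
Proof.
have hn (k : nat) : variation (g *+ k) <= k%:R * variation g.
  elim: k => [|k IH]; first by rewrite variation0 mul0r.
  by rewrite mulrS -natr1; apply: (le_trans (variationD _ _)); lra.
case: n => n; first by rewrite -pmulrn; exact: hn.
by rewrite NegzE mulrNz variationN -pmulrn normrN; exact: hn.
Qed.

Let variation_act z : variation (act z) <= 2 * S / b%:R * #|G|%:R * \sum_i `|(z i)%:~R|.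
Proof.
apply: (@le_trans _ _ (\sum_i variation (e_ i *~ z i))).
  rewrite /act; elim/big_ind2: _ => [|x1 x2 y1 y2 h1 h2|//]; first by rewrite variation0.
  by apply: (le_trans (variationD _ _)); exact: lerD.
rewrite mulr_sumr; apply: ler_sum => i _; apply: (le_trans (variationz _ _)).
rewrite mulrC intr_norm; apply: ler_wpM2r => //; exact: h_var.
Qed.

Let corr (g : G) := \sum_x h x * h (x + g).
Let N : R := #|{ffun 'I_d -> 'I_m}|%:R.
Let nG : R := #|G|%:R.

Let nG0 : 0 < nG.
Proof. by rewrite ltr0n; apply/card_gt0P; exists 0. Qed.

Let SG0 : 0 < S ^+ 2 * nG.
Proof. by rewrite mulr_gt0// exprn_gt0. Qed.

Let corr_pairs : `|\sum_th \sum_th' corr (sphere_act th - sphere_act th')| <=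
  (30 + c ^- 3) / K%:R * N ^+ 2 * (S ^+ 2 * nG).
Proof.
pose Phi (z : 'I_d -> int) := corr (act z) / (S ^+ 2 * nG).
have b0 : 0 < b%:R :> R by rewrite ltr0n (leq_trans K0).
have corr_le (g : G) : `|corr g| <= S ^+ 2 * nG.
  have -> : S ^+ 2 * nG = \sum_(x : G) S * S by rewrite sumr_const -[RHS]mulr_natl mulrC.
  apply: (le_trans (ler_norm_sum _ _ _)); apply: ler_sum => x _.
  by rewrite normrM ler_pM.
have Phi1 z : `|Phi z| <= 1.
  by rewrite /Phi normrM normfV (gtr0_norm SG0) ler_pdivrMr// mul1r.
have Phi_lip z z' : `|Phi z - Phi z'| <= 2 / b%:R * \sum_i `|(z i - z' i)%:~R|.
  rewrite /Phi -mulrBl normrM normfV (gtr0_norm SG0) ler_pdivrMr//.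
  have -> : corr (act z) - corr (act z') =
      \sum_x h x * (h (x + act z) - h (x + act z')).
    by rewrite /corr -sumrB; apply: eq_bigr => x _; rewrite mulrBr.
  apply: (le_trans (ler_norm_sum _ _ _)).
  apply: (@le_trans _ _ (\sum_x S * `|h (x + act z) - h (x + act z')|)).
    by apply: ler_sum => x _; rewrite normrM ler_wpM2r.
  rewrite -mulr_sumr.
  have -> : \sum_x `|h (x + act z) - h (x + act z')| = variation (act (fun i => z i - z' i)).
    rewrite actB -[LHS](sum_translate (fun x => `|h (x + act z) - h (x + act z')|) (- act z')) /variation; apply: eq_bigr => x _.
    by rewrite subrK addrAC addrA.
  apply: (le_trans (ler_wpM2l (ltW S0) (variation_act _))).
  by rewrite le_eqVlt; apply/orP; left; apply/eqP; rewrite /nG; ring.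
have Phi_cancel z : `|\sum_(s < 2 * K)
    Phi (fun i => z i + (if i == j then s%:Z * b%:Z else 0))| <= 2.
  rewrite /Phi -mulr_suml normrM normfV (gtr0_norm SG0) ler_pdivrMr//.
  have actE (s : int) : act (fun i => z i + (if i == j then s else 0)) = act z + e_ j *~ s.
    rewrite /act (eq_bigr (fun i => e_ i *~ z i + (if i == j then e_ j *~ s else 0))).
      by rewrite big_split /= -big_mkcond big_pred1_eq.
    by move=> i _; rewrite mulrzDr; case: eqP => [->|].
  under eq_bigr do rewrite actE /corr.
  rewrite exchange_big /=.
  have -> : 2 * (S ^+ 2 * nG) = \sum_(x : G) S * (2 * S).
    by rewrite sumr_const -[RHS]mulr_natl -/nG; ring.
  apply: (le_trans (ler_norm_sum _ _ _)); apply: ler_sum => x _.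
  rewrite -mulr_sumr normrM ler_pM//.
  by under eq_bigr do rewrite addrA; exact: h_cancel.
have := @sphere_pairs R d z0 T m T0 m0 b K K0 Kb hT hm Phi Phi1 Phi_lip j Phi_cancel d2.
set s := \sum_th _ => hs.
have -> : \sum_th \sum_th' corr (sphere_act th - sphere_act th') = s * (S ^+ 2 * nG).
  rewrite /s mulr_suml; apply: eq_bigr => th _; rewrite mulr_suml; apply: eq_bigr => th' _.
  by rewrite /Phi actB divfK// gt_eqF.
by rewrite normrM (gtr0_norm SG0) ler_pM2r.
Qed.

Lemma square_sum_corr (v : {ffun 'I_d -> 'I_m} -> G) :
  \sum_x (\sum_th h (x + v th)) ^+ 2 = \sum_th \sum_th' corr (v th' - v th).
Proof.
have -> : \sum_x (\sum_th h (x + v th)) ^+ 2 =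
    \sum_x \sum_th \sum_th' h (x + v th) * h (x + v th').
  apply: eq_bigr => x _; rewrite expr2 mulr_suml; apply: eq_bigr => th _.
  by rewrite mulr_sumr.
rewrite exchange_big /=; apply: eq_bigr => th _.
rewrite exchange_big /=; apply: eq_bigr => th' _.
rewrite /corr -[RHS](sum_translate (fun x => h x * h (x + (v th' - v th))) (v th)); apply: eq_bigr => x _.
by rewrite [in RHS](addrC (v th')) addrA addrK.
Qed.

Lemma smoothing (v : {ffun 'I_d -> 'I_m} -> G) :
  (v = sphere_act \/ v = (fun th => - sphere_act th)) ->
  \sum_x (\sum_th h (x + v th)) ^+ 2 <= (30 + c ^- 3) / K%:R * N ^+ 2 * (S ^+ 2 * nG).
Proof.
move=> hv; rewrite square_sum_corr; apply: le_trans corr_pairs.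
apply: (le_trans _ (ler_norm _)); case: hv => ->.
  by rewrite exchange_big.
rewrite le_eqVlt; apply/orP; left; apply/eqP; apply: eq_bigr => th _; apply: eq_bigr => th' _.
by rewrite opprK addrC.
Qed.

(** Cauchy-Schwarz in the form of the inequality between arithmetic and geometric means,
    with the weight that balances both sides. *)
Lemma smoothing_bilinear (v : {ffun 'I_d -> 'I_m} -> G) (eta Sg : R) (g : G -> R) :
  (v = sphere_act \/ v = (fun th => - sphere_act th)) ->
  0 < eta -> (30 + c ^- 3) / K%:R <= eta ^+ 2 -> (forall x, `|g x| <= Sg) ->
  `|\sum_x (\sum_th h (x + v th)) * g x| <= Sg * S * eta * N * nG.
Proof.
move=> hv eta0 heta hg.
have Sg0 : 0 <= Sg by apply: le_trans (hg 0).
have N0 : 0 < N by rewrite ltr0n; apply/card_gt0P; exists [ffun=> Ordinal m0].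
have q0 : 0 < eta * S * N by rewrite !mulr_gt0.
have amgm (a : R) : `|a| <= (a ^+ 2 / (eta * S * N) + eta * S * N) / 2.
  rewrite ler_pdivlMr// -(ler_pM2r q0) mulrDl divfK ?gt_eqF//.
  rewrite -[a ^+ 2]real_normK ?num_real//.
  by have := sqr_ge0 (`|a| - eta * S * N); nra.
apply: (le_trans (ler_norm_sum _ _ _)).
apply: (@le_trans _ _ (\sum_x ((\sum_th h (x + v th)) ^+ 2 / (eta * S * N) + eta * S * N) / 2 * Sg)).
  by apply: ler_sum => x _; rewrite normrM ler_pM.
rewrite -mulr_suml -mulr_suml big_split /= -mulr_suml.
have -> : \sum_(x : G) eta * S * N = nG * (eta * S * N).
  by rewrite sumr_const -[LHS]mulr_natl.
have hs := smoothing hv.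
have h2 : (\sum_x (\sum_th h (x + v th)) ^+ 2) / (eta * S * N) <= nG * (eta * S * N).
  rewrite ler_pdivrMr//; apply: (le_trans hs).
  have p0 : 0 <= N ^+ 2 * (S ^+ 2 * nG) by rewrite !mulr_ge0 ?exprn_ge0// ltW.
  rewrite -[leLHS]mulrA; apply: (le_trans (ler_wpM2r p0 heta)).
  by rewrite le_eqVlt; apply/orP; left; apply/eqP; ring.
rewrite -[leRHS]mulr1.
have : (((\sum_x (\sum_th h (x + v th)) ^+ 2) / (eta * S * N) + nG * (eta * S * N)) / 2) * Sg
   <= nG * (eta * S * N) * Sg by rewrite ler_wpM2r//; lra.
move=> /le_trans; apply.
by rewrite le_eqVlt; apply/orP; left; apply/eqP; ring.
Qed.

End Smoothing.

(** * The discrete torus *)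

(** The values cancel in consecutive pairs; only the first and the last one can be left
    without a partner. *)
Lemma alternating_sum (R : realType) (u : nat -> R) (bit : nat -> bool) (S : R) (K : nat) :
  (0 < K)%N -> (forall s, `|u s| <= S) -> (forall s, bit s.+1 = ~~ bit s) ->
  (forall s, ~~ bit s -> u s.+1 = - u s) -> `|\sum_(s < 2 * K) u s| <= 2 * S.
Proof.
move=> K0 uS bitS ubit.
have S0 : 0 <= S by apply: le_trans (uS 0%N).
have pairs (v : nat -> R) (q : nat -> bool) n : (forall s, q s.+1 = ~~ q s) ->
    (forall s, ~~ q s -> v s.+1 = - v s) -> ~~ q 0%N -> \sum_(s < 2 * n) v s = 0.
  move=> qS vq q0; have q2 k : ~~ q (2 * k)%N.
    by elim: k => [|k IH]; [exact: q0|rewrite mulnS !qS negbK].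
  elim: n => [|n IH]; first by rewrite big_ord0.
  by rewrite mulnS !big_ord_recr /= IH vq// add0r subrr.
have [b0|b0] := boolP (bit 0%N); last by rewrite (pairs u bit)// normr0 mulr_ge0.
case: K K0 => // K _.
rewrite mulnS big_ord_recl big_ord_recr /=.
rewrite (eq_bigr (fun i : 'I_(2 * K) => u i.+1))//.
rewrite (pairs (fun s => u s.+1) (fun s => bit s.+1)) ?add0r ?bitS ?b0//; last first.
  by move=> s; exact: ubit.
by apply: (le_trans (ler_normD _ _)); have := uS 0%N; have := uS (bump 0 (2 * K)); lra.
Qed.

(** Among [b] consecutive integers exactly one is divisible by [b]; [count_carry] uses
    this to count the points at which adding one changes the leading binary digits. *)
Lemma carry_unique (a b s : nat) : (s < b)%N -> (b %| (a + s).+1)%N -> s = (b - 1 - a %% b)%N.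
Proof.
move=> sb /dvdnP[q eq]; have b0 : (0 < b)%N by exact: leq_ltn_trans sb.
have := ltn_pmod a b0; have := divn_eq a b.
set a1 := (a %/ b)%N; set a0 := (a %% b)%N => ea h.
have qe : q = a1.+1 by nia.
by rewrite qe mulSn in eq; lia.
Qed.

Lemma carry_exists (a b : nat) : (0 < b)%N ->
  (b - 1 - a %% b < b)%N /\ (b %| (a + (b - 1 - a %% b)).+1)%N.
Proof.
move=> b0; have := ltn_pmod a b0; have := divn_eq a b => e h; split; first by lia.
have -> : ((a + (b - 1 - a %% b)).+1 = (a %/ b).+1 * b)%N by lia.
exact: dvdn_mull.
Qed.

Lemma val_Zp_addn (p : nat) (a : 'Z_p) (n : nat) : (1 < p)%N ->
  (a + n%:R)%R = ((a + n) %% p)%N :> nat.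
Proof. by case: p a => [|[|p]] // a _; rewrite /= val_Zp_nat// modnDmr. Qed.

Section Torus.
Variables (d M : nat).
Hypothesis M0 : (0 < M)%N.
Let L := (2 ^ M)%N.

Local Notation torus := 'rV['Z_(2 ^ M)]_d.

Let L1 : (1 < L)%N.
Proof. by rewrite -(exp1n M); apply: ltn_exp2r. Qed.

Definition unit_vec (i : 'I_d) : torus := delta_mx 0 i.

Definition coord (x : torus) (i : 'I_d) : nat := x 0 i.

Lemma coord_lt x i : (coord x i < 2 ^ M)%N.
Proof. by rewrite -[X in (_ < X)%N](Zp_cast L1); exact: ltn_ord. Qed.

Lemma coord_shift x (i j : 'I_d) n :
  coord (x + unit_vec j *+ n) i = if i == j then ((coord x i + n) %% 2 ^ M)%N else coord x i.
Proof.
rewrite /coord mxE mulmxnE mxE eqxx andTb; case: eqP => _.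
  exact: val_Zp_addn.
by rewrite mul0rn addr0.
Qed.

(** The interleaved binary expansion of a point of the grid, in the same order as for
    [approx].  For [d] positive the remainder modulo [d] is always the index of a coordinate,
    so the default value of [oapp] does not enter. *)
Definition digits (x : torus) (l : nat) : bool :=
  odd (oapp (coord x) 0%N (insub (l %% d)%N) %/ 2 ^ (M - 1 - l %/ d))%N.

Lemma digitsE x n (i : 'I_d) : digits x (n * d + i) = odd (coord x i %/ 2 ^ (M - 1 - n)).
Proof.
have d0 : (0 < d)%N by exact: leq_ltn_trans (ltn_ord i).
by rewrite /digits divnMDl// (divn_small (ltn_ord i)) addn0 modnMDl modn_small// valK.
Qed.

Lemma index_decomp l : (0 < d)%N -> exists (n : nat) (i : 'I_d), l = (n * d + i)%N.
Proof. by move=> d0; exists (l %/ d)%N, (Ordinal (ltn_pmod l d0)); exact: divn_eq. Qed.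

Lemma approx_digits x n (i : 'I_d) : (n <= M)%N ->
  approx d (digits x) n i = (coord x i %/ 2 ^ (M - n))%N.
Proof.
elim: n => [|n IH] nM /=; first by rewrite subn0 divn_small// coord_lt.
rewrite IH ?(ltnW nM)// digitsE.
have -> : (M - n = (M - 1 - n) + 1)%N by lia.
have -> : (M - n.+1 = M - 1 - n)%N by lia.
rewrite expnD expn1 divnMA divn2 mul2n addnC -[RHS]odd_double_half//.
Qed.

(** A translation by [b] in coordinate [j] flips the digit of level [n] of that coordinate,
    and does not affect the earlier letters if that digit was zero. *)
Section Level.
Variables (n : nat) (j : 'I_d).
Hypothesis nM : (n < M)%N.
Let b := (2 ^ (M - 1 - n))%N.

Let b0 : (0 < b)%N. Proof. by rewrite expn_gt0. Qed.

Let Lb : (2 ^ M = 2 ^ n.+1 * b)%N.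
Proof. by rewrite -expnD; congr (_ ^ _)%N; lia. Qed.

Lemma coord_shift_div x : (coord (x + unit_vec j *+ b)%R j %/ b = (coord x j %/ b).+1 %% 2 ^ n.+1)%N.
Proof. by rewrite coord_shift eqxx Lb -modn_divl divnDr// divnn b0 addn1. Qed.

Lemma coord_div_lt x : (coord x j %/ b < 2 ^ n.+1)%N.
Proof. by rewrite ltn_divLR// -Lb coord_lt. Qed.

Lemma digits_shift x : digits (x + unit_vec j *+ b) (n * d + j) = ~~ digits x (n * d + j).
Proof.
rewrite !digitsE -/b coord_shift_div.
by rewrite odd_mod ?oddX//= .
Qed.

Lemma digits_shift_lt x l : ~~ digits x (n * d + j) -> (l < n * d + j)%N ->
  digits (x + unit_vec j *+ b) l = digits x l.
Proof.
have d0 : (0 < d)%N by exact: leq_ltn_trans (ltn_ord j).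
have [n' [i ->]] := index_decomp l d0; rewrite !digitsE -/b => ev lt.
have [ij|ij] := eqVneq i j; last by rewrite coord_shift (negbTE ij).
subst i; have nn : (n' < n)%N by move: lt; rewrite ltn_add2r ltn_pmul2r.
have -> : (M - 1 - n' = (M - 1 - n) + (n - n').-1.+1)%N by lia.
rewrite expnD -/b !divnMA coord_shift_div.
have lt2 := coord_div_lt x; set q := (coord x j %/ b)%N in ev lt2 *.
have e2 : q = (2 * (q %/ 2))%N by rewrite divn2 mul2n -[LHS]odd_double_half (negbTE ev).
have lt3 : (q.+1 < 2 ^ n.+1)%N by rewrite expnS in lt2 *; lia.
rewrite modn_small// expnS !divnMA.
by have -> : (q.+1 %/ 2 = q %/ 2)%N by lia.
Qed.

Lemma digits_step x (i : 'I_d) l : ~~ (b %| (coord x i).+1)%N -> (l < n.+1 * d)%N ->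
  digits (x + unit_vec i) l = digits x l.
Proof.
move=> nd; have d0 : (0 < d)%N by exact: leq_ltn_trans (ltn_ord i).
have [n' [i' ->]] := index_decomp l d0; rewrite !digitsE => lt.
have nn : (n' <= n)%N by have := ltn_ord i'; nia.
have := coord_shift x i' i 1; rewrite mulr1n => ->; case: eqP => [->|//].
rewrite addn1.
have lt1 : ((coord x i).+1 < 2 ^ M)%N.
  rewrite ltn_neqAle coord_lt andbT; apply/eqP => e.
  by move: nd; rewrite e Lb dvdn_mull.
have -> : (M - 1 - n' = (M - 1 - n) + (n - n'))%N by lia.
by rewrite modn_small// expnD -/b !divnMA divnS// (negbTE nd).
Qed.

Lemma count_carry (R : realType) (i : 'I_d) :
  b%:R * \sum_(x : torus) (if (b %| (coord x i).+1)%N then 1 else 0) = #|{: torus}|%:R :> R.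
Proof.
pose F (x : torus) : R := if (b %| (coord x i).+1)%N then 1 else 0.
have -> : b%:R * \sum_x F x = \sum_(s < b) \sum_x F (x + unit_vec i *+ s).
  rewrite [RHS](eq_bigr (fun=> \sum_x F x)); last by move=> s _; exact: (sum_translate F).
  by rewrite sumr_const card_ord -[RHS]mulr_natl.
rewrite exchange_big /= -sum1_card natr_sum; apply: eq_bigr => x _.
have bL : (b %| 2 ^ M)%N by rewrite Lb dvdn_mull.
have FE (s : nat) : F (x + unit_vec i *+ s) = if ((coord x i + s).+1 %% b == 0)%N then 1 else 0.
  rewrite /F coord_shift eqxx /dvdn -addn1 -modnDml modn_dvdm// modnDml addn1.
  by [].
rewrite (eq_bigr (fun s : 'I_b => if ((coord x i + s).+1 %% b == 0)%N then 1 else 0)) //.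
have [lt dv] := carry_exists (coord x i) b0.
rewrite (bigD1 (Ordinal lt))//= big1 ?addr0; first by rewrite -[(_ == 0)%N]/(b %| _)%N dv.
move=> s; rewrite -val_eqE /= => /eqP sne; case: eqP => // e.
by exfalso; apply: sne; apply: carry_unique => //; rewrite /dvdn e.
Qed.

End Level.
End Torus.

(** * Densities and their increments *)

Section Density.
Variables (R : realType) (d M : nat).
Hypothesis M0 : (0 < M)%N.
Local Notation torus := 'rV['Z_(2 ^ M)]_d.

(** The density of the mass distribution [mu], averaged over boxes of level [l]. *)
Definition density (mu : word -> R) (l : nat) (x : torus) : R :=
  2 ^+ l * mu (mkseq (digits x) l).

Definition jump (mu : word -> R) (l : nat) (x : torus) : R :=
  density mu l.+1 x - density mu l x.

Definition additive_at (mu : word -> R) (l : nat) :=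
  forall w, size w = l -> mu w = mu (rcons w false) + mu (rcons w true).

Lemma mkseq_rcons (T : Type) (f : nat -> T) n : mkseq f n.+1 = rcons (mkseq f n) (f n).
Proof. by rewrite /mkseq -addn1 iotaD map_cat cats1. Qed.

Lemma eq_density mu l (x y : torus) : (forall k, (k < l)%N -> digits x k = digits y k) ->
  density mu l x = density mu l y.
Proof.
move=> e; congr (_ * mu _); apply/eq_in_map => i; rewrite mem_iota => /andP[_].
exact: e.
Qed.

Variables (mu : word -> R) (n : nat) (j : 'I_d) (S : R).
Hypotheses (nM : (n < M)%N).
Let l := (n * d + j)%N.
Let b := (2 ^ (M - 1 - n))%N.
Hypothesis mu_add : additive_at mu l.

Lemma jumpE x : jump mu l x =
  2 ^+ l * (mu (rcons (mkseq (digits x) l) (digits x l))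
            - mu (rcons (mkseq (digits x) l) (~~ digits x l))).
Proof.
rewrite /jump /density mkseq_rcons exprS (mu_add (size_mkseq _ _)).
by case: (digits x l) => /=; ring.
Qed.

Lemma jump_antisym x : ~~ digits x l -> jump mu l (x + unit_vec M j *+ b) = - jump mu l x.
Proof.
move=> nx; rewrite !jumpE.
have -> : mkseq (digits (x + unit_vec M j *+ b)) l = mkseq (digits x) l.
  apply/eq_in_map => i; rewrite mem_iota => /andP[_ il].
  exact: (digits_shift_lt M0).
rewrite (digits_shift M0) // negbK -mulrN opprB.
by [].
Qed.

(** The translation that flips the digit of index [l] exchanges the two halves of each box,
    on which the increment takes opposite values. *)
Lemma sum_jump : \sum_x jump mu l x = 0.
Proof.
rewrite (bigID (fun x : torus => digits x l)) /=.
have -> : \sum_(x : torus | digits x l) jump mu l x = - \sum_(x : torus | ~~ digits x l) jump mu l x.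
  rewrite [LHS]big_mkcond /= -(sum_translate _ (unit_vec M j *+ b)) -sumrN [RHS]big_mkcond /=.
  apply: eq_bigr => x _; rewrite (digits_shift M0)//.
  by case: ifP => // /jump_antisym.
by rewrite addrC subrr.
Qed.

Lemma sum_density_step : \sum_x density mu l.+1 x = \sum_x density mu l x.
Proof. by apply/eqP; rewrite -subr_eq0 -sumrB; apply/eqP; exact: sum_jump. Qed.

Hypothesis mu0 : forall w, 0 <= mu w.
Hypothesis densS : forall x, density mu l x <= S.
Hypothesis densS' : forall x, density mu l.+1 x <= S.

Lemma density_ge0 k x : 0 <= density mu k x.
Proof. by rewrite mulr_ge0 ?exprn_ge0. Qed.

Lemma jump_bound x : `|jump mu l x| <= S.
Proof.
have := densS x; have := densS' x; have := density_ge0 l x; have := density_ge0 l.+1 x.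
by rewrite /jump => ? ? ? ?; rewrite ler_norml; apply/andP; split; lra.
Qed.

(** A unit translation changes the first [l.+1] digits only at a proportion [1 / b] of the
    points. *)
Lemma jump_variation (i : 'I_d) :
  \sum_x `|jump mu l (x + unit_vec M i) - jump mu l x| <= 2 * S / b%:R * #|{: torus}|%:R.
Proof.
have b0 : 0 < b%:R :> R by rewrite ltr0n expn_gt0.
have S0 : 0 <= S by apply: le_trans (jump_bound 0).
rewrite -(count_carry M0 nM R i) -/b mulrA divfK ?gt_eqF// mulr_sumr.
apply: ler_sum => x _; case: ifP => [_|/negbT nd].
  rewrite mulr1; apply: (le_trans (ler_normB _ _)).
  have := jump_bound x; have := jump_bound (x + unit_vec M i); lra.
rewrite mulr0; have e k : (k <= l)%N -> digits (x + unit_vec M i) k = digits x k.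
  move=> kl; apply: (digits_step M0 nM) => //; rewrite mulSn addnC.
  by apply: (leq_ltn_trans kl); rewrite ltn_add2l.
have -> : jump mu l (x + unit_vec M i) = jump mu l x.
  rewrite /jump; congr (_ - _); apply: eq_density => k kl; apply: e => //; exact: ltnW.
by rewrite subrr normr0.
Qed.

Lemma jump_cancel (K : nat) x : (0 < K)%N ->
  `|\sum_(s < 2 * K) jump mu l (x + unit_vec M j *~ (s%:Z * b%:Z))| <= 2 * S.
Proof.
move=> K0.
rewrite (eq_bigr (fun s : 'I_(2 * K) => jump mu l (x + unit_vec M j *+ (s * b)))); last first.
  by move=> s _; rewrite pmulrn.
have eS s : x + unit_vec M j *+ (s.+1 * b) = x + unit_vec M j *+ (s * b) + unit_vec M j *+ b.
  by rewrite mulSn mulrnDr addrA addrAC.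
apply: (@alternating_sum R (fun s => jump mu l (x + unit_vec M j *+ (s * b)))
  (fun s => digits (x + unit_vec M j *+ (s * b)) l) S K K0) => s.
- exact: jump_bound.
- by rewrite eS (digits_shift M0).
- by move=> h; rewrite eS jump_antisym.
Qed.

End Density.

Section Step.
Variables (R : realType) (d M : nat) (z0 : 'I_d) (T : R) (m : nat).
Hypotheses (M0 : (0 < M)%N) (d2 : (2 <= d)%N) (T0 : 0 < T) (m0 : (0 < m)%N).
Local Notation torus := 'rV['Z_(2 ^ M)]_d.
Let c : R := (4 * d%:R)^-1.
Let v (th : {ffun 'I_d -> 'I_m}) : torus := act (unit_vec M) (sphere_vec z0 T th).

(** The discrete analogue of the integral of [g x * f (x + v)] over all [x] and all
    vectors [v] of length [t]; its positivity produces a pair of points at distance [t]. *)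
Definition sphere_form (f g : torus -> R) : R := \sum_x (\sum_th f (x + v th)) * g x.

Lemma sphere_form_adjoint f g :
  sphere_form f g = \sum_x (\sum_th g (x - v th)) * f x.
Proof.
have -> : sphere_form f g = \sum_th \sum_x f (x + v th) * g x.
  by rewrite exchange_big /=; apply: eq_bigr => x _; rewrite mulr_suml.
have -> : \sum_x (\sum_th g (x - v th)) * f x = \sum_th \sum_x g (x - v th) * f x.
  by rewrite exchange_big /=; apply: eq_bigr => x _; rewrite mulr_suml.
apply: eq_bigr => th _; rewrite -[RHS](sum_translate (fun x => g (x - v th) * f x) (v th)).
by apply: eq_bigr => x _; rewrite addrK mulrC.
Qed.

Variables (mu nu : word -> R) (n : nat) (j : 'I_d) (S eta : R) (K : nat).
Hypotheses (nM : (n < M)%N) (S0 : 0 < S).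
Let l := (n * d + j)%N.
Let b := (2 ^ (M - 1 - n))%N.
Hypotheses (mu_add : additive_at mu l) (nu_add : additive_at nu l).
Hypotheses (mu0 : forall w, 0 <= mu w) (nu0 : forall w, 0 <= nu w).
Hypotheses (muS : forall w, size w = l -> 2 ^+ l * mu w <= S)
  (muS' : forall w, size w = l.+1 -> 2 ^+ l.+1 * mu w <= S)
  (nuS : forall w, size w = l -> 2 ^+ l * nu w <= S)
  (nuS' : forall w, size w = l.+1 -> 2 ^+ l.+1 * nu w <= S).
Hypotheses (K0 : (0 < K)%N) (Kb : (K <= b)%N).
Hypothesis hT : 2048 * b%:R * K%:R ^+ 6 <= c ^+ 3 * T.
Hypothesis hm : 4 * K%:R ^+ 2 * T <= m%:R * b%:R.
Hypotheses (eta0 : 0 < eta) (heta : (30 + c ^- 3) / K%:R <= eta ^+ 2).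

(** Passing to the next level splits the boxes in one coordinate.  The change of the form
    involves the spherical average of an increment of one density, and the cancellation of
    the increment between neighbouring boxes makes this average small. *)
Lemma sphere_form_step :
  `|sphere_form (density mu l.+1) (density nu l.+1)
    - sphere_form (density mu l) (density nu l)| <=
  2 * S ^+ 2 * eta * #|{ffun 'I_d -> 'I_m}|%:R * #|{: torus}|%:R.
Proof.
have bound (rho : word -> R) (k : nat) : (forall w, 0 <= rho w) ->
    (forall w, size w = k -> 2 ^+ k * rho w <= S) -> forall x : torus, `|density rho k x| <= S.
  move=> rho0 rhoS x; rewrite ger0_norm ?rhoS ?size_mkseq//.
  by rewrite mulr_ge0 ?exprn_ge0.
have boundr (rho : word -> R) (k : nat) :
    (forall w, size w = k -> 2 ^+ k * rho w <= S) -> forall x : torus, density rho k x <= S.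
  by move=> rhoS x; rewrite rhoS ?size_mkseq.
have e : sphere_form (density mu l.+1) (density nu l.+1)
    - sphere_form (density mu l) (density nu l) =
    \sum_x (\sum_th jump mu l (x + v th)) * density nu l.+1 x
    + \sum_x (\sum_th jump nu l (x + (- v th))) * density mu l x.
  have -> : \sum_x (\sum_th jump mu l (x + v th)) * density nu l.+1 x =
    sphere_form (density mu l.+1) (density nu l.+1) - sphere_form (density mu l) (density nu l.+1).
    by rewrite /sphere_form -sumrB; apply: eq_bigr => x _; rewrite -mulrBl -sumrB.
  have -> : \sum_x (\sum_th jump nu l (x + (- v th))) * density mu l x =
    sphere_form (density mu l) (density nu l.+1) - sphere_form (density mu l) (density nu l).
    rewrite !sphere_form_adjoint -sumrB; apply: eq_bigr => x _.
    by rewrite -mulrBl -sumrB.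
  by rewrite addrA subrK.
rewrite e; apply: (le_trans (ler_normD _ _)).
have h1 := @smoothing_bilinear R d z0 T m T0 m0 d2 b K K0 Kb hT hm _ (unit_vec M)
  (jump mu l) S j S0 (jump_bound mu0 (boundr _ _ muS) (boundr _ _ muS'))
  (jump_variation M0 nM mu0 (boundr _ _ muS) (boundr _ _ muS'))
  (fun x => jump_cancel M0 nM mu_add mu0 (boundr _ _ muS) (boundr _ _ muS') x K0)
  v eta S (density nu l.+1) (or_introl erefl) eta0 heta (bound _ _ nu0 nuS').
have h2 := @smoothing_bilinear R d z0 T m T0 m0 d2 b K K0 Kb hT hm _ (unit_vec M)
  (jump nu l) S j S0 (jump_bound nu0 (boundr _ _ nuS) (boundr _ _ nuS'))
  (jump_variation M0 nM nu0 (boundr _ _ nuS) (boundr _ _ nuS'))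
  (fun x => jump_cancel M0 nM nu_add nu0 (boundr _ _ nuS) (boundr _ _ nuS') x K0)
  (fun th => - v th) eta S (density mu l) (or_intror erefl) eta0 heta (bound _ _ mu0 muS).
apply: (le_trans (lerD h1 h2)).
by rewrite le_eqVlt; apply/orP; left; apply/eqP; ring.
Qed.

End Step.

(** * Summing over the scales *)

Section LevelSum.
Variable R : realType.

Lemma sum_block_geometric (I : nat) : \sum_(i < I) ((2 ^+ (i %/ 24))^-1 : R) <= 48.
Proof.
have h J : \sum_(i < 24 * J) ((2 ^+ (i %/ 24))^-1 : R) = 48 * (1 - (2 ^+ J)^-1).
  elim: J => [|J IH]; first by rewrite muln0 big_ord0 expr0 invr1 subrr mulr0.
  rewrite mulnS addnC big_split_ord /= IH.
  rewrite (eq_bigr (fun=> (2 ^+ J)^-1)); last first.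
    by move=> i _; rewrite mulnC divnMDl// divn_small ?addn0.
  rewrite sumr_const card_ord exprS invfM; set q := (2 ^+ J)^-1.
  have -> : q *+ 24 = 24 * q by rewrite -[LHS]mulr_natl.
  by lra.
have le : (I <= 24 * (I %/ 24).+1)%N by rewrite mulnC ltnW// ltn_ceil.
apply: (@le_trans _ _ (\sum_(i < 24 * (I %/ 24).+1) ((2 ^+ (i %/ 24))^-1 : R))).
  rewrite -(subnKC le) big_split_ord /= lerDl; apply: sumr_ge0 => i _.
  by rewrite invr_ge0 exprn_ge0.
by rewrite h ler_piMr// gerBl invr_ge0 exprn_ge0.
Qed.

(** The loss caused by a dimension less than [d] grows so slowly that half of the gain
    from smoothing absorbs it. *)
Lemma growth_bound (y : R) (i : nat) : 1 <= y -> y ^+ 48 <= 2 ->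
  (y ^+ i) ^+ 2 / 2 ^+ (i %/ 12) <= 2 / 2 ^+ (i %/ 24).
Proof.
move=> y1 y48; have y0 : 0 <= y by lra.
have h1 : (y ^+ i) ^+ 2 <= 2 * 2 ^+ (i %/ 24).
  rewrite -exprM -exprS.
  apply: (@le_trans _ _ (y ^+ (48 * (i %/ 24).+1))).
    apply: ler_weXn2l => //; have := ltn_ceil i (isT : (0 < 24)%N); lia.
  by rewrite exprM lerXn2r ?nnegrE ?exprn_ge0.
have p k : 0 < 2 ^+ k :> R by rewrite exprn_gt0.
rewrite ler_pdivrMr//; apply: (le_trans h1).
rewrite mulrAC ler_pdivlMr// -mulrA ler_pM2l// -exprD.
by apply: ler_weXn2l; [lra|lia].
Qed.

End LevelSum.

Section FiniteLevel.
Variables (R : realType) (d : nat).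
Hypothesis d2 : (2 <= d)%N.
Let c : R := (4 * d%:R)^-1.
Let d0 : (0 < d)%N. Proof. exact: ltnW. Qed.

(** The restriction of a mass distribution to the cube of side one half at the origin, for
    words of length at least [d].  A vector of length at most one half with nonnegative
    coordinates does not leave the unit cube when it is added to a point of the small
    one, so there is no wrap-around on the torus. *)
Definition cut (nu : word -> R) (w : word) : R := if has id (take d w) then 0 else nu w.

Lemma cut_ge0 nu : (forall w, 0 <= nu w) -> forall w, 0 <= cut nu w.
Proof. by move=> nu0 w; rewrite /cut; case: ifP. Qed.

Lemma cut_le nu : (forall w, 0 <= nu w) -> forall w, cut nu w <= nu w.
Proof. by move=> nu0 w; rewrite /cut; case: ifP. Qed.

Lemma cut_additive nu l : (d <= l)%N -> additive_at nu l -> additive_at (cut nu) l.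
Proof.
move=> dl ha w wl; rewrite /cut -!cats1 !takel_cat ?wl// !cats1.
by case: ifP => _; [rewrite addr0|exact: ha].
Qed.

Section Torus.
Variable M : nat.
Hypothesis M0 : (0 < M)%N.
Local Notation torus := 'rV['Z_(2 ^ M)]_d.

Lemma sum_density (mu : word -> R) l : (l <= M * d)%N ->
  (forall k, (k < l)%N -> additive_at mu k) ->
  \sum_(x : torus) density mu l x = #|{: torus}|%:R * mu [::].
Proof.
elim: l => [|l IH] lM ha.
  rewrite (eq_bigr (fun=> mu [::])); first by rewrite sumr_const -[LHS]mulr_natl.
  by move=> x _; rewrite /density expr0 mul1r.
rewrite -IH ?(ltnW lM)//; last by move=> k kl; apply: ha; exact: ltnW.
have [n [i e]] := index_decomp l d0.
have nM : (n < M)%N.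
  by rewrite -(ltn_pmul2r d0); apply: leq_ltn_trans _ lM; rewrite e leq_addr.
rewrite e; apply: (sum_density_step M0 nM).
by rewrite -e; apply: ha.
Qed.

(** The density of the Dirac mass at the origin is a multiple of the indicator of the
    small cube. *)
Lemma sum_corner :
  2 ^+ d * \sum_(x : torus) (if has id (mkseq (digits x) d) then 0 else 1) = #|{: torus}|%:R :> R.
Proof.
pose dirac (w : word) : R := if has id w then 0 else 1.
have h : \sum_(x : torus) density dirac d x = #|{: torus}|%:R * dirac [::].
  apply: sum_density; first by rewrite leq_pmull.
  by move=> k _ w _; rewrite /dirac !has_rcons /=; case: (has id w) => /=; rewrite ?addr0 ?add0r ?orbT.
by rewrite mulr1 in h; rewrite -h mulr_sumr.
Qed.

Variables (z0 : 'I_d) (T : R) (m : nat) (mu nu : word -> R) (l : nat) (sg r : R).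
Hypotheses (dl : (d <= l)%N) (lM : (l <= M * d)%N).
Hypotheses (mu_add : forall k, (k < l)%N -> additive_at mu k)
  (nu_add : forall k, (k < l)%N -> additive_at nu k).
Hypotheses (mu0 : forall w, 0 <= mu w) (nu0 : forall w, 0 <= nu w).
Hypotheses (mu_le : forall w, size w = l -> 2 ^+ l * mu w <= sg)
  (nu_le : forall w, size w = l -> 2 ^+ l * nu w <= sg).
Hypotheses (mu_root : 1 - r <= mu [::]) (nu_root : 1 - r <= nu [::]) (sg1 : 1 <= sg).

(** At this scale the densities are at most [sg], which is close to [1], and have
    averages close to [1]; hence they are close to [1] in mean, and the form is close to
    its value for two indicators of cubes. *)
Lemma sphere_form_main :
  (sg ^+ 2 / 2 ^+ d - 2 * sg * (sg - 1 + r)) * #|{ffun 'I_d -> 'I_m}|%:R * #|{: torus}|%:R <=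
  sphere_form z0 T m (density mu l : torus -> R) (density (cut nu) l).
Proof.
set N : R := #|{ffun 'I_d -> 'I_m}|%:R; set nG : R := #|{: torus}|%:R.
have dens (rho : word -> R) : (forall w, 0 <= rho w) ->
    (forall w, size w = l -> 2 ^+ l * rho w <= sg) ->
    forall x : torus, 0 <= density rho l x <= sg.
  by move=> r0 rle x; rewrite rle ?size_mkseq// andbT mulr_ge0 ?exprn_ge0.
pose chi (x : torus) : R := if has id (mkseq (digits x) d) then 0 else 1.
have cutE x : density (cut nu) l x = chi x * density nu l x.
  rewrite /density /cut /chi take_mkseq//; case: ifP => _; last by rewrite mul1r.
  by rewrite mulr0 mul0r.
pose vv (th : {ffun 'I_d -> 'I_m}) : torus := act (unit_vec M) (sphere_vec z0 T th).
have point_bound (x : torus) th : sg ^+ 2 * chi x - sg * (sg - density mu l (x + vv th))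
     - sg * (sg - density nu l x) <= density mu l (x + vv th) * density (cut nu) l x.
  rewrite cutE; have /andP[a0 a1] := dens mu mu0 mu_le (x + vv th).
  have /andP[b0 b1] := dens nu nu0 nu_le x.
  have p1 : 0 <= (sg - density mu l (x + vv th)) * (sg - density nu l x).
    by rewrite mulr_ge0// subr_ge0.
  have p2 : 0 <= sg * (sg - density mu l (x + vv th)) by rewrite mulr_ge0 ?subr_ge0//; exact: le_trans sg1.
  have p3 : 0 <= sg * (sg - density nu l x) by rewrite mulr_ge0 ?subr_ge0//; exact: le_trans sg1.
  by rewrite /chi; case: ifP => _; lra.
have -> : sphere_form z0 T m (density mu l : torus -> R) (density (cut nu) l) =
    \sum_th \sum_x density mu l (x + vv th) * density (cut nu) l x.
  rewrite /sphere_form [RHS]exchange_big /=; apply: eq_bigr => x _.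
  by rewrite mulr_suml.
have sum_const (a : R) : \sum_(x : torus) a = nG * a.
  by rewrite sumr_const -[LHS]mulr_natl.
have chi_sum : \sum_x chi x = nG / 2 ^+ d.
  by rewrite /nG -sum_corner mulrAC divff ?mul1r// expf_neq0.
have -> : (sg ^+ 2 / 2 ^+ d - 2 * sg * (sg - 1 + r)) * N * nG =
    \sum_(th : {ffun 'I_d -> 'I_m}) (sg ^+ 2 / 2 ^+ d - 2 * sg * (sg - 1 + r)) * nG.
  by rewrite sumr_const -[RHS]mulr_natl /N; ring.
apply: ler_sum => th _.
apply: (@le_trans _ _ (\sum_x (sg ^+ 2 * chi x - sg * (sg - density mu l (x + vv th))
     - sg * (sg - density nu l x)))); last by apply: ler_sum => x _; exact: point_bound.
rewrite !sumrB -!mulr_sumr !sumrB !sum_const chi_sum.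
rewrite (sum_translate (density mu l)) !sum_density//.
have nG0 : 0 <= nG by [].
have h1 : nG * (1 - r) <= nG * mu [::] by rewrite ler_wpM2l.
have h2 : nG * (1 - r) <= nG * nu [::] by rewrite ler_wpM2l.
have sg0 : 0 <= sg by exact: le_trans sg1.
have := ler_wpM2l sg0 h1; have := ler_wpM2l sg0 h2; rewrite -/nG.
set q := (2 ^+ d)^-1; lra.
Qed.

End Torus.

End FiniteLevel.

Section FiniteLevelDistance.
Variables (R : realType) (d : nat).
Hypothesis d2 : (2 <= d)%N.
Let c : R := (4 * d%:R)^-1.
Let d0 : (0 < d)%N. Proof. exact: ltnW. Qed.

(** The Frostman condition on masses, rewritten for densities; [y] is [2] to the power
    [d - s], and boxes that are not cubes are compared with the cube containing them. *)
Definition growth_le (mu : word -> R) (y : R) := forall w,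
  2 ^+ size w * mu w <= 2 ^+ (size w %% d) * y ^+ (size w %/ d).

Lemma growth_le_step (mu : word -> R) (y : R) n (j : 'I_d) w : 1 <= y <= 2 -> growth_le mu y ->
  (size w = n * d + j \/ size w = (n * d + j).+1)%N ->
  2 ^+ size w * mu w <= 2 ^+ d * y ^+ n.
Proof.
move=> /andP[y1 y2] hg hw; apply: (le_trans (hg w)).
have yn : 0 <= y ^+ n by rewrite exprn_ge0//; lra.
have e1 : 1 <= 2 :> R by lra.
case: hw => ->.
  rewrite divnMDl// modnMDl divn_small// modn_small// addn0 ler_wpM2r//.
  by apply: ler_weXn2l => //; exact: ltnW.
rewrite -addnS divnMDl// modnMDl.
have [jd|jd] := ltnP j.+1 d.
  rewrite divn_small// modn_small// addn0 ler_wpM2r//.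
  by apply: ler_weXn2l => //; exact: ltnW.
have -> : j.+1 = d by apply/eqP; rewrite eqn_leq jd ltn_ord.
rewrite modnn divnn d0 addn1 expr0 mul1r exprS ler_wpM2r//.
by apply: (le_trans y2); rewrite -[leLHS]expr1; apply: ler_weXn2l.
Qed.

(** The choice of scales.  The side of the boxes at level [n] is [b] grid units, [K] grows
    like a small power of the ratio of the distance to this side, and the grid is so fine
    that [b] exceeds [K] at every level; [m] is the number of values of each parameter
    of the sphere. *)
Lemma scale_bounds (t : R) (n0 u0 N n M : nat) : (n0 <= n < N)%N -> 0 < t <= 1 / 2 ->
  1024 * 2 ^+ (12 * u0) <= c ^+ 3 * (2 ^+ n0 * t) -> M = (2 * N + 2 * u0 + 2)%N ->
  let K := (2 ^ (2 * (u0 + (n - n0) %/ 12)))%N in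
  let b := (2 ^ (M - 1 - n))%N in
  let m := (2 ^ (4 * u0 + 4 * N + M + 2))%N in
  [/\ (K <= b)%N, 2048 * b%:R * K%:R ^+ 6 <= c ^+ 3 * (t * 2 ^+ M) &
     4 * K%:R ^+ 2 * (t * 2 ^+ M) <= m%:R * b%:R :> R].
Proof.
move=> /andP[n0n nN] /andP[t0 t1] hZ ME K b m.
have e1 : 1 <= 2 :> R by lra.
have p k : 0 < 2 ^+ k :> R by rewrite exprn_gt0.
have b1 : 1 <= b%:R :> R by rewrite ler1n expn_gt0.
split.
- by rewrite leq_exp2l//; lia.
- rewrite /b /K !natrX -(ler_pM2r (p n0)) -exprM.
  apply: (@le_trans _ _ (1024 * 2 ^+ (12 * u0) * 2 ^+ M)); last first.
    have -> : c ^+ 3 * (t * 2 ^+ M) * 2 ^+ n0 = c ^+ 3 * (2 ^+ n0 * t) * 2 ^+ M by ring.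
    by rewrite ler_pM2r.
  have h : 2 ^+ 1 * (2 ^+ (M - 1 - n) * (2 ^+ (2 * (u0 + (n - n0) %/ 12) * 6) * 2 ^+ n0))
      <= 2 ^+ (12 * u0) * 2 ^+ M :> R.
    by rewrite -!exprD; apply: ler_weXn2l => //; lia.
  move: h; rewrite expr1; set A := 2 ^+ (M - 1 - n); set B := 2 ^+ (_ * 6); set D := 2 ^+ n0.
  set P := 2 ^+ (12 * u0); set Q := 2 ^+ M => h.
  by clearbody A B D P Q; clear - h; lra.
- have h1 : t * 2 ^+ M <= 2 ^+ M by rewrite ler_piMl// ?ltW//; lra.
  have h2 : 4 * K%:R ^+ 2 * 2 ^+ M <= m%:R :> R.
    rewrite /K /m !natrX -exprM.
    have -> : (4 : R) = 2 ^+ 2 by rewrite expr2; lra.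
    by rewrite -!exprD; apply: ler_weXn2l => //; lia.
  have h3 : 0 <= 4 * K%:R ^+ 2 :> R by rewrite mulr_ge0// exprn_ge0.
  have h4 : 0 <= m%:R :> R by [].
  have := ler_wpM2l h3 h1; have := ler_wpM2l h4 b1; lra.
Qed.

Lemma lt_fine_scale n N u0 : (n < N)%N -> (n < 2 * N + 2 * u0 + 2)%N.
Proof. lia. Qed.

Lemma leq_fine_scale N u0 : (N <= 2 * N + 2 * u0 + 2)%N.
Proof. lia. Qed.

Variables (z0 : 'I_d) (t y C r : R) (n0 u0 N : nat) (mu nu : word -> R).
Hypotheses (t01 : 0 < t <= 1 / 2) (y1 : 1 <= y) (y48 : y ^+ 48 <= 2) (yn0 : y ^+ n0 <= 2).
Hypotheses (n0_gt0 : (0 < n0)%N) (n0N : (n0 <= N)%N).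
Hypothesis hZ : 1024 * 2 ^+ (12 * u0) <= c ^+ 3 * (2 ^+ n0 * t).
Hypotheses (C0 : 0 < C) (hC : 30 + c ^- 3 <= C ^+ 2).
Hypotheses (mu_add : forall k, (k < N * d)%N -> additive_at mu k)
  (nu_add : forall k, (k < N * d)%N -> additive_at nu k).
Hypotheses (mu0 : forall w, 0 <= mu w) (nu0 : forall w, 0 <= nu w).
Hypotheses (mu_le : growth_le mu y) (nu_le : growth_le nu y).
Hypotheses (mu_root : 1 - r <= mu [::]) (nu_root : 1 - r <= nu [::]).

Let M := (2 * N + 2 * u0 + 2)%N.
Let m := (2 ^ (4 * u0 + 4 * N + M + 2))%N.
Let T := t * 2 ^+ M.
Let M0 : (0 < M)%N. Proof. by rewrite /M addn2. Qed.
Let m0 : (0 < m)%N. Proof. by rewrite expn_gt0. Qed.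
Let T0 : 0 < T. Proof. by case/andP: t01 => t0 _; rewrite mulr_gt0// exprn_gt0. Qed.
Local Notation torus := 'rV['Z_(2 ^ M)]_d.
Let form (l : nat) : R := sphere_form z0 T m (density mu l : torus -> R) (density (cut d nu) l).
Let NG : R := #|{ffun 'I_d -> 'I_m}|%:R * #|{: torus}|%:R.

Let y2 : 1 <= y <= 2.
Proof. by rewrite y1/=; apply: le_trans y48; rewrite -[leLHS]expr1; apply: ler_weXn2l. Qed.

Let level_error (i : nat) : R := 2 * (2 ^+ d * y ^+ (n0 + i)) ^+ 2 * (C / 2 ^+ (u0 + i %/ 12)).

Let form_step (i : nat) (j : nat) : (n0 + i < N)%N -> (j < d)%N ->
  `|form ((n0 + i) * d + j).+1 - form ((n0 + i) * d + j)| <= level_error i * NG.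
Proof.
move=> iN jd; set n := (n0 + i)%N.
have nN : (n0 <= n < N)%N by rewrite /n leq_addr.
have [] := scale_bounds nN t01 hZ erefl.
rewrite -/M -/m -/T /n addKn -/n => h1 h2 h3.
have nM : (n < M)%N by case/andP: nN => _; exact: lt_fine_scale.
have lN : (n * d + j < N * d)%N.
  case/andP: nN => _ h; apply: (@leq_trans (n.+1 * d)); last by rewrite leq_mul2r h orbT.
  by rewrite mulSn addnC ltn_add2r.
have S0 : 0 < 2 ^+ d * y ^+ n by rewrite mulr_gt0// exprn_gt0//; apply: lt_le_trans y1.
have eta0 : 0 < C / 2 ^+ (u0 + i %/ 12) by rewrite divr_gt0// exprn_gt0.
have dl : (d <= n * d + j)%N.
  apply: leq_trans (leq_addr _ _); rewrite leq_pmull//.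
  by rewrite /n; apply: leq_trans n0_gt0 (leq_addr _ _).
have cut_le2 (w : word) : 2 ^+ size w * cut d nu w <= 2 ^+ size w * nu w.
  by rewrite ler_wpM2l ?exprn_ge0//; exact: cut_le.
have heta : (30 + c ^- 3) / (2 ^ (2 * (u0 + i %/ 12)))%:R <= (C / 2 ^+ (u0 + i %/ 12)) ^+ 2.
  rewrite expr_div_n -exprM (mulnC _ 2%N) natrX ler_pM2r//.
have muS w : size w = (n * d + j)%N -> 2 ^+ (n * d + j) * mu w <= 2 ^+ d * y ^+ n.
  by move=> wl; rewrite -wl; apply: (growth_le_step (j := Ordinal jd)) => //; left.
have muS' w : size w = (n * d + j).+1 -> 2 ^+ (n * d + j).+1 * mu w <= 2 ^+ d * y ^+ n.
  by move=> wl; rewrite -wl; apply: (growth_le_step (j := Ordinal jd)) => //; right.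
have nuS w : size w = (n * d + j)%N -> 2 ^+ (n * d + j) * cut d nu w <= 2 ^+ d * y ^+ n.
  move=> wl; rewrite -wl; apply: (le_trans (cut_le2 w)).
  by apply: (growth_le_step (j := Ordinal jd)) => //; left.
have nuS' w : size w = (n * d + j).+1 -> 2 ^+ (n * d + j).+1 * cut d nu w <= 2 ^+ d * y ^+ n.
  move=> wl; rewrite -wl; apply: (le_trans (cut_le2 w)).
  by apply: (growth_le_step (j := Ordinal jd)) => //; right.
have K0 : (0 < 2 ^ (2 * (u0 + i %/ 12)))%N by rewrite expn_gt0.
have := @sphere_form_step R d M z0 T m M0 d2 T0 m0 mu (cut d nu) n (Ordinal jd)
  (2 ^+ d * y ^+ n) (C / 2 ^+ (u0 + i %/ 12)) (2 ^ (2 * (u0 + i %/ 12)))%N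
  nM S0 (mu_add lN) (cut_additive dl (nu_add lN)) mu0 (cut_ge0 d nu0)
  muS muS' nuS nuS' K0 h1 h2 h3 eta0 heta.
move=> /le_trans; apply; rewrite /level_error /NG.
by rewrite le_eqVlt; apply/orP; left; apply/eqP; ring.
Qed.

Let NG0 : 0 <= NG. Proof. by rewrite mulr_ge0. Qed.

Let form_level (i : nat) : (n0 + i < N)%N ->
  `|form ((n0 + i).+1 * d) - form ((n0 + i) * d)| <= d%:R * level_error i * NG.
Proof.
move=> iN; have h J : (J <= d)%N ->
    `|form ((n0 + i) * d + J) - form ((n0 + i) * d)| <= J%:R * level_error i * NG.
  elim: J => [|J IH] Jd; first by rewrite addn0 subrr normr0 !mul0r.
  apply: (le_trans (norm_sub_via _ (form ((n0 + i) * d + J)) _)).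
  have := IH (ltnW Jd); have := form_step iN Jd; rewrite addnS -natr1 !mulrDl mul1r.
  lra.
by rewrite mulSn addnC; exact: h.
Qed.

Let level_error_le (i : nat) :
  level_error i <= 16 * 4 ^+ d * (C / 2 ^+ u0) / 2 ^+ (i %/ 24).
Proof.
have p k : 0 < 2 ^+ k :> R by rewrite exprn_gt0.
have -> : level_error i = 2 * 4 ^+ d * (C / 2 ^+ u0) * (y ^+ n0) ^+ 2 *
    ((y ^+ i) ^+ 2 / 2 ^+ (i %/ 12)).
  rewrite /level_error !exprD.
  have -> : (4 : R) = 2 ^+ 2 by rewrite expr2; lra.
  rewrite -exprM (mulnC 2%N) exprM; field; by rewrite !gt_eqF.
have q0 : 0 <= 2 * 4 ^+ d * (C / 2 ^+ u0).
  by rewrite !mulr_ge0 ?exprn_ge0 ?invr_ge0 ?ltW.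
have s0 : 0 <= y ^+ n0 by rewrite exprn_ge0//; apply: le_trans y1.
have s4 : (y ^+ n0) ^+ 2 <= 4.
  have -> : (4 : R) = 2 ^+ 2 by rewrite expr2; lra.
  by rewrite lerXn2r ?nnegrE.
have h1 := growth_bound i y1 y48.
have h2 : 0 <= 2 / 2 ^+ (i %/ 24) :> R by rewrite divr_ge0 ?exprn_ge0.
apply: (@le_trans _ _ (2 * 4 ^+ d * (C / 2 ^+ u0) * 4 * (2 / 2 ^+ (i %/ 24)))).
  apply: (@le_trans _ _ (2 * 4 ^+ d * (C / 2 ^+ u0) * (y ^+ n0) ^+ 2 * (2 / 2 ^+ (i %/ 24)))).
    apply: ler_wpM2l; last exact: h1.
    by apply: mulr_ge0; [exact: q0|apply: exprn_ge0].
  by apply: ler_wpM2r => //; apply: ler_wpM2l.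
by rewrite le_eqVlt; apply/orP; left; apply/eqP; ring.
Qed.

Let form_total :
  `|form (N * d) - form (n0 * d)| <= 768 * d%:R * 4 ^+ d * C / 2 ^+ u0 * NG.
Proof.
pose E := d%:R * (16 * 4 ^+ d * (C / 2 ^+ u0)).
have E0 : 0 <= E.
  apply: mulr_ge0 => //; apply: mulr_ge0; first by rewrite mulr_ge0 ?exprn_ge0.
  by apply: divr_ge0; [exact: ltW|exact: exprn_ge0].
have h I : (n0 + I <= N)%N -> `|form ((n0 + I) * d) - form (n0 * d)| <=
    E * (\sum_(i < I) (2 ^+ (i %/ 24))^-1) * NG.
  elim: I => [|I IH] IN; first by rewrite addn0 subrr normr0 big_ord0 mulr0 mul0r.
  rewrite addnS in IN.
  apply: (le_trans (norm_sub_via _ (form ((n0 + I) * d)) _)).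
  have h1 := IH (ltnW IN); have h2 := form_level IN.
  rewrite big_ord_recr /= mulrDr mulrDl addrC; apply: lerD => //.
  rewrite addnS; apply: (le_trans h2); apply: ler_wpM2r => //.
  apply: (le_trans (ler_wpM2l _ (level_error_le I))) => //.
  by rewrite le_eqVlt; apply/orP; left; apply/eqP; rewrite /E !mulrA.
have := h (N - n0)%N; rewrite subnKC// => /(_ (leqnn _)) /le_trans; apply.
apply: ler_wpM2r => //; apply: (le_trans (ler_wpM2l E0 (sum_block_geometric R _))).
by rewrite le_eqVlt; apply/orP; left; apply/eqP; rewrite /E; ring.
Qed.

Let dens_top (rho : word -> R) : growth_le rho y ->
  forall w, size w = (n0 * d)%N -> 2 ^+ (n0 * d) * rho w <= y ^+ n0.
Proof.
by move=> h w wl; have := h w; rewrite wl modnMl mulnK// expr0 mul1r.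
Qed.

(** The form is bounded below at level [n0], where the boxes are slightly smaller than the
    distance, and the changes at all finer levels add up to less than this bound.  Hence
    it is positive at level [N]. *)
Lemma finite_level_positive :
  768 * d%:R * 4 ^+ d * C / 2 ^+ u0 <
    (y ^+ n0) ^+ 2 / 2 ^+ d - 2 * y ^+ n0 * (y ^+ n0 - 1 + r) ->
  exists (x : torus) (th : {ffun 'I_d -> 'I_m}),
    0 < mu (mkseq (digits (x + act (unit_vec M) (sphere_vec z0 T th))) (N * d)) /\
    0 < cut d nu (mkseq (digits x) (N * d)).
Proof.
move=> hmain.
have sg1 : 1 <= y ^+ n0 by rewrite exprn_ege1.
have lM : (n0 * d <= M * d)%N.
  by rewrite leq_mul2r; apply/orP; right; apply: (leq_trans n0N); exact: leq_fine_scale.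
have lN k : (k < n0 * d)%N -> (k < N * d)%N.
  by move=> h; apply: (leq_trans h); rewrite leq_mul2r n0N orbT.
have dl : (d <= n0 * d)%N by rewrite leq_pmull.
have h1 := @sphere_form_main R d d2 M M0 z0 T m mu nu (n0 * d)%N (y ^+ n0) r dl lM
  (fun k kl => mu_add (lN k kl)) (fun k kl => nu_add (lN k kl)) mu0 nu0
  (dens_top mu_le) (dens_top nu_le) mu_root nu_root sg1.
have NGp : 0 < NG.
  rewrite mulr_gt0// ltr0n; apply/card_gt0P; last by exists 0.
  by exists [ffun=> Ordinal m0].
have pos : 0 < form (N * d).
  have := form_total; rewrite ler_norml => /andP[h2 _].
  have h3 := hmain; rewrite -(ltr_pM2r NGp) in h3.
  rewrite -mulrA -/NG -/(form (n0 * d)) in h1.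
  have h4 := lt_le_trans h3 h1; rewrite -subr_gt0; move: h2 h4.
  set a := form (N * d); set e := form (n0 * d); set q := _ * NG => h2 h4.
  have h5 : e - q <= a by lra.
  by rewrite subr0; apply: lt_le_trans h5; rewrite subr_gt0.
apply/not_existsP => no.
have : form (N * d) <= 0.
  rewrite /form /sphere_form; apply: sumr_le0 => x _.
  rewrite mulr_suml; apply: sumr_le0 => th _.
  have hmu := mu0 (mkseq (digits (x + act (unit_vec M) (sphere_vec z0 T th))) (N * d)).
  have hnu := cut_ge0 d nu0 (mkseq (digits x) (N * d)).
  rewrite /density mulrACA.
  have [h|h] := pselect (0 < cut d nu (mkseq (digits x) (N * d))); last first.
    have -> : cut d nu (mkseq (digits x) (N * d)) = 0.
      by apply/eqP; rewrite eq_le hnu andbT leNgt; apply/negP.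
    by rewrite !mulr0.
  have -> : mu (mkseq (digits (x + act (unit_vec M) (sphere_vec z0 T th))) (N * d)) = 0.
    apply/eqP; rewrite eq_le hmu andbT leNgt; apply/negP => h'.
    by apply: (no x); exists th.
  by rewrite mul0r mulr0.
by rewrite leNgt pos.
Qed.

End FiniteLevelDistance.

(** * Distances between grid points *)

Lemma sqr_sub_le (R : realType) (a b e : R) : `|a| <= 1 -> `|b| <= 1 -> `|a - b| <= e ->
  `|a ^+ 2 - b ^+ 2| <= 2 * e.
Proof.
move=> a1 b1 ab; rewrite subr_sqr normrM mulrC.
have h : `|a + b| <= 2 by apply: (le_trans (ler_normD _ _)); lra.
by apply: ler_pM.
Qed.

Lemma sum_sqr_sub_le (R : realType) (d : nat) (u v : 'I_d -> R) (e : R) :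
  (forall i, `|u i| <= 1) -> (forall i, `|v i| <= 1) -> (forall i, `|u i - v i| <= e) ->
  `|\sum_i u i ^+ 2 - \sum_i v i ^+ 2| <= 2 * d%:R * e.
Proof.
move=> u1 v1 uv; rewrite -sumrB; apply: (le_trans (ler_norm_sum _ _ _)).
apply: (@le_trans _ _ (\sum_(i < d) 2 * e)).
  by apply: ler_sum => i _; exact: sqr_sub_le.
by rewrite sumr_const card_ord -[X in X <= _]mulr_natl; lra.
Qed.

Lemma floor_div_scale (R : realType) (a M N : nat) : (N <= M)%N -> (a <= 2 ^ M)%N ->
  `|(a %/ 2 ^ (M - N))%:R / 2 ^+ N - a%:R / 2 ^+ M : R| <= (2 ^+ N)^-1 /\
  0 <= ((a %/ 2 ^ (M - N))%:R / 2 ^+ N : R) <= 1.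
Proof.
move=> NM aM; set k := (2 ^ (M - N))%N.
have k0 : (0 < k)%N by rewrite expn_gt0.
have p n : 0 < 2 ^+ n :> R by rewrite exprn_gt0.
have eM : 2 ^+ M = k%:R * 2 ^+ N :> R by rewrite /k natrX -exprD subnK.
have kr : 0 < k%:R :> R by rewrite ltr0n.
have e : a%:R = (a %/ k)%:R * k%:R + (a %% k)%:R :> R by rewrite -natrM -natrD -divn_eq.
split.
  have -> : (a %/ k)%:R / 2 ^+ N - a%:R / 2 ^+ M = - ((a %% k)%:R / (k%:R * 2 ^+ N)) :> R.
    by rewrite eM e; field; rewrite !gt_eqF.
  rewrite normrN ger0_norm; last by rewrite divr_ge0// mulr_ge0// exprn_ge0.
  rewrite ler_pdivrMr ?mulr_gt0// mulrCA mulVf ?gt_eqF// mulr1 ler_nat.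
  by apply: ltnW; rewrite ltn_pmod.
apply/andP; split; first by rewrite divr_ge0// ltW.
rewrite ler_pdivrMr// mul1r -natrX ler_nat.
have -> : (2 ^ N = 2 ^ M %/ k)%N by rewrite /k -expnB ?leq_subr// subKn.
exact: leq_div2r.
Qed.

Section TorusDistance.
Variables (R : realType) (d M N : nat) (z0 : 'I_d) (t : R) (m : nat).
Hypotheses (N0 : (0 < N)%N) (NM : (N <= M)%N) (m0 : (0 < m)%N) (t01 : 0 < t <= 1 / 2).
Local Notation torus := 'rV['Z_(2 ^ M)]_d.
Let T := t * 2 ^+ M.
Let M0 : (0 < M)%N. Proof. exact: leq_trans NM. Qed.

Lemma corner_coord (x : torus) (i : 'I_d) :
  ~~ has id (take d (mkseq (digits x) (N * d))) -> (coord x i < 2 ^ (M - 1))%N.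
Proof.
rewrite take_mkseq ?leq_pmull// => /hasPn h.
have /h : digits x i \in mkseq (digits x) d.
  by apply/mapP; exists (i : nat) => //; rewrite mem_iota /=.
rewrite -[X in digits x X]/(0 * d + i)%N digitsE subn0 => od.
have : (coord x i %/ 2 ^ (M - 1) < 2)%N.
  by rewrite ltn_divLR ?expn_gt0// -expnS subn1 prednK// coord_lt.
move: od; case E : (coord x i %/ 2 ^ (M - 1))%N => [|[|q]]// _ _.
have := ltn_ceil (coord x i) (expn_gt0 2 (M - 1)); rewrite E mul1n.
by apply.
Qed.

Lemma coord_act (x : torus) (z : 'I_d -> int) (i : 'I_d) : 0 <= z i ->
  (coord x i + `|z i| < 2 ^ M)%N -> coord (x + act (unit_vec M) z) i = (coord x i + `|z i|)%N.
Proof.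
move=> zi lt; have L1 : (1 < 2 ^ M)%N by rewrite -[X in (X < _)%N](expn0 2) ltn_exp2l.
rewrite /coord mxE.
have -> : act (unit_vec M) z 0 i = (`|z i|%N)%:R :> 'Z_(2 ^ M).
  rewrite /act summxE (bigD1 i)//= big1 ?addr0.
    rewrite -[in LHS](gez0_abs zi) -pmulrn mulmxnE mxE !eqxx.
    by [].
  move=> k ki; have zE (n : nat) : (unit_vec M k *+ n) 0 i = 0.
    by rewrite mulmxnE mxE eqxx eq_sym (negbTE ki) mul0rn.
  by case: (z k) => n; [rewrite -pmulrn zE|rewrite NegzE mulrNz mxE -pmulrn zE oppr0].
by rewrite val_Zp_addn// modn_small.
Qed.

(** The squares of the exact coordinates of the sphere point sum to [t ^+ 2] after scaling;
    truncating both points to [N] digits and rounding the sphere point each move a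
    coordinate by at most [1 / 2 ^+ N]. *)
Lemma torus_distance (x : torus) (th : {ffun 'I_d -> 'I_m}) :
  ~~ has id (take d (mkseq (digits x) (N * d))) ->
  `|\sum_(i < d) ((approx d (digits (x + act (unit_vec M) (sphere_vec z0 T th))) N i)%:R / 2 ^+ N
     - (approx d (digits x) N i)%:R / 2 ^+ N) ^+ 2 - t ^+ 2| <= 6 * d%:R / 2 ^+ N.
Proof.
move=> hx; case/andP: t01 => t0 t1.
have p n : 0 < 2 ^+ n :> R by rewrite exprn_gt0.
have T0 : 0 < T by rewrite mulr_gt0.
pose k (i : 'I_d) : int := (th i : nat)%:Z.
have hk i : - m%:Z <= k i <= 2 * m%:Z by rewrite /k; have := ltn_ord (th i); lia.
pose q i : R := Num.sqrt (sphere_sq z0 T m k i) / 2 ^+ M.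
have hq i : Num.sqrt (sphere_sq z0 T m k i) ^+ 2 = sphere_sq z0 T m k i /\
    0 <= Num.sqrt (sphere_sq z0 T m k i) <= T.
  have [-> /andP[_ h]] := @sphere_sqrt_range R d z0 T m T0 m0 k i hk.
  by split => //; rewrite sqrtr_ge0.
have sumq : \sum_i q i ^+ 2 = t ^+ 2.
  have -> : t ^+ 2 = T ^+ 2 / (2 ^+ M) ^+ 2 by rewrite /T exprMn mulfK// expf_neq0// expf_neq0.
  rewrite -(sum_sphere_sq z0 T m k) mulr_suml; apply: eq_bigr => i _.
  by rewrite /q expr_div_n (hq i).1.
set z := sphere_vec z0 T th.
have hz i : [/\ 0 <= z i, (`|z i| <= 2 ^ (M - 1))%N &
    `|(`|z i|%N)%:R / 2 ^+ M - q i| <= (2 ^+ N)^-1].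
  have [z1 z2] := @sphere_point_bounds R d z0 T m T0 m0 k i hk.
  have zi : (`|z i|%N)%:R = (z i)%:~R :> R by rewrite pmulrn gez0_abs.
  split => //.
    rewrite -(ler_nat R) zi; apply: (le_trans z2).
    have -> : (2 ^ (M - 1))%:R = 1 / 2 * 2 ^+ M :> R.
      by rewrite natrX -[in RHS](prednK M0) exprS subn1; field.
    by rewrite /T ler_pM2r.
  have i0 : 0 <= (2 ^+ M)^-1 :> R by rewrite invr_ge0 exprn_ge0.
  rewrite zi /q -mulrBl normrM (ger0_norm i0).
  apply: (@le_trans _ _ (1 * (2 ^+ M)^-1)).
    rewrite ler_pM2r ?invr_gt0//.
    have /andP[f1 f2] := floor_itv (Num.sqrt (sphere_sq z0 T m k i)).
    rewrite intrD in f2.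
    by rewrite /z /sphere_vec /sphere_point -/k ler_norml; apply/andP; split; lra.
  by rewrite mul1r lef_pV2 ?posrE// ler_weXn2l//; lra.
rewrite -sumq.
have -> : 6 * d%:R / 2 ^+ N = 2 * d%:R * (3 / 2 ^+ N) :> R by lra.
have co i : [/\ coord (x + act (unit_vec M) z) i = (coord x i + `|z i|)%N,
     (coord x i + `|z i| <= 2 ^ M)%N & (coord x i <= 2 ^ M)%N].
  have [z1 z2 _] := hz i; have h := corner_coord i hx.
  have h2 : (coord x i + `|z i| < 2 ^ M)%N.
    have e : (2 ^ M = 2 ^ (M - 1) + 2 ^ (M - 1))%N by rewrite addnn -mul2n -expnS subn1 prednK.
    by rewrite [X in (_ < X)%N]e; apply: leq_trans (leq_add h z2).
  by split; [exact: coord_act|exact: ltnW|apply: ltnW; exact: coord_lt].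
apply: sum_sqr_sub_le => i; rewrite ?(approx_digits M0 _ _ NM); have [c1 c2 c3] := co i.
- rewrite c1; have [_ /andP[a1 a2]] := floor_div_scale R NM c2.
  have [_ /andP[b1 b2]] := floor_div_scale R NM c3.
  by rewrite ler_norml; apply/andP; split; lra.
- have [_ /andP[q1 q2]] := hq i.
  rewrite /q ger0_norm; last by rewrite divr_ge0// ltW.
  rewrite ler_pdivrMr// mul1r; apply: (le_trans q2).
  by rewrite /T -[leRHS]mul1r ler_pM2r//; lra.
- rewrite c1; have [a1 _] := floor_div_scale R NM c2; have [b1 _] := floor_div_scale R NM c3.
  have [_ _ z3] := hz i.
  rewrite natrD mulrDl in a1.
  move: a1 b1 z3; set A := _ / 2 ^+ N; set B := (coord x i %/ _)%:R / _.
  set u := (coord x i)%:R / _; set v := (`|z i|%N)%:R / _ => a1 b1 z3.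
  have -> : A - B - q i = (A - (u + v)) - (B - u) + (v - q i) by ring.
  apply: (le_trans (ler_normD _ _)).
  have := ler_normB (A - (u + v)) (B - u); lra.
Qed.

End TorusDistance.

(** * Sets of large content *)

Section Core.
Variables (R : realType) (d : nat).
Hypothesis d2 : (2 <= d)%N.
Let d0 : (0 < d)%N. Proof. exact: ltnW. Qed.

Lemma cube_weight_growth (s y : R) (mu : word -> R) :
  y = 2 `^ (d%:R - s) -> (forall w, mu w <= cube_weight d s w) -> growth_le d mu y.
Proof.
move=> yE mu_le w; set k := (size w %/ d)%N.
have p n : 0 < 2 ^+ n :> R by rewrite exprn_gt0.
have -> : 2 ^+ size w = 2 ^+ (size w %% d) * (2 ^+ k) ^+ d :> R.
  by rewrite -exprM -exprD addnC -divn_eq.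
rewrite -mulrA ler_pM2l//.
apply: (le_trans (ler_wpM2l _ (mu_le w))); first by rewrite exprn_ge0// ltW.
rewrite /cube_weight -/k.
have e1 : ((2 ^+ k)^-1 : R) `^ s = (2 ^+ k) `^ (- s).
  by rewrite powRN -powR_inv1 ?exprn_ge0// -powRrM mulN1r powRN.
have e2 : (2 ^+ k : R) ^+ d = (2 ^+ k) `^ d%:R by rewrite powR_mulrn// exprn_ge0.
have -> : y ^+ k = (2 ^+ k) `^ (d%:R - s).
  rewrite yE -powR_mulrn ?powR_ge0// -(powR_mulrn k (ltW (ltr0Sn R 1))).
  by rewrite -!powRrM mulrC.
by rewrite e1 e2 -powRD//; apply/implyP => _; rewrite gt_eqF.
Qed.

(** Pairs of points whose distances approximate [t] accumulate, by compactness, at a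
    pair at distance exactly [t]. *)
Lemma limit_distance (KE KF : set (nat -> bool)) (t C : R) (n0 : nat) : 0 <= t ->
  closed_seq KE -> closed_seq KF ->
  (forall N, (n0 <= N)%N -> exists x y, [/\ KE x, KF y &
     `|\sum_(i < d) (point R d x 0 i - point R d y 0 i) ^+ 2 - t ^+ 2| <= C / 2 ^+ N]) ->
  exists x y, [/\ KE x, KF y & t = eucl_norm (point R d x - point R d y)].
Proof.
move=> t0 clE clF hN.
have /choice[xy Hxy] : forall N, exists p : (nat -> bool) * (nat -> bool), [/\ KE p.1, KF p.2 &
     `|\sum_(i < d) (point R d p.1 0 i - point R d p.2 0 i) ^+ 2 - t ^+ 2| <= C / 2 ^+ (n0 + N)].
  by move=> N; have [x [y [? ? ?]]] := hN (n0 + N)%N (leq_addr _ _); exists (x, y).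
have [|z Hz] := @konig (bool * bool)%type (fun k i => ((xy k).1 i, (xy k).2 i))
    (fun=> [:: (true, true); (true, false); (false, true); (false, false)]).
  by move=> i k _; case: ((xy k).1 i); case: ((xy k).2 i).
exists (fun i => (z i).1), (fun i => (z i).2); split.
- apply: clE => m; have [k _ Hk] := Hz m 0%N; have [? _ _] := Hxy k.
  by exists (xy k).1 => // i im; rewrite -(Hk i im).
- apply: clF => m; have [k _ Hk] := Hz m 0%N; have [_ ? _] := Hxy k.
  by exists (xy k).2 => // i im; rewrite -(Hk i im).
set x := fun i => (z i).1; set y := fun i => (z i).2.
have p n : 0 < 2 ^+ n :> R by rewrite exprn_gt0.
have C0 : 0 <= C.
  have [_ _ h] := Hxy 0%N; have := le_trans (normr_ge0 _) h.
  by rewrite pmulr_lge0 ?invr_gt0.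
have e : \sum_(i < d) (point R d x 0 i - point R d y 0 i) ^+ 2 = t ^+ 2.
  apply: (@le_exp2V_eq _ _ _ (C + 4 * d%:R)) => n.
  have [k kn Hk] := Hz (n * d)%N n; have [_ _ h] := Hxy k.
  apply: (le_trans (norm_sub_via _
    (\sum_(i < d) (point R d (xy k).1 0 i - point R d (xy k).2 0 i) ^+ 2) _)).
  have h2 : C / 2 ^+ (n0 + k) <= C / 2 ^+ n.
    apply: ler_wpM2l => //; rewrite lef_pV2 ?posrE//; apply: ler_weXn2l; first lra.
    exact: leq_trans (leq_addl _ _).
  have h1 : `|\sum_(i < d) (point R d x 0 i - point R d y 0 i) ^+ 2 -
     \sum_(i < d) (point R d (xy k).1 0 i - point R d (xy k).2 0 i) ^+ 2| <=
     2 * d%:R * (2 * (2 ^+ n)^-1).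
    have diff01 w w' (i : 'I_d) : `|point R d w 0 i - point R d w' 0 i| <= 1.
      by apply: norm_sub_itv01; exact: point_itv01.
    apply: sum_sqr_sub_le => i; [exact: diff01|exact: diff01|].
    have hx : `|point R d x 0 i - point R d (xy k).1 0 i| <= (2 ^+ n)^-1.
      by apply: point_dist => q qn; rewrite /x -(Hk q qn).
    have hy : `|point R d y 0 i - point R d (xy k).2 0 i| <= (2 ^+ n)^-1.
      by apply: point_dist => q qn; rewrite /y -(Hk q qn).
    move: hx hy; set a := point R d x 0 i; set b := point R d y 0 i.
    set a' := point R d _ 0 i; set b' := point R d _ 0 i => hx hy.
    have -> : a - b - (a' - b') = (a - a') - (b - b') by ring.
    by apply: (le_trans (ler_normB _ _)); lra.
  have -> : (C + 4 * d%:R) / 2 ^+ n = 2 * d%:R * (2 * (2 ^+ n)^-1) + C / 2 ^+ n by ring.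
  by apply: lerD h1 _; apply: le_trans h h2.
rewrite /eucl_norm -[LHS]ger0_norm// -sqrtr_sqr -e; congr Num.sqrt.
by apply: eq_bigr => i _; rewrite !mxE.
Qed.

(** The level at which the boxes become smaller than the distance [t] by the factor [Z]. *)
Lemma exists_scale (t Z : R) : 0 < t -> t < Z ->
  exists n0 : nat, [/\ (0 < n0)%N, Z <= 2 ^+ n0 * t & 2 ^+ n0 <= 2 * Z / t].
Proof.
move=> t0 tZ; have Z0 : 0 < Z by apply: lt_trans tZ.
have [|n Hn] := @exp2V_le R (t / Z); first by rewrite divr_gt0.
have p k : 0 < 2 ^+ k :> R by rewrite exprn_gt0.
have exn : exists n, Z <= 2 ^+ n * t.
  by exists n; move: Hn; rewrite -div1r ler_pdivrMr// mulrAC ler_pdivlMr// mul1r mulrC.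
case: (ex_minnP exn) => -[|n1] h hmin; first by move: h; rewrite expr0 mul1r leNgt tZ.
exists n1.+1; split => //.
rewrite ler_pdivlMr// exprS -mulrA ler_pM2l// leNgt; apply/negP => /ltW/hmin.
by rewrite ltnn.
Qed.

Lemma main_term_bound (q rho a : R) : 0 < q -> q <= 1 -> rho = q / 24 ->
  1 <= a -> a <= 1 + rho -> q / 4 < a ^+ 2 * q - 2 * a * (a - 1 + 2 * rho).
Proof.
move=> q0 q1 e a1 a2.
have h1 : q <= a ^+ 2 * q by rewrite ler_peMl ?exprn_ege1// ltW.
have h2 : a * (a - 1 + 2 * rho) <= 2 * (3 * rho) by apply: ler_pM; lra.
by lra.
Qed.

(** One distance at a time.  The condition on [(Z / t) `^ (d%:R - s)] says that down to the
    scale [t / Z] the [s]-dimensional and the [d]-dimensional cost of a cube almost agree,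
    so that sets of large content look full at this scale. *)
Theorem distance_of_large_content : exists rho Z : R,
  [/\ 0 < rho < 1, 1 <= Z &
   forall (t s : R) (E F : set 'rV[R]_d), 0 < t <= 1 / 2 -> 0 < s <= d%:R ->
     d%:R - s <= 1 / 48 -> (Z / t) `^ (d%:R - s) <= 1 + rho ->
     borel_set E -> borel_set F -> E `<=` @unit_cube R d -> F `<=` @unit_cube R d ->
     ((1 - rho)%:E <= dyadic_content s E)%E -> ((1 - rho)%:E <= dyadic_content s F)%E ->
     distance_set E F t].
Proof.
pose c : R := (4 * d%:R)^-1.
have dr : 2 <= d%:R :> R by rewrite ler_nat.
have c0 : 0 < c by rewrite invr_gt0; lra.
have c1 : c <= 1 by rewrite invf_le1; lra.
have p k : 0 < 2 ^+ k :> R by rewrite exprn_gt0.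
pose C : R := 30 + c ^- 3.
have c3 : 0 < c ^- 3 by rewrite invr_gt0 exprn_gt0.
have C1 : 1 <= C by rewrite /C; lra.
have hC : 30 + c ^- 3 <= C ^+ 2 by rewrite -/C expr2 ler_peMl//; lra.
pose q : R := (2 ^+ d)^-1.
have q0 : 0 < q by rewrite invr_gt0.
have q1 : q <= 1 by rewrite invf_le1// exprn_ege1//; lra.
(* [u0] fixes the ratio between the distance and the coarsest scale; it makes the sum of
   all errors smaller than a quarter of the volume of the small cube. *)
have [u0 hW] : exists u0 : nat, forall a : R, q / 4 < a ->
    768 * d%:R * 4 ^+ d * C / 2 ^+ u0 < a.
  have W0 : 0 < 768 * d%:R * 4 ^+ d * C.
    by apply: mulr_gt0; [apply: mulr_gt0; [apply: mulr_gt0|apply: exprn_gt0]|]; lra.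
  have [|u0 hu0] := @exp2V_le R (q / 4 / (768 * d%:R * 4 ^+ d * C)).
    by apply: divr_gt0 => //; lra.
  exists u0 => a; apply: le_lt_trans.
  by rewrite mulrC -ler_pdivlMr.
have [Z0 [Z01 hZ0]] : exists Z0 : R, 1 <= Z0 /\
    forall x, Z0 <= x -> 1024 * 2 ^+ (12 * u0) <= c ^+ 3 * x.
  have c30 : 0 < c ^+ 3 by rewrite exprn_gt0.
  exists (1024 * 2 ^+ (12 * u0) / c ^+ 3); split.
    rewrite ler_pdivlMr// mul1r; apply: (@le_trans _ _ 1); first by rewrite exprn_ile1// ltW.
    have : 1 <= 2 ^+ (12 * u0) :> R by rewrite exprn_ege1//; lra.
    by set P := 2 ^+ _; clearbody P => hP; lra.
  by move=> x; rewrite ler_pdivrMr// [x * _]mulrC.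
pose rho : R := q / 24.
have rho0 : 0 < rho by rewrite /rho; lra.
exists rho, (2 * Z0); split; [by rewrite rho0 /= /rho; lra|lra|].
move=> t s E F /andP[t0 t1] /andP[s0 sd] hds hZt bE bF E1 F1 cE cF.
have tZ : t < Z0 by lra.
have [n0 [n00 hn0 hn0']] := exists_scale t0 tZ.
pose y : R := 2 `^ (d%:R - s).
have ds0 : 0 <= d%:R - s by rewrite subr_ge0.
have one2 : 1 <= 2 :> R by lra.
have y1 : 1 <= y by rewrite -[leLHS](powRr0 2); exact: (ler_powR one2 ds0).
have y48 : y ^+ 48 <= 2.
  rewrite -powR_mulrn ?powR_ge0// -powRrM -[leRHS]powRr1//.
  by apply: (ler_powR one2); lra.
have yn0 : y ^+ n0 <= 1 + rho.
  apply: le_trans hZt; rewrite -powR_mulrn ?powR_ge0// -powRrM mulrC powRrM powR_mulrn; last lra.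
  by apply: ge0_ler_powR; rewrite ?nnegrE ?exprn_ge0 ?divr_ge0//; lra.
have yn2 : y ^+ n0 <= 2 by rewrite /rho in yn0; lra.
have yn1 : 1 <= y ^+ n0 by rewrite exprn_ege1.
have lw0 w : 0 <= cube_weight d s w by exact: powR_ge0.
have compact_part (A : set 'rV[R]_d) : borel_set A -> A `<=` @unit_cube R d ->
    ((1 - rho)%:E <= dyadic_content s A)%E ->
    exists K, [/\ closed_seq K, K `<=` point R d @^-1` A &
      1 - 2 * rho <= content (cube_weight d s) K].
  move=> bA A1 cA; have h := le_content_expansion d0 s0 A1 cA.
  by apply: capacitability => //; [exact: analytic_borel|lra].
have [KE [clE KEE cKE]] := compact_part E bE E1 cE.
have [KF [clF KFF cKF]] := compact_part F bF F1 cF.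
suff [x [w [Kx Kw e]]] : exists x y, [/\ KE x, KF y & t = eucl_norm (point R d x - point R d y)].
  by exists (point R d x), (point R d w); split => //; [exact: KEE|exact: KFF].
apply: (@limit_distance KE KF t (10 * d%:R) n0) => //; first exact: ltW.
move=> N n0N.
have N0 : (0 < N)%N by exact: leq_trans n0N.
have [mu [mu0 mu_le mu_add mu_root mu_meets]] := finite_frostman KE lw0 (N * d)%N.
have [nu [nu0 nu_le nu_add nu_root nu_meets]] := finite_frostman KF lw0 (N * d)%N.
have add (rho' : word -> R) : (forall w, (size w < N * d)%N ->
    rho' w = rho' (rcons w false) + rho' (rcons w true)) ->
    forall k, (k < N * d)%N -> additive_at rho' k.
  by move=> h k kN w wk; apply: h; rewrite wk.
have mu_gr := cube_weight_growth (erefl y) mu_le.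
have nu_gr := cube_weight_growth (erefl y) nu_le.
have hmain : 768 * d%:R * 4 ^+ d * C / 2 ^+ u0 <
    (y ^+ n0) ^+ 2 / 2 ^+ d - 2 * y ^+ n0 * (y ^+ n0 - 1 + 2 * rho).
  apply: hW; rewrite -/q.
  exact: (main_term_bound q0 q1 (erefl rho) yn1 yn0).
pose M := (2 * N + 2 * u0 + 2)%N; pose m := (2 ^ (4 * u0 + 4 * N + M + 2))%N.
have C0 : 0 < C by lra.
have [x [th [hmu hnu]]] := @finite_level_positive R d d2 (Ordinal d0) t y C (2 * rho) n0 u0 N mu nu
  (introT andP (conj t0 t1)) y1 y48 yn2 n00 n0N (hZ0 _ hn0) C0 hC (add mu mu_add) (add nu nu_add)
  mu0 nu0 mu_gr nu_gr (le_trans cKE mu_root) (le_trans cKF nu_root) hmain.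
have hx : ~~ has id (take d (mkseq (digits x) (N * d))).
  by move: hnu; rewrite /cut; case: ifP => //; rewrite ltxx.
have hnu' : 0 < nu (mkseq (digits x) (N * d)).
  by apply: lt_le_trans hnu _; exact: cut_le.
have NM : (N <= M)%N by exact: leq_fine_scale.
have m0 : (0 < m)%N by rewrite expn_gt0.
have hd := @torus_distance R d M N (Ordinal d0) t m N0 NM m0 (introT andP (conj t0 t1)) x th hx.
have [wE KwE eE] := mu_meets _ (size_mkseq _ _) hmu.
have [wF KwF eF] := nu_meets _ (size_mkseq _ _) hnu'.
exists wE, wF; split => //.
rewrite size_mkseq in eE; rewrite size_mkseq in eF.
have appr (u : nat -> bool) (v : nat -> bool) (i : 'I_d) :
    mkseq u (N * d) = mkseq v (N * d) -> approx d u N i = approx d v N i.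
  move=> e; apply: eq_approx => // k kN.
  by have := congr1 (fun z => nth false z k) e; rewrite !nth_mkseq.
set S := \sum_(i < d) _ in hd.
have -> : 10 * d%:R / 2 ^+ N = 2 * d%:R * (2 / 2 ^+ N) + 6 * d%:R / 2 ^+ N :> R by lra.
apply: (le_trans (norm_sub_via _ S _)); apply: lerD hd.
apply: sum_sqr_sub_le => i.
- by apply: norm_sub_itv01; exact: point_itv01.
- by apply: norm_sub_itv01; exact: approx_itv01.
- rewrite -(appr _ _ i eE) -(appr _ _ i eF).
  have := point_approx_dist R wE N i; have := point_approx_dist R wF N i.
  set a := point R d wE 0 i; set b := point R d wF 0 i.
  set a' := (approx d wE N i)%:R / _; set b' := (approx d wF N i)%:R / _ => hy hx'.
  have -> : a - b - (a' - b') = (a - a') - (b - b') by ring.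
  by apply: (le_trans (ler_normB _ _)); lra.
Qed.

End Core.

(** * Choice of the constants *)

Section Intervals.
Variables (R : realType) (d : nat) (rho0 Z : R).
Hypotheses (rho01 : 0 < rho0 < 1) (Z1 : 1 <= Z).
Hypothesis large_content_distance : forall (t s : R) (E F : set 'rV[R]_d),
  0 < t <= 1 / 2 -> 0 < s <= d%:R ->
  d%:R - s <= 1 / 48 -> (Z / t) `^ (d%:R - s) <= 1 + rho0 ->
  borel_set E -> borel_set F -> E `<=` @unit_cube R d -> F `<=` @unit_cube R d ->
  ((1 - rho0)%:E <= dyadic_content s E)%E -> ((1 - rho0)%:E <= dyadic_content s F)%E ->
  distance_set E F t.

(** The condition of the previous theorem is hardest at the left end of the interval. *)
Lemma contain_itv (rho a b eps : R) : rho <= rho0 -> 0 < a -> b <= 1 / 2 ->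
  eps <= 1 / 48 -> (Z / a) `^ eps <= 1 + rho0 -> distances_contain_itv d rho a b eps.
Proof.
move=> rr a0 b1 eps1 hZ E F bE bF E1 F1 s s0d ds hmin t /=.
rewrite in_itv /= => /andP[at_ tb].
have t0 : 0 < t by apply: lt_le_trans at_.
have cc (A : set 'rV[R]_d) : ((1 - rho)%:E <= dyadic_content s A)%E ->
    ((1 - rho0)%:E <= dyadic_content s A)%E.
  by apply: le_trans; rewrite lee_fin lerB.
move: hmin; rewrite le_min => /andP[/cc cE /cc cF].
apply: (large_content_distance (s := s)) => //; first by rewrite t0 (le_trans tb).
  by lra.
have [s1 s2] := andP s0d.
have Za : 1 <= Z / a by rewrite ler_pdivlMr//; have := Z1; lra.
apply: le_trans hZ; apply: (@le_trans _ _ ((Z / a) `^ (d%:R - s))).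
  have Z0 : 0 <= Z by have := Z1; lra.
  apply: ge0_ler_powR; rewrite ?nnegrE ?subr_ge0// ?divr_ge0// ?(ltW t0) ?(ltW a0)//.
  by rewrite ler_wpM2l// lef_pV2.
by apply: ler_powR => //; lra.
Qed.

Lemma powR_le_of_ln (x e : R) : 1 <= x -> e * ln x <= ln (1 + rho0) -> x `^ e <= 1 + rho0.
Proof.
move=> x1 h; have x0 : 0 < x by lra.
have r1 : 0 < 1 + rho0 by case/andP: rho01; lra.
by rewrite /powR gt_eqF// -[leRHS]lnK ?posrE// ler_expR.
Qed.

Let lnr : 0 < ln (1 + rho0).
Proof. by rewrite ln_gt0//; case/andP: rho01; lra. Qed.

Let lnZ : 0 <= ln Z. Proof. exact: ln_ge0. Qed.

Lemma exists_eps (a : R) : 0 < a <= 1 / 2 ->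
  exists eps : R, 0 < eps <= 1 / 48 /\ (Z / a) `^ eps <= 1 + rho0.
Proof.
move=> /andP[a0 a1].
have Za : 1 < Z / a by rewrite ltr_pdivlMr//; have := Z1; lra.
have lnp : 0 < ln (Z / a) by exact: ln_gt0.
exists (Num.min (1 / 48) (ln (1 + rho0) / ln (Z / a))); split.
  by rewrite lt_min ge_min lexx divr_gt0//= divr_gt0.
apply: powR_le_of_ln; first exact: ltW.
by rewrite -ler_pdivlMr// ge_min lexx orbT.
Qed.

(** With this exponent [(Z / rho) `^ (rho / ln (1 / rho))] is at most
    [expR (rho * (1 + ln Z))] as soon as [ln (1 / rho)] is at least [1]. *)
Lemma exists_small_rho : exists rho1 : R, [/\ 0 < rho1, rho1 <= rho0 &
  forall rho, 0 < rho <= rho1 -> [/\ rho < 1, 0 < rho / ln (1 / rho),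
    rho / ln (1 / rho) <= rho, rho / ln (1 / rho) <= 1 / 48 &
    (Z / rho) `^ (rho / ln (1 / rho)) <= 1 + rho0]].
Proof.
have [r0 r1] := andP rho01.
have e0 : 0 < expR (- 1) :> R by exact: expR_gt0.
have q0 : 0 < ln (1 + rho0) / (1 + ln Z) by rewrite divr_gt0//; have := lnZ; lra.
exists (Num.min (Num.min rho0 (1 / 48)) (Num.min (expR (- 1)) (ln (1 + rho0) / (1 + ln Z)))).
split; first by rewrite !lt_min r0 e0 q0 andbT/= divr_gt0.
  by rewrite !ge_min lexx.
move=> rho /andP[p0]; rewrite !le_min => /andP[/andP[p1 p2] /andP[p3 p4]].
have ln1 : 1 <= ln (1 / rho).
  rewrite div1r lnV ?posrE// lerNr -[leRHS]expRK ler_ln ?posrE//.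
have lp : 0 < ln (1 / rho) by lra.
have le_rho : rho / ln (1 / rho) <= rho by rewrite ler_pdivrMr// ler_peMr// ltW.
split=> //; [lra|by rewrite divr_gt0|by apply: le_trans p2|].
have Zr : 1 <= Z / rho by rewrite ler_pdivlMr//; have := Z1; lra.
apply: powR_le_of_ln => //.
have Z0 : 0 < Z by have := Z1; lra.
have -> : ln (Z / rho) = ln Z + ln (1 / rho).
  by rewrite div1r lnM ?posrE ?invr_gt0.
move: p4; rewrite ler_pdivlMr; last by have := lnZ; lra.
apply: le_trans.
have -> : rho / ln (1 / rho) * (ln Z + ln (1 / rho)) = rho * (ln Z / ln (1 / rho) + 1).
  by field; rewrite gt_eqF.
rewrite ler_pM2l// addrC lerD2l ler_pdivrMr// ler_peMr//.
Qed.

(** Above the threshold [rk], where the power of [rho] could exceed one half, the fixed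
    interval from [1 / 4] to [1 / 2] serves. *)
Lemma exists_admissible (rho1 kappa : R) : 0 < rho1 -> rho1 <= rho0 ->
  (forall rho, 0 < rho <= rho1 -> [/\ rho < 1, 0 < rho / ln (1 / rho),
    rho / ln (1 / rho) <= rho, rho / ln (1 / rho) <= 1 / 48 &
    (Z / rho) `^ (rho / ln (1 / rho)) <= 1 + rho0]) ->
  0 < kappa < 1 ->
  exists a b eps : R -> R, admissible d rho1 a b eps /\
    exists rho_kappa : R, 0 < rho_kappa <= rho1 /\
      forall rho, 0 < rho <= rho_kappa ->
        [/\ a rho = rho `^ 1, b rho = a rho `^ kappa, b rho = rho `^ (1 * kappa) &
            eps rho = 1 * rho / ln (1 / rho)].
Proof.
move=> r10 r11 hr /andP[k0 k1].
have [eps0 [/andP[eps00 eps01] heps0]] : exists eps : R, 0 < eps <= 1 / 48 /\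
    (Z / (1 / 4)) `^ eps <= 1 + rho0 by apply: exists_eps; apply/andP; split; lra.
pose rk := Num.min rho1 ((1 / 2) `^ kappa^-1).
have rk0 : 0 < rk by rewrite lt_min r10/= powR_gt0// divr_gt0.
exists (fun rho => if rho <= rk then rho `^ 1 else 1 / 4),
  (fun rho => if rho <= rk then rho `^ (1 * kappa) else 1 / 2),
  (fun rho => if rho <= rk then 1 * rho / ln (1 / rho) else eps0).
split; last first.
  exists rk; rewrite rk0 ge_min lexx; split => // rho /andP[_ ->].
  by split => //; rewrite powRrM.
move=> rho /andP[p0 p1]; case: ifP => h.
  have [lt1 e1 e2 e3 e4] := hr rho (introT andP (conj p0 p1)).
  have p0' := ltW p0.
  rewrite (powRr1 p0') (mul1r rho) (mul1r kappa).
  have half : rho `^ kappa <= 1 / 2.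
    have h2 : rho <= (1 / 2) `^ kappa^-1 by apply: (le_trans h); rewrite ge_min lexx orbT.
    apply: (@le_trans _ _ (((1 / 2) `^ kappa^-1) `^ kappa)).
      by apply: ge0_ler_powR; rewrite ?nnegrE ?powR_ge0// ltW.
    by rewrite -powRrM mulVf ?gt_eqF// powRr1// ltW.
  split => //; last exact: (contain_itv (le_trans p1 r11) p0 half e3 e4).
  rewrite -[X in X < _](powRr1 p0').
  by rewrite /powR gt_eqF// ltr_expR ltr_nM2r// ln_lt0// p0.
split; [lra|lra|by []|].
have q4 : 0 < 1 / 4 :> R by lra.
exact: (contain_itv (le_trans p1 r11) q4 (lexx _) eps01 heps0).
Qed.

End Intervals.

Lemma cvg_at_right_sqrt_bound (R : realType) (f : R -> R) (delta : R) : 0 < delta ->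
  (forall rho, 0 < rho <= delta -> 0 <= f rho <= rho `^ (1 / 2)) ->
  f rho @[rho --> 0^'+] --> (0 : R).
Proof.
move=> d0 hf; apply/cvgr0Pnorm_lt => e e0; near=> rho.
have p0 : 0 < rho by near: rho; exact: nbhs_right_gt.
have pd : rho <= delta by near: rho; exact: nbhs_right_le.
have pe : rho < e ^+ 2 by near: rho; apply: nbhs_right_lt; rewrite exprn_gt0.
have /andP[f0 f1] := hf rho (introT andP (conj p0 pd)).
rewrite ger0_norm//; apply: (le_lt_trans f1).
have -> : e = (e ^+ 2) `^ (1 / 2).
  have e2 : 2%:R * (1 / 2) = 1 :> R by lra.
  by rewrite -(powR_mulrn 2 (ltW e0)) -powRrM e2 powRr1// ltW.
by apply: gt0_ltr_powR; rewrite ?nnegrE ?exprn_ge0// ltW.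
Unshelve. all: by end_near.
Qed.

Theorem theorem1p1 (R : realType) :
  (forall d : nat, (2 <= d)%N ->
    exists a b rho eps : R,
      [/\ 0 < a < 1, 0 < b < 1, a < b, 0 < rho < 1 & 0 < eps < 1] /\
      distances_contain_itv d rho a b eps)
  /\
  (forall d : nat, (2 <= d)%N ->
    exists rho_d : R, 0 < rho_d < 1 /\
      (exists a b eps : R -> R,
         admissible d rho_d a b eps /\
         [/\ a rho @[rho --> 0^'+] --> (0 : R),
             b rho @[rho --> 0^'+] --> (0 : R) &
             eps rho @[rho --> 0^'+] --> (0 : R)]) /\
      (exists c0 : R, 0 < c0 /\
         forall kappa : R, 0 < kappa < 1 ->
           exists a b eps : R -> R,
             admissible d rho_d a b eps /\
             exists rho_kappa : R, 0 < rho_kappa <= rho_d /\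
               forall rho : R, 0 < rho <= rho_kappa ->
                 [/\ a rho = rho `^ c0,
                     b rho = (a rho) `^ kappa,
                     b rho = rho `^ (c0 * kappa) &
                     eps rho = c0 * rho / ln (1 / rho)])).
Proof.
split=> d d2; have [rho0 [Z [rho01 Z1 hdist]]] := distance_of_large_content R d2.
  have q : 0 < (1 / 4 : R) <= 1 / 2 by apply/andP; split; lra.
  have [eps [/andP[eps0 eps1] heps]] := exists_eps rho01 Z1 q.
  exists (1 / 4), (1 / 2), rho0, eps; split.
    by split => //; try (apply/andP; split); lra.
  by apply: (contain_itv Z1 hdist) => //; lra.
have [rho1 [r10 r11 hr]] := exists_small_rho rho01 Z1.
exists rho1; split.
  by rewrite r10 /=; case/andP: rho01 => _; exact: le_lt_trans.
split; last first.
  exists 1; split => // kappa hk.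
  exact: (exists_admissible rho01 Z1 hdist r10 r11 hr hk).
have half : 0 < (1 / 2 : R) < 1 by apply/andP; split; lra.
have [a [b [eps [adm [rk [/andP[rk0 rk1] hrk]]]]]] :=
  exists_admissible rho01 Z1 hdist r10 r11 hr half.
exists a, b, eps; split => //.
have le_sqrt rho : 0 < rho -> rho < 1 -> rho <= rho `^ (1 / 2).
  move=> p0 p1; rewrite -[X in X <= _](powRr1 (ltW p0)).
  by rewrite /powR gt_eqF// ler_expR ler_nM2r ?ln_lt0 ?p0//; lra.
have facts rho : 0 < rho <= rk -> [/\ a rho = rho, b rho = rho `^ (1 / 2),
    0 <= eps rho <= rho & rho <= rho `^ (1 / 2)].
  move=> h; have [ha _ hb he] := hrk rho h.
  have [p0 p1] := andP h.
  have [lt1 e1 e2 _ _] := hr rho (introT andP (conj p0 (le_trans p1 rk1))).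
  rewrite mul1r in hb; rewrite mul1r in he; rewrite (powRr1 (ltW p0)) in ha.
  by split => //; [rewrite he e2 andbT; exact: ltW|exact: le_sqrt].
split; apply: (cvg_at_right_sqrt_bound rk0) => rho h; have [ha hb he hs] := facts rho h.
- by rewrite ha hs andbT; case/andP: h => /ltW.
- by rewrite hb powR_ge0 lexx.
- by case/andP: he => -> /le_trans ->.
Qed.
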